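(* Let $-\infty<a<b<\infty$ and $-\infty<c<d<\infty$ with either $b<c$ or $d<a$, let $x_1<\cdots<x_n$ be points in $[a,b]$ and $y_1<\cdots<y_n$ points in $[c,d]$, let $\underline{r},\underline{s}\in\mathbb{C}^{n}$, and let $L_n$ be the $n\times n$ L\''owner matrix with entries \[ (L_n)_{jk}=\frac{r_j-s_k}{x_j-y_k},\qquad 1\le j,k\le n. \] Let \[ \gamma=\frac{|c-a|\,|d-b|}{|c-b|\,|d-a|} \] be the absolute value of the cross-ratio of $a,b,c,d$. Then, for all integers $j\ge 1$ and $k\ge 0$ with $1\le j+2k\le n$, \[ \sigma_{j+2k}(L_n)\le 4\left[\exp\left(\frac{\pi^2}{4\mu(1/\sqrt{\gamma})}\right)\right]^{-2k}\sigma_j(L_n), \] where $\mu$ is the Gr\''otzsch ring function. If $0<a<b$, $c=-b$ and $d=-a$, then $2\mu(1/\sqrt{\gamma})=\mu(a/b)$. The bound remains valid if $4\mu(1/\sqrt{\gamma})$ is replaced by $2\log(16\gamma)$.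
   Context: $\sigma_1(L)\ge\cdots\ge\sigma_n(L)\ge 0$ denote the singular values of an $n\times n$ matrix $L$. The Gr\''otzsch ring function is $\mu(\lambda)=\frac{\pi}{2}\,K(\sqrt{1-\lambda^2})/K(\lambda)$ for $0<\lambda<1$, where $K(\lambda)=\int_0^1 \frac{dt}{\sqrt{(1-t^2)(1-\lambda^2t^2)}}$ is the complete elliptic integral of the first kind. *)

(* Defs.v *)
From HB Require Import structures.
From mathcomp Require Import all_boot all_order all_algebra.
From mathcomp Require Export complex.
From mathcomp Require Import all_classical all_reals all_analysis.

Set Implicit Arguments.
Unset Strict Implicit.
Unset Printing Implicit Defensive.

Import Order.TTheory GRing.Theory Num.Theory Num.Def.
Import numFieldNormedType.Exports.

Local Open Scope classical_set_scope.
Local Open Scope complex_scope.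
Local Open Scope sesquilinear_scope.
Local Open Scope ring_scope.

(* The integrand is read as 0 at t = 1, where its denominator vanishes; this
   is a Lebesgue-null set.  For 0 <= lambda < 1 the integral is finite. *)
Definition elliptic_K (R : realType) (lambda : R) : R :=
  (\int[lebesgue_measure]_(t in `[0, 1])
     (1 / Num.sqrt ((1 - t ^+ 2) * (1 - lambda ^+ 2 * t ^+ 2))))%R.

(* Meaningful for 0 < lambda < 1. *)
Definition grotzsch_mu (R : realType) (lambda : R) : R :=
  pi / 2 * (elliptic_K (Num.sqrt (1 - lambda ^+ 2)) / elliptic_K lambda).

(* The n roots, with multiplicity, of the characteristic polynomial. *)
Definition eigenvalues (C : numClosedFieldType) (n : nat) (A : 'M[C]_n) :
    seq C :=
  sval (closed_field_poly_normal (char_poly A)).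

(* The eigenvalues of L^* L are nonnegative reals, so that taking real parts
   only changes their type. *)
Definition singular_values (R : realType) (n : nat) (L : 'M[R[i]]_n) : seq R :=
  sort >=%R [seq Num.sqrt (complex.Re z) | z <- eigenvalues (L ^t* *m L)].

(* sigma_j, numbered from j = 1. *)
Definition singular_value (R : realType) (n : nat) (L : 'M[R[i]]_n)
    (j : nat) : R :=
  nth 0 (singular_values L) j.-1.

Definition loewner_mx (R : realType) (n : nat) (x y : 'I_n -> R)
    (r s : 'I_n -> R[i]) : 'M[R[i]]_n :=
  \matrix_(j, k) ((r j - s k) / (x j - y k)%:C).

Definition abs_cross_ratio (R : realType) (a b c d : R) : R :=
  (`|c - a| * `|d - b|) / (`|c - b| * `|d - a|).

(* Main.v *)
Require Import Defs.
From mathcomp Require Import all_boot all_order all_algebra.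
From mathcomp Require Import all_classical all_reals all_analysis.
From mathcomp Require Import measurable_realfun zify ring lra.

(** Write k pairs of affine functions (f, g) with f(s) g(t) - g(s) f(t)
    proportional to s - t, and let p and q be the products of the f and of the
    g.  In p(x_i) q(y_j) - q(x_i) p(y_j) the denominator x_i - y_j cancels
    factor by factor, so that the difference between diag(p/q at x) L diag(q/p at y) and L has rank at most
    2k.  The min-max characterization of singular values turns this into
    sigma_(j+2k) <= max_x |p/q| * max_y |q/p| * sigma_j ([loewner_decay]).  It
    remains to find p/q small on [a, b] and large on [c, d], and a Moebius map
    ([mobius_intervals]) reduces this to the intervals [1/s, s] and [-s, -1/s]
    with (s + 1/s)^2 = 4 gamma.  There p/q is taken to be the product of the
    (x - z)/(x + z) for k positive zeros z; its modulus at -x is the inverse of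
    its modulus at x, so a bound 2 h^k on [1/s, s] gives 4 h^(2k) in the end.

    The zeros come from the theta function theta(w) = sum_j w^j h^(j^2) on the
    unit circle, in the guise of the ratio f(w) = theta(w) / theta(-w).  Two
    addition formulas, which are changes of variables in a double series,
    together with the Jacobi triple product, write
    |f(w) - f(z)| / (f(w) + f(z)) as an infinite product in w z and w/z.  When
    z runs over the k-th roots of i these products collapse, and the product
    over z equals the same expression for h^k, w^k and i
    ([theta_ratio_multiplication]), which is at most 2 h^k.  By the intermediate
    value theorem f maps the circle onto [1/F, F] with F = f(1), hence the
    zeros f(z) do the job on that interval ([zolotarev_rational]).

    Finally F must be compared with s.  The modulus lambda(h) = F^(-2) obeys
    lambda(h^2) = 2 sqrt(lambda) / (1 + lambda), again by the addition
    formulas, and the substitution of Landen halves mu under the same map.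
    Squaring h therefore doubles mu at the complementary modulus, which stays
    above a multiple of the nome; since mu grows only logarithmically at 0,
    infinitely many squarings give
    mu(sqrt(1 - lambda(h)^2)) <= log(1/h) / 2 ([grotzsch_mu_theta]).  As
    mu(l) mu(sqrt(1 - l^2)) = pi^2/4, having F < s would force
    h <= exp(- pi^2 / (2 mu(s^(-2)))).  So every larger h is admissible, and
    letting h decrease to this value gives the first bound, because 1/sqrt(gamma)
    is the Landen transform of s^(-2) and mu(1/sqrt(gamma)) = mu(s^(-2)) / 2.
    The symmetric case is another instance of the Landen transform, and the last
    bound follows from mu(x) <= log(4/x) ([grotzsch_mu_log]), proved by the same
    iteration. *)

Set Implicit Arguments.
Unset Strict Implicit.
Unset Printing Implicit Defensive.

Import Order.TTheory GRing.Theory Num.Theory.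
Import numFieldNormedType.Exports.
Local Open Scope ring_scope.

(** * Variational bounds for singular values *)

Section SingularValues.
Local Open Scope complex_scope.
Local Open Scope sesquilinear_scope.

Lemma perm_eigenvalues (C : numClosedFieldType) n (A : 'M[C]_n) (s : seq C) :
  char_poly A = \prod_(z <- s) ('X - z%:P) -> perm_eq (eigenvalues A) s.
Proof.
move=> As; apply: prod_XsubC_eq; rewrite -As /eigenvalues.
case: (closed_field_poly_normal _) => t /= tE.
by rewrite [RHS]tE (eqP (char_poly_monic A)) scale1r.
Qed.

(** Kept with values in R[i], where the matrix products live; it is the square
    of the Euclidean norm, hence a nonnegative real. *)
Definition sqnorm {R : realType} n (u : 'rV[R[i]]_n) : R[i] :=
  (u *m u^t*) 0 0.

Lemma sqnormE (R : realType) n (u : 'rV[R[i]]_n) :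
  sqnorm u = \sum_i `|u 0 i| ^+ 2.
Proof.
rewrite /sqnorm mxE; apply: eq_bigr => i _.
by rewrite !mxE normCK.
Qed.

Lemma sqnorm_ge0 (R : realType) n (u : 'rV[R[i]]_n) : 0 <= sqnorm u.
Proof. by rewrite sqnormE sumr_ge0// => i _; rewrite exprn_ge0. Qed.

Lemma sqnorm_eq0 (R : realType) n (u : 'rV[R[i]]_n) :
  (sqnorm u == 0) = (u == 0).
Proof.
rewrite sqnormE psumr_eq0; last by move=> i _; rewrite exprn_ge0.
apply/allP/eqP => [h| -> i _ /=]; last by rewrite mxE normr0 expr0n.
apply/rowP => i; have := h i (mem_index_enum _).
rewrite /= mxE expf_eq0 normr_eq0 /= => /eqP ->.
done.
Qed.

Lemma trmxCM (C : numClosedFieldType) m n p (A : 'M[C]_(m, n))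
  (B : 'M[C]_(n, p)) : (A *m B)^t* = B^t* *m A^t*.
Proof. by rewrite trmx_mul map_mxM. Qed.

Lemma sqnorm_unitary (R : realType) n (P : 'M[R[i]]_n) (u : 'rV[R[i]]_n) :
  P \is unitarymx -> sqnorm (u *m P) = sqnorm u.
Proof.
by move=> uP; rewrite /sqnorm trmxCM mulmxA -(mulmxA u) (unitarymxP uP) mulmx1.
Qed.

(** Row vectors are used throughout, so L acts as u |-> u L^H.  In the
    orthonormal eigenbasis of the Gram matrix of L, given by the rows of P, the
    squared length of u L^H is a weighted sum of squared coordinates, and the
    weights d i are the squared singular values. *)
Lemma gram_spectral (R : realType) n (L : 'M[R[i]]_n) :
  exists P : 'M[R[i]]_n, exists d : 'I_n -> R,
  [/\ P \is unitarymx, forall i, 0 <= d i,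
   (forall u, sqnorm (u *m L^t*) =
       \sum_i (d i)%:C * `|(u *m P^t*) 0 i| ^+ 2) &
   singular_values L = sort >=%R [seq Num.sqrt (d i) | i : 'I_n]].
Proof.
pose A := L^t* *m L.
have AA : A \is hermsymmx.
  by apply/is_hermitianmxP; rewrite expr0 scale1r /A trmxCM trmxCK.
have /orthomx_spectralP := hermitian_normalmx AA.
set P := spectralmx A; set D := spectral_diag A => Aeq.
have uP : P \is unitarymx by exact: spectral_unitarymx.
rewrite invmx_unitary // in Aeq.
have quad u : sqnorm (u *m L^t*) = \sum_i D 0 i * `|(u *m P^t*) 0 i| ^+ 2.
  rewrite /sqnorm trmxCM trmxCK mulmxA -(mulmxA u) -/A Aeq.
  have yE : (u *m P^t*)^t* = P *m u^t* by rewrite trmxCM trmxCK.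
  rewrite !mulmxA -(mulmxA _ P) -yE mxE.
  set y := u *m P^t*; apply: eq_bigr => i _.
  by rewrite mul_mx_diag !mxE normCK mulrAC mulrC.
have D_ge0 i : 0 <= D 0 i.
  have := sqnorm_ge0 (row i P *m L^t*); rewrite quad.
  have -> : row i P *m P^t* = row i 1%:M.
    by rewrite -row_mul (unitarymxP uP).
  rewrite (bigD1 i) //= big1 => [|j /negbTE ji]; rewrite !mxE ?eqxx.
    by rewrite normr1 expr1n mulr1 addr0.
  by rewrite eq_sym ji normr0 expr0n mulr0.
have DR i : D 0 i = (complex.Re (D 0 i))%:C.
  by rewrite RRe_real // ger0_real.
exists P, (fun i => complex.Re (D 0 i)); split=> //.
- by move=> i; rewrite -ler0c -DR.
- by move=> u; rewrite quad; apply: eq_bigr => i _; rewrite -DR.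
rewrite /singular_values; apply/perm_sortP.
- by move=> x y; rewrite /= le_total.
- by move=> y x z /= h1 h2; apply: le_trans h2 h1.
- by move=> x y /= h; apply/eqP; rewrite eq_le andbC.
suff /(perm_map (fun z => Num.sqrt (complex.Re z))) :
    perm_eq (eigenvalues (L^t* *m L)) [seq D 0 i | i : 'I_n].
  by rewrite -map_comp.
apply: perm_eigenvalues; rewrite big_map big_enum /= -/A.
have PP : P^t* *m P = 1%:M by rewrite -invmx_unitary // mulVmx ?spectral_unit.
have PC : map_mx polyC (P^t* ) *m map_mx polyC P = 1%:M :> 'M[{poly R[i]}]_n.
  by rewrite -map_mxM PP map_mx1.
have -> : char_poly A = char_poly (diag_mx D).
  rewrite /char_poly Aeq; set Q := diag_mx D.
  have -> : char_poly_mx (P^t* *m Q *m P) =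
      map_mx polyC (P^t* ) *m char_poly_mx Q *m map_mx polyC P.
    rewrite /char_poly_mx !map_mxM /= mulmxBr mulmxBl mul_mx_scalar.
    by rewrite -scalemxAl PC scalemx1.
  by rewrite !det_mulmx mulrAC -det_mulmx PC det1 mul1r.
rewrite char_poly_trig ?diag_mx_is_trig//.
by apply: eq_bigr => i _; rewrite mxE eqxx mulr1n.
Qed.

(** This and the next lemma trade a statement on the position m in a decreasing
    list for a statement on the number of entries above a threshold, the form in
    which dimensions of eigenspaces appear. *)
Lemma count_gt_nth (R : realType) (s : seq R) (m : nat) (c : R) :
  sorted >=%R s -> (0 < m)%N -> 0 <= c -> c < nth 0 s m.-1 ->
  (m <= count (fun x => (c < x)%R) s)%N.
Proof.
move=> ss m0 c0 cm.
have ms : (m.-1 < size s)%N.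
  by rewrite ltnNge; apply/negP => /(nth_default 0) e; move: cm; rewrite e ltNge c0.
rewrite prednK // in ms.
rewrite -(cat_take_drop m s) count_cat -[X in (X <= _)%N]addn0 leq_add //.
suff : all (fun x => (c < x)%R) (take m s).
  by rewrite all_count size_takel // => /eqP ->.
apply/(all_nthP 0) => k; rewrite size_takel // => km.
rewrite nth_take //; apply: lt_le_trans cm _.
have gt : transitive (>=%R : rel R) by move=> y x z /= h1 h2; apply: le_trans h2 h1.
have := @sorted_leq_nth _ _ gt (@lexx _ _) 0 s ss k m.-1.
apply; rewrite ?inE; first exact: leq_trans km ms.
- by rewrite prednK.
- by rewrite -ltnS prednK.
Qed.

Lemma count_gt_nth_lt (R : realType) (s : seq R) (m : nat) :
  sorted >=%R s -> (0 < m)%N ->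
  (count (fun x => (nth 0 s m.-1 < x)%R) s < m)%N.
Proof.
move=> ss m0.
rewrite -[X in count _ X](cat_take_drop m.-1 s) count_cat.
rewrite [X in (_ + X)%N](_ : _ = 0%N) ?addn0.
  apply: leq_ltn_trans (count_size _ _) _; rewrite size_take_min.
  by rewrite (leq_ltn_trans (geq_minl _ _)) // prednK.
apply/eqP; rewrite -leqn0 leqNgt -has_count; apply/hasPn => x /(nthP 0) [k].
rewrite size_drop ltn_subRL => ks <-; rewrite nth_drop -leNgt.
have gt : transitive (>=%R : rel R) by move=> y a z /= h1 h2; apply: le_trans h2 h1.
have := @sorted_leq_nth _ _ gt (@lexx _ _) 0 s ss m.-1 (m.-1 + k).
apply; rewrite ?inE ?leq_addr //.
by apply: leq_ltn_trans ks; rewrite leq_addr.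
Qed.

Section Subspace.
Variables (R : realType) (n : nat) (P : 'M[R[i]]_n) (I : {set 'I_n}).
Hypothesis uP : P \is unitarymx.

Definition rows_of : 'M[R[i]]_(#|I|, n) := \matrix_(k < #|I|) row (enum_val k) P.

Lemma rank_rows_of : \rank rows_of = #|I|.
Proof.
apply: mxrank_unitary; apply/row_unitarymxP => i j.
rewrite !rowK (row_unitarymxP uP); congr (nat_of_bool _)%:R.
by apply/eqP/eqP => [/enum_val_inj|->].
Qed.

Lemma rows_of_coord (u : 'rV[R[i]]_n) i :
  (u <= rows_of)%MS -> i \notin I -> (u *m P^t* ) 0 i = 0.
Proof.
case/submxP => w -> iI; rewrite -mulmxA mxE big1 // => k _.
have -> : rows_of *m P^t* = \matrix_(k < #|I|) row (enum_val k) (1%:M : 'M[R[i]]_n).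
  by apply/row_matrixP => l; rewrite row_mul !rowK -row_mul (unitarymxP uP).
rewrite !mxE; case: eqP => [e|]; last by rewrite mulr0.
by move: iI; rewrite -e enum_valP.
Qed.

Lemma sqnorm_coord (u : 'rV[R[i]]_n) :
  sqnorm u = \sum_i `|(u *m P^t* ) 0 i| ^+ 2.
Proof. by rewrite -sqnormE sqnorm_unitary // trmxC_unitary. Qed.

End Subspace.

Lemma card_sqrt_gt (R : realType) n (d : 'I_n -> R) (c : R) :
  #|[set i | c < Num.sqrt (d i)]| =
  count (fun x => c < x) (sort >=%R [seq Num.sqrt (d i) | i : 'I_n]).
Proof.
rewrite count_sort count_map cardsE cardE enumT -size_filter /enum_mem.
by congr size; apply: eq_filter.
Qed.

Lemma sorted_sort_ge (R : realType) (s : seq R) : sorted >=%R (sort >=%R s).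
Proof. by apply: sort_sorted => x y /=; exact: le_total. Qed.

(** One half of the min-max principle: if sigma_m were larger than c, the m
    leading eigenvectors would span a space that meets V, by dimension, in a
    vector stretched by more than c. *)
Lemma singular_value_le (R : realType) n q (L : 'M[R[i]]_n) (V : 'M[R[i]]_(q, n))
    (m : nat) (c : R) :
  0 <= c -> (0 < m)%N -> (n < m + \rank V)%N ->
  (forall u : 'rV_n, (u <= V)%MS ->
     sqnorm (u *m L^t* ) <= (c ^+ 2)%:C * sqnorm u) ->
  singular_value L m <= c.
Proof.
move=> c0 m0 mV bV; rewrite leNgt; apply/negP => cm.
have [P [d [uP d0 qL sL]]] := gram_spectral L.
move: cm; rewrite /singular_value sL => /(count_gt_nth (sorted_sort_ge _) m0 c0).
rewrite -card_sqrt_gt; set I := [set i | _] => mI.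
(* W has dimension at least m and lengths are stretched by more than c on it. *)
pose W := rows_of P I.
have : (0 < \rank (V :&: W)%MS)%N.
  have key (a b e k : nat) : (a + b = e + k -> a <= n -> n < m + e -> m <= k ->
    0 < b)%N by lia.
  apply: (key _ _ _ #|I| _ (rank_leq_col (V + W)%MS) mV mI).
  by rewrite -[in RHS](rank_rows_of I uP) mxrank_sum_cap.
rewrite lt0n mxrank_eq0 => /rowV0Pn [u].
rewrite sub_capmx => /andP[uV uW] u0.
have /idP := bV u uV; apply/negP; rewrite qL (sqnorm_coord uP) mulr_sumr.
have yI i : i \notin I -> (u *m P^t* ) 0 i = 0 by exact: rows_of_coord.
have [i iI yi] : exists2 i, i \in I & (u *m P^t* ) 0 i != 0.
  case: (pickP (fun i => (i \in I) && ((u *m P^t* ) 0 i != 0))) => [i|h].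
    by case/andP => ? ?; exists i.
  move: u0; rewrite -sqnorm_eq0 (sqnorm_coord uP) big1 ?eqxx // => i _.
  have [iI|/yI ->] := boolP (i \in I); last by rewrite normr0 expr0n.
  by have := h i; rewrite iI /= => /negbFE/eqP ->; rewrite normr0 expr0n.
have lt_d j : j \in I -> (c ^+ 2)%:C < (d j)%:C.
  rewrite inE ltcR => cj.
  by rewrite -[d j]sqr_sqrtr // ltr_pXn2r // nnegrE ?sqrtr_ge0.
have le_y j : (c ^+ 2)%:C * `|(u *m P^t* ) 0 j| ^+ 2 <=
    (d j)%:C * `|(u *m P^t* ) 0 j| ^+ 2.
  have [/lt_d/ltW jI|/yI ->] := boolP (j \in I).
    by rewrite ler_wpM2r // exprn_ge0.
  by rewrite normr0 expr0n !mulr0.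
rewrite -real_ltNge; last 2 first.
- by apply/ger0_real/sumr_ge0 => j _; rewrite mulr_ge0 ?exprn_ge0 // ler0c ?exprn_ge0.
- by apply/ger0_real/sumr_ge0 => j _; rewrite mulr_ge0 ?exprn_ge0 // ler0c d0.
rewrite (bigD1 i) //= [ltRHS](bigD1 i) //= ltr_leD //.
  by rewrite ltr_pM2r ?lt_d // exprn_gt0 // normr_gt0.
by apply: ler_sum => j _.
Qed.

(** The other half of the min-max principle: the span of the eigenvectors whose
    singular value does not exceed sigma_m has codimension less than m. *)
Lemma singular_value_subspace (R : realType) n (L : 'M[R[i]]_n) (m : nat) :
  (0 < m)%N ->
  exists2 V : 'M[R[i]]_n, (n < m + \rank V)%N &
  forall u : 'rV_n, (u <= V)%MS ->
     sqnorm (u *m L^t* ) <= (singular_value L m ^+ 2)%:C * sqnorm u.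
Proof.
move=> m0; have [P [d [uP d0 qL sL]]] := gram_spectral L.
set c := singular_value L m.
pose I := [set i | c < Num.sqrt (d i)].
have Im : (#|I| < m)%N.
  by rewrite card_sqrt_gt /c /singular_value sL count_gt_nth_lt // sorted_sort_ge.
exists (<<rows_of P (~: I)>>)%MS.
  rewrite mxrank_gen rank_rows_of //.
  by rewrite -[X in (X < _)%N](card_ord n) -(cardsC I) ltn_add2r.
move=> u; rewrite genmxE => uV; rewrite qL (sqnorm_coord uP) mulr_sumr.
apply: ler_sum => i _.
have [iI|iI] := boolP (i \in ~: I); last first.
  by rewrite (rows_of_coord uP uV iI) normr0 expr0n !mulr0.
have dc : Num.sqrt (d i) <= c by move: iI; rewrite !inE -leNgt.
have c0 : 0 <= c := le_trans (sqrtr_ge0 (d i)) dc.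
rewrite ler_wpM2r ?exprn_ge0 // lecR -[d i]sqr_sqrtr //.
by rewrite ler_pXn2r // nnegrE sqrtr_ge0.
Qed.

End SingularValues.

(** * Decay of singular values from a rational function *)

Section LoewnerMatrices.
Local Open Scope complex_scope.
Local Open Scope sesquilinear_scope.

Lemma sqnorm_diag_le (R : realType) n (u d : 'rV[R[i]]_n) (A : R) :
  (forall j, `|d 0 j| <= A%:C) ->
  sqnorm (u *m diag_mx d) <= (A ^+ 2)%:C * sqnorm u.
Proof.
move=> dA; rewrite !sqnormE mulr_sumr; apply: ler_sum => j _.
rewrite mul_mx_diag mxE normrM exprMn mulrC ler_wpM2r ?exprn_ge0 //.
rewrite rmorphXn /= lerXn2r // ?nnegrE //.
exact: le_trans (dA j).
Qed.


Section Bezout.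
Variables (R : realType) (n : nat) (x y : 'I_n -> R) (r s : 'I_n -> R[i]).
Implicit Type fs : seq ((R -> R) * (R -> R)).
Hypothesis xy : forall i j, x i != y j.

Definition num_prod fs t := \prod_(f <- fs) f.1 t.
Definition den_prod fs t := \prod_(f <- fs) f.2 t.

(** The Bezout-type matrix of the rational function num_prod / den_prod,
    weighted by the numerators of the Loewner matrix. *)
Definition bezout_mx fs : 'M[R[i]]_n := \matrix_(i, j)
  ((r i - s j) / (x i - y j)%:C *
   (num_prod fs (x i) * den_prod fs (y j)
    - den_prod fs (x i) * num_prod fs (y j))%:C).

(** The product rule for p(x) q(y) - q(x) p(y) adds, for each new factor, a term
    in which x - y cancels; what is left of it is a combination (r_i - s_j) a_i
    b_j, of rank two. *)
Lemma rank_bezout fs :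
  (forall f, f \in fs -> exists c, forall a b,
     f.1 a * f.2 b - f.2 a * f.1 b = c * (a - b)) ->
  (\rank (bezout_mx fs) <= 2 * size fs)%N.
Proof.
elim: fs => [_|f fs IH hfs].
  rewrite (_ : bezout_mx _ = 0) ?mxrank0 //.
  by apply/matrixP => i j; rewrite !mxE /num_prod /den_prod !big_nil subrr mulr0.
have [c hc] := hfs f (mem_head _ _).
pose D1 : 'M[R[i]]_n := diag_mx (\row_i (f.1 (x i))%:C).
pose D2 : 'M[R[i]]_n := diag_mx (\row_i (f.2 (y i))%:C).
pose q1 : 'cV[R[i]]_n := \col_i (r i * (c * den_prod fs (x i))%:C).
pose q2 : 'cV[R[i]]_n := \col_i ((c * den_prod fs (x i))%:C).
pose p1 : 'rV[R[i]]_n := \row_j (num_prod fs (y j))%:C.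
pose p2 : 'rV[R[i]]_n := \row_j (s j * (num_prod fs (y j))%:C).
have -> : bezout_mx (f :: fs) = D1 *m bezout_mx fs *m D2 + (q1 *m p1 - q2 *m p2).
  apply/matrixP => i j; rewrite /bezout_mx !mul_mx_diag !mul_diag_mx !mxE.
  rewrite !big_ord1 !mxE /num_prod /den_prod !big_cons.
  set P := \prod_(f <- fs) f.1 (x i); set Q' := \prod_(f <- fs) f.2 (y j).
  set Q := \prod_(f <- fs) f.2 (x i); set P' := \prod_(f <- fs) f.1 (y j).
  have -> : f.1 (x i) * P * (f.2 (y j) * Q') - f.2 (x i) * Q * (f.1 (y j) * P')
      = f.1 (x i) * (P * Q' - Q * P') * f.2 (y j) + c * (x i - y j) * (Q * P').
    by rewrite -hc; ring.
  have d0 : (x i)%:C - (y j)%:C != 0 by rewrite -rmorphB fmorph_eq0 subr_eq0.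
  rewrite !(rmorphD, rmorphM) /=; field; exact: d0.
rewrite mulnS addnC; apply: leq_trans (mxrank_add _ _) _; apply: leq_add.
  apply: leq_trans (mxrankM_maxl _ _) _; apply: leq_trans (mxrankM_maxr _ _) _.
  by apply: IH => g gfs; apply: hfs; rewrite inE gfs orbT.
apply: leq_trans (mxrank_add _ _) _; rewrite mxrank_opp (@leq_add _ _ 1 1) //.
  by apply: leq_trans (mxrankM_maxl _ _) _; rewrite rank_leq_col.
by apply: leq_trans (mxrankM_maxl _ _) _; rewrite rank_leq_col.
Qed.

Lemma singular_value_ge0 (L : 'M[R[i]]_n) m : 0 <= singular_value L m.
Proof.
rewrite /singular_value; case: (ltnP m.-1 (size (singular_values L))) => h.
  have := mem_nth 0 h; rewrite /singular_values mem_sort => /mapP[z _ ->].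
  exact: sqrtr_ge0.
by rewrite nth_default.
Qed.

(** With R1 and R2 the diagonal matrices of values of p/q at x and of q/p at y,
    L = R1 L R2 - M where M has rank at most 2 * size fs.  On the vectors u
    annihilated by M and such that u R2 lies in the optimal subspace for
    sigma_m, the action of L is bounded by A B sigma_m; these vectors form a
    space of codimension less than m + 2 * size fs. *)
Lemma loewner_decay fs (A B : R) m :
  (forall f, f \in fs -> exists c, forall a b,
     f.1 a * f.2 b - f.2 a * f.1 b = c * (a - b)) ->
  (forall i, den_prod fs (x i) != 0) -> (forall i, num_prod fs (y i) != 0) ->
  (forall i, `|num_prod fs (x i) / den_prod fs (x i)| <= A) ->
  (forall i, `|den_prod fs (y i) / num_prod fs (y i)| <= B) ->
  0 <= A -> 0 <= B -> (0 < m)%N ->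
  singular_value (loewner_mx x y r s) (m + 2 * size fs) <=
    A * B * singular_value (loewner_mx x y r s) m.
Proof.
move=> hfs Q0 P0 hA hB A0 B0 m0; set L := loewner_mx x y r s.
pose R1 : 'rV[R[i]]_n := \row_i (num_prod fs (x i) / den_prod fs (x i))%:C.
pose R2 : 'rV[R[i]]_n := \row_i (den_prod fs (y i) / num_prod fs (y i))%:C.
pose S1 : 'rV[R[i]]_n := \row_i (den_prod fs (x i))^-1%:C.
pose S2 : 'rV[R[i]]_n := \row_i (num_prod fs (y i))^-1%:C.
pose M := diag_mx S1 *m bezout_mx fs *m diag_mx S2.
have LE : L = diag_mx R1 *m L *m diag_mx R2 - M.
  apply/matrixP => i j; rewrite /M /bezout_mx !mul_mx_diag !mul_diag_mx !mxE.
  have := P0 j; have := Q0 i.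
  set P := num_prod fs (x i); set Q' := den_prod fs (y j).
  set Q := den_prod fs (x i); set P' := num_prod fs (y j) => Q0' P0'.
  have : P%:C / Q%:C * (Q'%:C / P'%:C) - Q%:C^-1 * (P * Q' - Q * P')%:C * P'%:C^-1 = 1.
    rewrite !(rmorphB, rmorphM) /=; field.
    by rewrite !fmorph_eq0 Q0' P0'.
  rewrite !(rmorphM, fmorphV) /= => e.
  by rewrite -[LHS]mulr1 -e; ring.
have rM : (\rank M <= 2 * size fs)%N.
  apply: leq_trans (mxrankM_maxl _ _) _; apply: leq_trans (mxrankM_maxr _ _) _.
  exact: rank_bezout.
have [V rV hV] := singular_value_subspace L m0.
have trD (d : 'rV[R[i]]_n) : (forall i, d 0 i \is Num.real) ->
    (diag_mx d)^t* = diag_mx d.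
  move=> dr; rewrite tr_diag_mx; apply/matrixP => i j; rewrite !mxE rmorphMn /=.
  by rewrite conj_Creal.
have R1r : (diag_mx R1)^t* = diag_mx R1.
  by apply: trD => i; rewrite mxE; apply/complex_realP; eexists.
have R2r : (diag_mx R2)^t* = diag_mx R2.
  by apply: trD => i; rewrite mxE; apply/complex_realP; eexists.
(* W consists of the u with u M^H = 0 and u R2 in V. *)
pose W := kermx (row_mx (M^t* ) (diag_mx R2 *m cokermx V)).
apply: (@singular_value_le _ _ _ L W).
- by rewrite !mulr_ge0 // singular_value_ge0.
- by rewrite addn_gt0 m0.
- rewrite mxrank_ker.
  have h1 : (\rank (row_mx (M^t* ) (diag_mx R2 *m cokermx V)) <=
      2 * size fs + (n - \rank V))%N.
    rewrite -mxrank_tr tr_row_mx -addsmxE.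
    apply: leq_trans (mxrank_adds_leqif _ _) _; apply: leq_add.
      by rewrite mxrank_tr mxrank_map mxrank_tr.
    rewrite mxrank_tr; apply: leq_trans (mxrankM_maxr _ _) _.
    by rewrite mxrank_coker.
  have h2 := rank_leq_col V.
  by apply: leq_trans (_ : n < m + 2 * size fs + (n - (2 * size fs + (n - \rank V))))%N _;
    [move: (\rank V) rV h2 => e; lia | rewrite leq_add2l leq_sub2l].
move=> u /sub_kermxP; rewrite mul_mx_row => /eqP.
rewrite row_mx_eq0 => /andP[/eqP uM].
rewrite mulmxA => /eqP uV.
have {}uV : (u *m diag_mx R2 <= V)%MS by rewrite submxE uV.
have -> : u *m L^t* = u *m diag_mx R2 *m L^t* *m diag_mx R1.
  rewrite {1}LE linearB /= map_mxB mulmxBr uM subr0.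
  by rewrite !trmxCM R1r R2r !mulmxA.
have toC (t e : R) : `|t| <= e -> `|t%:C| <= e%:C.
  move=> te; rewrite normc_def /= expr0n /= addr0 lecR sqrtr_sqr //.
apply: le_trans (sqnorm_diag_le (A := A) _ _) _.
  by move=> j; rewrite mxE; exact: toC.
set t := singular_value L m.
have -> : ((A * B * t) ^+ 2)%:C = (A ^+ 2)%:C * ((t ^+ 2)%:C * (B ^+ 2)%:C).
  by rewrite -!rmorphM /=; congr _%:C; ring.
rewrite -!mulrA ler_wpM2l ?ler0c ?exprn_ge0 //.
apply: le_trans (hV _ uV) _.
rewrite ler_wpM2l ?ler0c ?exprn_ge0 ?singular_value_ge0 //.
apply: sqnorm_diag_le => j; rewrite mxE; exact: toC.
Qed.
End Bezout.

End LoewnerMatrices.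

(** * The q-binomial theorem and the finite triple product *)

Section QBinomial.
Local Open Scope complex_scope.

(** The q-Pochhammer symbol (q; q)_n for q = p^2; the square keeps all later
    exponents integral. *)
Definition qfact (F : fieldType) (p : F) (n : nat) : F :=
  \prod_(m < n) (1 - p ^+ (2 * m.+1)).

(** The Gaussian binomial coefficient for q = p^2. *)
Definition qbinom (F : fieldType) (p : F) (n j : nat) : F :=
  qfact p n / (qfact p j * qfact p (n - j)).

Lemma qfactS (F : fieldType) (p : F) n :
  qfact p n.+1 = qfact p n * (1 - p ^+ (2 * n.+1)).
Proof. by rewrite /qfact big_ord_recr. Qed.

Section Qbinomial.
Variables (F : fieldType) (p : F).
Hypothesis p1 : forall n, p ^+ (2 * n.+1) != 1.

Lemma qfact_neq0 n : qfact p n != 0.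
Proof. by apply/prodf_neq0 => m _; rewrite subr_eq0 eq_sym p1. Qed.

Lemma qbinom0 n : qbinom p n 0 = 1.
Proof. by rewrite /qbinom subn0 {2}/qfact big_ord0 mul1r divff ?qfact_neq0. Qed.

Lemma qbinomnn n : qbinom p n n = 1.
Proof. by rewrite /qbinom subnn {3}/qfact big_ord0 mulr1 divff ?qfact_neq0. Qed.

Lemma qbinom_pascal n j : (j < n)%N ->
  qbinom p n.+1 j.+1 = qbinom p n j.+1 + p ^+ (2 * (n - j)) * qbinom p n j.
Proof.
move=> jn; have [k ->] : exists k, n = (j + k.+1)%N.
  by exists (n - j.+1)%N; rewrite addnS -addSn subnKC.
rewrite /qbinom subSS !addKn.
rewrite (_ : (j + k.+1 - j.+1)%N = k); last by lia.
rewrite !qfactS.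
have a0 := qfact_neq0 j; have b0 := qfact_neq0 k.
have c0 : 1 - p ^+ (2 * j.+1) != 0 by rewrite subr_eq0 eq_sym.
have d0 : 1 - p ^+ (2 * k.+1) != 0 by rewrite subr_eq0 eq_sym.
have -> : p ^+ (2 * (j + k.+1).+1) = p ^+ (2 * j.+1) * p ^+ (2 * k.+1).
  by rewrite -exprD; congr (_ ^+ _); lia.
by field; rewrite a0 b0 c0 d0.
Qed.

Lemma qbinomial_theorem (y : F) n :
  \prod_(m < n) (1 + y * p ^+ (2 * m).+1) =
  \sum_(j < n.+1) p ^+ (j ^ 2) * qbinom p n j * y ^+ j.
Proof.
elim: n => [|n IH].
  by rewrite big_ord0 big_ord_recl big_ord0 /= qbinom0 !expr0 !mulr1 addr0.
rewrite big_ord_recr /= IH mulrDr mulr1.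
rewrite [in RHS]big_ord_recl /= !expr0 qbinom0 [in RHS]big_ord_recr /=.
rewrite {1}big_ord_recl /= !expr0 qbinom0 [X in _ + X * _]big_ord_recr /=.
rewrite !qbinomnn -!addrA; congr (_ + _).
rewrite mulrDl addrA; congr (_ + _); last first.
  rewrite -[bump 0 n]/(n.+1) (_ : (n.+1 ^ 2 = n ^ 2 + (2 * n).+1)%N); last by lia.
  by rewrite exprD [y ^+ n.+1]exprS; move: (_ ^+ (2 * n).+1) => e; ring.
rewrite mulr_suml -big_split; apply: eq_bigr => j _ /=.
rewrite -![bump 0 j]/(j.+1) qbinom_pascal // [in RHS]mulrDr [in RHS]mulrDl.
congr (_ + _).
have -> : p ^+ (j.+1 ^ 2) * (p ^+ (2 * (n - j)) * qbinom p n j) =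
   p ^+ (j ^ 2) * p ^+ (2 * n).+1 * qbinom p n j.
  rewrite mulrA -!exprD; congr (_ ^+ _ * _); have := ltn_ord j; lia.
by rewrite [y ^+ j.+1]exprS; ring.
Qed.

End Qbinomial.

(** The interval from - N to N, listed by pairs of opposite integers so that
    symmetric sums can be handled by induction on N. *)
Fixpoint zrange (N : nat) : seq int :=
  if N is N'.+1 then [:: N%:Z, - N%:Z & zrange N'] else [:: 0].

Lemma mem_zrange N (j : int) : (j \in zrange N) = (`|j| <= N)%N.
Proof.
elim: N => [|N IH]; first by rewrite /= inE; lia.
by rewrite /= !inE IH; lia.
Qed.

Lemma uniq_zrange N : uniq (zrange N).
Proof.
elim: N => [|N IH] //; rewrite /= IH !inE !mem_zrange andbT; lia.
Qed.

Lemma sum_zrange (V : nmodType) N (f : int -> V) :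
  \sum_(i < (2 * N).+1) f (i%:Z - N%:Z) = \sum_(j <- zrange N) f j.
Proof.
rewrite -(big_mkord predT (fun i => f (i%:Z - N%:Z))) -(big_map (fun i : nat => i%:Z - N%:Z) predT).
apply: perm_big; apply: uniq_perm (uniq_zrange N) _.
  by rewrite map_inj_uniq ?iota_uniq // => a b; lia.
move=> j; rewrite mem_zrange; apply/mapP/idP => [ [k]|jN].
  by rewrite mem_index_iota => h ->; lia.
by exists (absz (j + N%:Z)); rewrite ?mem_index_iota; lia.
Qed.

(** The general term of the theta series, in the sign convention for which the
    triple product has factors 1 - u p^(2m-1) and 1 - u^-1 p^(2m-1). *)
Definition theta_term (F : fieldType) (p u : F) (j : int) : F :=
  (- u) ^ j * p ^+ (`|j| ^ 2).

(** This is the q-binomial theorem for 2N factors at y = - u p^(-2N): half of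
    the factors are the 1 - u p^(2m-1), the other half become the 1 - u^-1
    p^(2m-1) once a monomial is extracted from each of them.  As N grows it
    turns into the Jacobi triple product. *)
Lemma finite_triple_product (F : fieldType) (p u : F) N :
  (forall n, p ^+ (2 * n.+1) != 1) -> p != 0 -> u != 0 ->
  \prod_(m < N) ((1 - u * p ^+ (2 * m).+1) * (1 - u^-1 * p ^+ (2 * m).+1)) =
  \sum_(i < (2 * N).+1) theta_term p u (i%:Z - N%:Z) * qbinom p (2 * N) i.
Proof.
move=> p1 p0 u0; have Nu0 : - u != 0 by rewrite oppr_eq0.
have := qbinomial_theorem p1 (- u * p ^- (2 * N)) (2 * N).
have split2 (f : nat -> F) :
    \prod_(m < 2 * N) f m = \prod_(m < N) f m * \prod_(m < N) f (N + m)%N.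
  by rewrite mul2n -addnn big_split_ord.
rewrite (split2 (fun m => 1 + - u * p ^- (2 * N) * p ^+ (2 * m).+1)).
have -> : \prod_(i < N) (1 + - u * p ^- (2 * N) * p ^+ (2 * (N + i)).+1) =
    \prod_(i < N) (1 - u * p ^+ (2 * i).+1).
  apply: eq_bigr => i _; rewrite mulnDr -addnS exprD mulrA mulrVK ?mulNr //.
  by rewrite unitfE expf_neq0.
have -> : \prod_(i < N) (1 + - u * p ^- (2 * N) * p ^+ (2 * i).+1) =
    (- u) ^+ N * p ^- (N ^ 2) * \prod_(i < N) (1 - u^-1 * p ^+ (2 * i).+1).
  rewrite (reindex_inj rev_ord_inj) /=.
  transitivity (\prod_(i < N) (- u * p ^- (2 * i).+1 * (1 - u^-1 * p ^+ (2 * i).+1))).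
    apply: eq_bigr => i _.
    have -> : (2 * (N - i.+1)).+1 = (2 * N - (2 * i).+1)%N by have := ltn_ord i; lia.
    rewrite expfB //; last by have := ltn_ord i; lia.
    have a0 : p ^+ (2 * N) != 0 by rewrite expf_neq0.
    have b0 : p ^+ (2 * i).+1 != 0 by rewrite expf_neq0.
    by field; rewrite a0 b0 u0.
  rewrite big_split /=; congr (_ * _).
  rewrite big_split /= prodr_const card_ord; congr (_ * _).
  rewrite prodfV; congr (_^-1).
  elim: (N) => [|n IH]; first by rewrite big_ord0.
  rewrite big_ord_recr /= IH -exprD; congr (_ ^+ _); lia.
move=> /(congr1 (fun t => t * ((- u) ^- N * p ^+ (N ^ 2)))) e.
rewrite big_split /=.
have a0 : p ^+ (N ^ 2) != 0 by rewrite expf_neq0.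
have b0 : (- u) ^+ N != 0 by rewrite expf_neq0.
transitivity (\sum_(j < (2 * N).+1)
      p ^+ (j ^ 2) * qbinom p (2 * N) j * (- u * p ^- (2 * N)) ^+ j *
    ((- u) ^- N * p ^+ (N ^ 2))).
  by rewrite -mulr_suml -e; field; rewrite a0 b0.
apply: eq_bigr => j _; rewrite /theta_term.
rewrite expfzDr // exprMn exprVn -[(- u) ^ (j : nat)]/((- u) ^+ j) -invr_expz -[(- u) ^ N]/((- u) ^+ N).
have -> : p ^+ (`|j%:Z - N%:Z| ^ 2) = p ^+ (j ^ 2) * p ^- (2 * N * j) * p ^+ (N ^ 2).
  apply: (mulIf (expf_neq0 (2 * N * j) p0)); rewrite mulrAC mulfVK ?expf_neq0 //.
  rewrite -!exprD; congr (_ ^+ _); lia.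
rewrite -exprM; ring.
Qed.

End QBinomial.

(** * Theta sums and theta products *)

Section TripleProductLimit.
Local Open Scope complex_scope.
Local Open Scope classical_set_scope.

(** The norm of R[i] takes its values in R[i]; limits and order arguments need a
    real-valued modulus. *)
Definition cmod {R : realType} (z : R[i]) : R := complex.Re `|z|.

Section Cmod.
Variable R : realType.
Implicit Types z w : R[i].

Lemma cmodE z : `|z| = (cmod z)%:C.
Proof. by rewrite /cmod RRe_real // normr_real. Qed.

Lemma cmodM z w : cmod (z * w) = cmod z * cmod w.
Proof. by apply: (@complexI R); rewrite -cmodE normrM !cmodE rmorphM. Qed.

Lemma cmod_ge0 z : 0 <= cmod z.
Proof. by rewrite -ler0c -cmodE. Qed.

Lemma cmodD z w : cmod (z + w) <= cmod z + cmod w.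
Proof. by rewrite -lecR -cmodE rmorphD /= -!cmodE ler_normD. Qed.

Lemma cmodN z : cmod (- z) = cmod z.
Proof. by rewrite /cmod normrN. Qed.

Lemma cmodBC z w : cmod (z - w) = cmod (w - z).
Proof. by rewrite -cmodN opprB. Qed.

Lemma cmod_real (x : R) : cmod x%:C = `|x|.
Proof. by rewrite /cmod normc_def /= expr0n /= addr0 sqrtr_sqr. Qed.

Lemma cmod1 : cmod 1 = 1 :> R.
Proof. by rewrite /cmod normr1. Qed.

Lemma cmodV z : cmod z^-1 = (cmod z)^-1.
Proof. by apply: (@complexI R); rewrite -cmodE normfV cmodE fmorphV. Qed.

Lemma cmodX z n : cmod (z ^+ n) = cmod z ^+ n.
Proof. by apply: (@complexI R); rewrite -cmodE normrX cmodE rmorphXn. Qed.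

Lemma cmod_eq0 z : (cmod z == 0) = (z == 0).
Proof. by rewrite -(inj_eq (@complexI R)) -cmodE normr_eq0. Qed.

Lemma cmod_sum I (s : seq I) (P : pred I) (F : I -> R[i]) :
  cmod (\sum_(i <- s | P i) F i) <= \sum_(i <- s | P i) cmod (F i).
Proof.
elim/big_rec2: _ => [|i y1 y2 _ h]; first by rewrite /cmod normr0.
by rewrite (le_trans (cmodD _ _)) // lerD2l.
Qed.

Lemma cmod_prod I (s : seq I) (P : pred I) (F : I -> R[i]) :
  cmod (\prod_(i <- s | P i) F i) = \prod_(i <- s | P i) cmod (F i).
Proof. by elim/big_rec2: _ => [|i y1 y2 _ <-]; rewrite ?cmod1 ?cmodM. Qed.

Lemma cmod_dist z w : `|cmod z - cmod w| <= cmod (z - w).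
Proof.
rewrite ler_norml lerBrDr lerBlDr; apply/andP; split.
  by rewrite addrC lerBlDl cmodBC -{1}(subrK z w) (le_trans (cmodD _ _)) // addrC.
by rewrite -{1}(subrK w z) cmodD.
Qed.

Lemma cmod1V z : cmod z = 1 -> z^-1 = z^*.
Proof.
move=> z1; have z0 : z != 0 by rewrite -cmod_eq0 z1 oner_eq0.
by apply: (mulfI z0); rewrite mulfV // -sqr_normc cmodE z1 expr1n.
Qed.

End Cmod.

Section QfactLimit.
Variables (R : realType) (p : R).
Hypothesis p01 : 0 < p < 1.

Let p0 : 0 < p. Proof. by case/andP: p01. Qed.
Let p1 : p < 1. Proof. by case/andP: p01. Qed.

Lemma qpow_neq1 n : p ^+ (2 * n.+1) != 1.
Proof. by rewrite lt_eqF // exprn_ilt1 // ltW. Qed.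

Lemma qfact_gt0 n : 0 < qfact p n.
Proof. by apply: prodr_gt0 => m _; rewrite subr_gt0 exprn_ilt1 // ltW. Qed.

Lemma qfact_noninc : nonincreasing_seq (qfact p).
Proof.
apply/nonincreasing_seqP => n; rewrite qfactS ger_pMr ?qfact_gt0 //.
by rewrite lerBlDr lerDl exprn_ge0 // ltW.
Qed.

Lemma qfact_le1 n : qfact p n <= 1.
Proof.
by apply: le_trans (qfact_noninc (leq0n n)) _; rewrite /qfact big_ord0.
Qed.

Let q01 : 0 < 1 - p ^+ 2.
Proof. by rewrite subr_gt0 exprn_ilt1 // ltW. Qed.

(** A product of factors 1 - e_m is at least one minus the sum of the e_m, here
    a geometric sum. *)
Lemma qfact_lower n k : qfact p n * (1 - p ^+ (2 * n) / (1 - p ^+ 2)) <= qfact p (n + k).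
Proof.
suff : qfact p n * (1 - (p ^+ (2 * n.+1) - p ^+ (2 * (n + k).+1)) / (1 - p ^+ 2))
    <= qfact p (n + k).
  apply: le_trans; rewrite ler_wpM2l ?(ltW (qfact_gt0 _)) // lerB //.
  rewrite ler_wpM2r ?invr_ge0 ?(ltW q01) //.
  have : p ^+ (2 * n.+1) <= p ^+ (2 * n) by apply: ler_wiXn2l; [exact: ltW|exact: ltW|lia].
  by have := exprn_ge0 (2 * (n + k).+1) (ltW p0); lra.
elim: k => [|k IH]; first by rewrite addn0 subrr mul0r subr0 mulr1.
rewrite addnS qfactS.
have a0 := exprn_ge0 (2 * (n + k).+1) (ltW p0).
have b1 : qfact p (n + k) <= qfact p n by apply: qfact_noninc; rewrite leq_addr.
apply: le_trans (_ : qfact p (n + k) - qfact p n * p ^+ (2 * (n + k).+1) <= _); last first.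
  by rewrite mulrBr mulr1 lerB // ler_wpM2r.
apply: le_trans (lerB IH (lexx _)).
rewrite -mulrBr ler_wpM2l ?(ltW (qfact_gt0 _)) //.
rewrite (_ : (2 * (n + k).+2 = 2 * (n + k).+1 + 2)%N); last by lia.
rewrite exprD; move: (p ^+ (2 * (n + k).+1)) (p ^+ (2 * n.+1)) => A B.
have q0 := lt0r_neq0 q01; set q := p ^+ 2 in q0 *.
by rewrite le_eqVlt; apply/orP; left; apply/eqP; field.
Qed.

(** The infinite product of the 1 - p^(2m), the constant of the Jacobi triple
    product. *)
Definition qfact_lim := limn (qfact p).

Lemma qfact_cvg : qfact p @ \oo --> qfact_lim.
Proof.
apply: nonincreasing_is_cvgn; first exact: qfact_noninc.
by exists 0 => _ [n _ <-]; rewrite ltW ?qfact_gt0.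
Qed.

Lemma qfact_lim_le n : qfact_lim <= qfact p n.
Proof. by apply: nonincreasing_cvgn_ge => //; [exact: qfact_noninc|exact: qfact_cvg]. Qed.

Lemma qfact_lim_lower n :
  qfact p n * (1 - p ^+ (2 * n) / (1 - p ^+ 2)) <= qfact_lim.
Proof.
apply: limr_ge; first exact: qfact_cvg.
near=> m; rewrite -(@subnKC n m); first exact: qfact_lower.
by near: m; exact: nbhs_infty_ge.
Unshelve. all: end_near. Qed.

Lemma qfact_lim_gt0 : 0 < qfact_lim.
Proof.
have : (fun n => p ^+ (2 * n) / (1 - p ^+ 2)) @ \oo --> (0 : R).
  rewrite -[X in _ --> X](mul0r (1 - p ^+ 2)^-1); apply: cvgMl.
  under eq_fun do rewrite exprM.
  by apply: cvg_expr; rewrite ger0_norm ?exprn_ge0 ?ltW // -subr_gt0.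
move=> /cvgrPdist_lt /(_ 1 ltr01) [n _ /(_ n (leqnn _))] /=.
rewrite sub0r normrN => /ltr_normlW h; apply: lt_le_trans (qfact_lim_lower n).
by rewrite mulr_gt0 ?qfact_gt0 // subr_gt0.
Qed.

Lemma qfact_lim_dist n : qfact p n - qfact_lim <= p ^+ (2 * n) / (1 - p ^+ 2).
Proof.
have := qfact_lim_lower n; have := qfact_le1 n; have := qfact_gt0 n.
have : 0 <= p ^+ (2 * n) / (1 - p ^+ 2).
  by rewrite divr_ge0 ?exprn_ge0 // ltW.
move: (qfact p n) (_ / _) => a b b0 a0 a1; nra.
Qed.

(** The Gaussian binomials at N + j of row 2N tend to the inverse of the
    constant of the triple product, with an error that deteriorates as j
    approaches N; there the factor p^(j^2) of the theta series compensates for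
    it. *)
Lemma qbinom_dist N (j : int) : (`|j| <= N)%N ->
  `|qfact_lim * qbinom p (2 * N) (absz (j + N%:Z)) - 1| <=
  3 / ((1 - p ^+ 2) * qfact_lim ^+ 2) * p ^+ (2 * (N - `|j|)).
Proof.
move=> jN; set i := absz _; have iN : (i <= 2 * N)%N by lia.
rewrite /qbinom.
set G := qfact_lim; have G0 : 0 < G := qfact_lim_gt0.
set a := qfact p (2 * N); set b := qfact p i; set c := qfact p _.
have [Ga Gb Gc] : [/\ G <= a, G <= b & G <= c] by split; exact: qfact_lim_le.
set d := p ^+ (2 * (N - `|j|)) / (1 - p ^+ 2).
have bd n : (N - `|j| <= n)%N -> qfact p n - G <= d.
  move=> h; apply: le_trans (qfact_lim_dist n) _.
  rewrite ler_wpM2r ?invr_ge0 ?(ltW q01) //.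
  by apply: ler_wiXn2l; [exact: ltW|exact: ltW|lia].
have [da db dc] : [/\ a - G <= d, b - G <= d & c - G <= d].
  by split; apply: bd; lia.
have [a1 b1 c1] : [/\ a <= 1, b <= 1 & c <= 1] by split; exact: qfact_le1.
have bc0 : 0 < b * c by rewrite mulr_gt0 // (lt_le_trans G0).
have -> : G * (a / (b * c)) - 1 = (G * a - b * c) / (b * c).
  by field; rewrite !lt0r_neq0 // (lt_le_trans G0).
rewrite normrM normfV (gtr0_norm bc0) ler_pdivrMr //.
have -> : 3 / ((1 - p ^+ 2) * G ^+ 2) * p ^+ (2 * (N - `|j|)) = 3 * d / G ^+ 2.
  by rewrite /d; field; rewrite !lt0r_neq0.
have G2 : G ^+ 2 <= b * c by rewrite expr2 ler_pM // ltW.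
have d0 : 0 <= d by apply: le_trans db; rewrite subr_ge0.
apply: (@le_trans _ _ (3 * d)).
  rewrite ler_norml; apply/andP; split; nra.
by rewrite mulrAC ler_pdivlMr ?exprn_gt0 // ler_wpM2l // mulr_ge0.
Qed.

End QfactLimit.

Definition theta_sum {R : realType} (p : R) (u : R[i]) (N : nat) : R[i] :=
  \sum_(j <- zrange N) theta_term p%:C u j.

Definition theta_prod {R : realType} (p : R) (u : R[i]) (N : nat) : R[i] :=
  \prod_(m < N) ((1 - u * p%:C ^+ (2 * m).+1) * (1 - u^-1 * p%:C ^+ (2 * m).+1)).

Lemma qbinom_morph (F K : fieldType) (f : {rmorphism F -> K}) (p : F) n j :
  f (qbinom p n j) = qbinom (f p) n j.
Proof.
have fq m : f (qfact p m) = qfact (f p) m.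
  by rewrite rmorph_prod; apply: eq_bigr => l _; rewrite rmorphB rmorph1 rmorphXn.
by rewrite fmorph_div rmorphM /= !fq.
Qed.

Lemma nat_expr_bound (R : realFieldType) (p : R) n : 0 <= p < 1 ->
  n%:R * p ^+ n <= (1 - p)^-1.
Proof.
move=> /andP[p0 p1]; have q0 : 0 < 1 - p by rewrite subr_gt0.
rewrite -[leRHS]mul1r ler_pdivlMr //.
have -> : n%:R * p ^+ n = \sum_(i < n) p ^+ n.
  by rewrite sumr_const card_ord mulr_natl.
apply: le_trans (_ : (\sum_(i < n) p ^+ i) * (1 - p) <= _).
  rewrite ler_wpM2r ?(ltW q0) //; apply: ler_sum => i _.
  by apply: ler_wiXn2l; [exact: p0|exact: ltW|exact: ltnW].
rewrite mulrC -opprB mulNr -subrX1 opprB lerBlDr lerDl exprn_ge0 //.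
Qed.

Lemma size_zrange N : size (zrange N) = (2 * N).+1.
Proof. by elim: N => //= N ->; lia. Qed.

Section TripleProduct.
Variables (R : realType) (p : R).
Hypothesis p01 : 0 < p < 1.

Let p0 : 0 < p. Proof. by case/andP: p01. Qed.
Let p1 : p < 1. Proof. by case/andP: p01. Qed.

(** The closed annulus p <= |u| <= 1/p is needed, and not only the unit circle,
    because the second addition formula evaluates theta sums on the boundary |u|
    = 1/p.  This costs |j| in the exponent. *)
Lemma cmod_theta_term (u : R[i]) (j : int) :
  u != 0 -> cmod u <= p^-1 -> cmod u^-1 <= p^-1 ->
  cmod (theta_term p%:C u j) <= p ^+ (`|j| ^ 2 - `|j|).
Proof.
move=> u0 u1 u2; rewrite /theta_term cmodM cmodX cmod_real gtr0_norm //.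
have : cmod ((- u) ^ j) <= p ^- `|j|.
  have pw (v : R[i]) n : cmod v <= p^-1 -> cmod (v ^+ n) <= p ^- n.
    move=> v1; rewrite cmodX -exprVn; apply: lerXn2r => //.
      by rewrite nnegrE cmod_ge0.
    by rewrite nnegrE invr_ge0 ltW.
  case: j => n.
    by rewrite -exprnP exprNn cmodM cmodX cmodN cmod1 expr1n mul1r; exact: pw.
  rewrite NegzE -invr_expz -exprnP abszN absz_nat -exprVn invrN exprNn.
  by rewrite cmodM cmodX cmodN cmod1 expr1n mul1r; exact: pw.
move=> h; apply: le_trans (ler_wpM2r _ h) _; first by rewrite exprn_ge0 // ltW.
rewrite mulrC -expfB_cond //.
by rewrite gt_eqF //= ?add0n; nia.
Qed.

(** A quantitative form of the Jacobi triple product.  Each of the 2N + 1 terms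
    has error O(p^(2N)), and the number of terms is absorbed by half of this
    decay. *)
Lemma triple_product_dist : exists K, forall u : R[i],
  u != 0 -> cmod u <= p^-1 -> cmod u^-1 <= p^-1 -> forall N,
  cmod ((qfact_lim p)%:C * theta_prod p u N - theta_sum p u N) <= K * p ^+ N.
Proof.
set G := qfact_lim p.
pose C := 3 / ((1 - p ^+ 2) * G ^+ 2).
have C0 : 0 <= C.
  rewrite divr_ge0 // mulr_ge0 ?exprn_ge0 ?(ltW (qfact_lim_gt0 p01)) //.
  by rewrite subr_ge0 exprn_ile1 // ltW.
exists (C * p ^- 2 * (2 * (1 - p)^-1 + 1)) => u u0 u1 u2 N.
have pC1 n : p%:C ^+ (2 * n.+1) != 1 :> R[i].
  by rewrite -rmorphXn -(rmorph1 (real_complex R)) (inj_eq (@complexI R)) qpow_neq1.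
have pC0 : p%:C != 0 :> R[i] by rewrite fmorph_eq0 gt_eqF.
rewrite /theta_prod finite_triple_product //.
have -> : \sum_(i < (2 * N).+1) theta_term p%:C u (i%:Z - N%:Z) * qbinom p%:C (2 * N) i =
   \sum_(j <- zrange N) theta_term p%:C u j * (qbinom p (2 * N) (absz (j + N%:Z)))%:C.
  rewrite -sum_zrange; apply: eq_bigr => i _.
  by rewrite subrK absz_nat (qbinom_morph (real_complex R)).
rewrite mulr_sumr /theta_sum -sumrB.
apply: le_trans (cmod_sum _ _ _) _.
have bnd j : j \in zrange N ->
   cmod (G%:C * (theta_term p%:C u j * (qbinom p (2 * N) (absz (j + N%:Z)))%:C)
     - theta_term p%:C u j) <= C * p ^- 2 * p ^+ (2 * N).
  rewrite mem_zrange => jN.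
  have -> : G%:C * (theta_term p%:C u j * (qbinom p (2 * N) (absz (j + N%:Z)))%:C)
     - theta_term p%:C u j =
     theta_term p%:C u j * (G * qbinom p (2 * N) (absz (j + N%:Z)) - 1)%:C.
    move: (qbinom _ _ _) (theta_term _ _ _) => b t.
    by rewrite rmorphB rmorphM rmorph1 /=; ring.
  rewrite cmodM cmod_real.
  apply: le_trans (ler_pM (cmod_ge0 _) (normr_ge0 _) (cmod_theta_term _ u0 u1 u2)
     (qbinom_dist p01 jN)) _.
  rewrite mulrCA -mulrA ler_wpM2l // -exprD.
  rewrite ler_pdivlMl ?exprn_gt0 // -exprD.
  apply: ler_wiXn2l; [exact: ltW|exact: ltW|].
  move: jN; move: (absz j) => k; have : (3 * k <= k * k + 2)%N by case: k => [|[|k]]; nia.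
  move=> h1 h2; have h3 : (k ^ 2 = k * k)%N by []; lia.
rewrite big_seq; apply: le_trans (ler_sum _ bnd) _.
rewrite -big_seq big_const_seq count_predT size_zrange iter_addr addr0.
rewrite -[leLHS]mulr_natr -!(mulrA (C / p ^+ 2)) ler_wpM2l //.
  by rewrite divr_ge0 // exprn_ge0 // ltW.
have := nat_expr_bound N (_ : 0 <= p < 1); rewrite p1 ltW // => /(_ isT) h.
have pN : p ^+ N <= 1 by rewrite exprn_ile1 // ltW.
have pN0 : 0 <= p ^+ N by rewrite exprn_ge0 // ltW.
rewrite mul2n -addnn exprD -[(N + N).+1]addn1 !natrD.
rewrite -(mulrA (p ^+ N)) [leRHS]mulrC ler_wpM2l //.
by move: h; set a := p ^+ N in pN pN0 *; set b := (1 - p)^-1; set c := N%:R; nra.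
Qed.

End TripleProduct.

End TripleProductLimit.

(** * Addition formulas for theta sums *)

Section AdditionFormulas.
Local Open Scope complex_scope.
Local Open Scope classical_set_scope.

Definition zbox N : seq (int * int) :=
  [seq (i, j) | i <- zrange N, j <- zrange N].

Lemma mem_zbox N (x : int * int) :
  (x \in zbox N) = (`|x.1| <= N)%N && (`|x.2| <= N)%N.
Proof.
apply/allpairsP/andP => [[y [h1 h2 ->]]|[h1 h2]].
  by rewrite !mem_zrange in h1 h2.
by exists x; rewrite !mem_zrange; case: x h1 h2.
Qed.

Lemma uniq_zbox N : uniq (zbox N).
Proof.
by apply: allpairs_uniq; rewrite ?uniq_zrange // => -[a b] [c d] _ _ [-> ->].
Qed.

Lemma big_subseq_mem (T : eqType) (V : nmodType) (s t : seq T) (F : T -> V) :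
  uniq s -> uniq t -> {subset s <= t} ->
  \sum_(x <- t | x \in s) F x = \sum_(x <- s) F x.
Proof.
move=> us ut st; rewrite -big_filter; apply: perm_big.
apply: uniq_perm => //; first exact: filter_uniq.
by move=> x; rewrite mem_filter; case: (boolP (x \in s)) => //= /st ->.
Qed.

Section DoubleSum.
Variables (R : realType) (h : R).
Hypothesis h01 : 0 < h < 1.

Let h0 : 0 < h. Proof. by case/andP: h01. Qed.
Let h1 : h < 1. Proof. by case/andP: h01. Qed.

Let t N : R := \sum_(j <- zrange N) h ^+ (`|j| ^ 2).

Let tS N : t N.+1 = 2 * h ^+ (N.+1 ^ 2) + t N.
Proof.
rewrite /t /= !big_cons abszN !absz_nat; set x := h ^+ _; ring.
Qed.

Let t_ge0 N : 0 <= t N.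
Proof. by apply: sumr_ge0 => j _; rewrite exprn_ge0 // ltW. Qed.

Let tail N k : t (N + k) - t N <= 2 / (1 - h) * h ^+ N.
Proof.
have q0 : 0 < 1 - h by rewrite subr_gt0.
suff H : t (N + k) - t N <= 2 / (1 - h) * (h ^+ N - h ^+ (N + k)).
  apply: le_trans H _; rewrite ler_wpM2l ?divr_ge0 // ?(ltW q0) //.
  by rewrite lerBlDr lerDl exprn_ge0 // ltW.
elim: k => [|k IH]; first by rewrite addn0 !subrr mulr0.
rewrite addnS tS -addrA.
have e : h ^+ ((N + k).+1 ^ 2) <= h ^+ (N + k).
  by apply: ler_wiXn2l; [exact: ltW|exact: ltW|nia].
apply: le_trans (lerD (ler_wpM2l _ e) IH) _ => //.
rewrite [h ^+ (N + k).+1]exprS le_eqVlt; apply/orP; left; apply/eqP.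
by field; rewrite lt0r_neq0.
Qed.

(** Justifies a change of variables f in an absolutely convergent double series
    directly on truncations: f maps the square of size N into a larger square,
    within the original square the image misses only points where A vanishes,
    and the points outside contribute a tail of the squared theta series. *)
Lemma double_sum_rotate (A : int * int -> R[i]) (f : int * int -> int * int) :
  injective f ->
  (forall x, cmod (A x) <= 2 * (h ^+ (`|x.1| ^ 2) * h ^+ (`|x.2| ^ 2))) ->
  (forall N x, x \in zbox N -> A x != 0 -> exists2 y, y \in zbox N & x = f y) ->
  (forall N x, x \in zbox N -> f x \in zbox (2 * N).+2) ->
  exists K, forall N,
   cmod (\sum_(x <- zbox (2 * N).+2) A x - \sum_(y <- zbox N) A (f y)) <= K * h ^+ N.
Proof.
move=> finj Ah fsurj fbox.
pose T := 1 + 2 / (1 - h).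
have tT N : t N <= T.
  have := tail 0 N; rewrite add0n mulr1 lerBlDl => /le_trans; apply.
  by rewrite lerD2r /t /= big_seq1 expr0.
exists (2 * (2 / (1 - h) * (2 * T))) => N.
set M := (2 * N).+2.
have -> : \sum_(y <- zbox N) A (f y) = \sum_(x <- zbox M | x \in map f (zbox N)) A x.
  rewrite big_subseq_mem ?big_map ?uniq_zbox // ?map_inj_uniq ?uniq_zbox //.
  by move=> _ /mapP[y yN ->]; exact: fbox.
rewrite (bigID [in map f (zbox N)]) /= addrAC subrr add0r.
pose a (x : int * int) := h ^+ (`|x.1| ^ 2) * h ^+ (`|x.2| ^ 2).
have a0 x : 0 <= a x by rewrite mulr_ge0 // exprn_ge0 // ltW.
have sa L : \sum_(x <- zbox L) a x = t L ^+ 2.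
  rewrite /zbox big_allpairs_dep /= expr2 /t mulr_suml; apply: eq_bigr => i _.
  by rewrite mulr_sumr.
apply: le_trans (cmod_sum _ _ _) _.
apply: le_trans (_ : \sum_(x <- zbox M | x \notin zbox N) 2 * a x <= _).
  rewrite big_mkcond [leRHS]big_mkcond; apply: ler_sum => x _.
  have [xN|xN] := boolP (x \in zbox N); have [xf|xf] /= := boolP (x \in map f _) => //.
  - have [->|Ax] := eqVneq (A x) 0; first by rewrite /cmod normr0.
    by have [y yN e] := fsurj N x xN Ax; rewrite e map_f in xf.
  - by rewrite mulr_ge0.
have sNM : {subset zbox N <= zbox M}.
  by move=> x; rewrite !mem_zbox /M; lia.
have := big_subseq_mem a (uniq_zbox N) (uniq_zbox M) sNM; rewrite sa => eN.
have := sa M; rewrite (bigID [in zbox N]) /= eN => eM.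
rewrite -mulr_sumr -[leRHS]mulrA; apply: ler_wpM2l => //.
have -> : \sum_(x <- zbox M | x \notin zbox N) a x = t M ^+ 2 - t N ^+ 2.
  by rewrite -eM addrAC subrr add0r.
(* M = N + (N + 2): the tail bound from N covers the larger square. *)
have := tail N (N.+2); rewrite (_ : (N + N.+2)%N = M); last by rewrite /M; lia.
have := tT N; have := tT M; have := t_ge0 N; have := t_ge0 M.
have dM : t N <= t M.
  rewrite -subr_ge0; have : t M ^+ 2 - t N ^+ 2 >= 0.
    by rewrite -eM addrAC subrr add0r sumr_ge0.
  by rewrite subr_sqr; have := t_ge0 N; have := t_ge0 M; nra.
move=> c1 c2 c3 c4 c5; rewrite [leRHS]mulrAC; set d := _ / _ * h ^+ N.
rewrite subr_sqr -/d in c5 *.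
by apply: ler_pM; rewrite ?subr_ge0 ?addr_ge0 //; lra.
Qed.

End DoubleSum.

Lemma exprz_sign (F : fieldType) (j : int) :
  (-1 : F) ^ j = (-1) ^+ odd `|j|.
Proof.
case: j => n; rewrite ?NegzE; first by rewrite -exprnP signr_odd.
by rewrite -invr_expz -exprnP abszN absz_nat signr_odd -exprVn invrN1.
Qed.

Section ThetaAddition.
Variables (R : realType) (h : R).
Hypothesis h01 : 0 < h < 1.
Let h0 : 0 < h. Proof. by case/andP: h01. Qed.

Let ttermE (p u : R[i]) j : theta_term p u j = (-1) ^+ odd `|j| * u ^ j * p ^+ (`|j| ^ 2).
Proof. by rewrite /theta_term -[- u]mulN1r expfzMl exprz_sign. Qed.

Let cmod_unit (w : R[i]) j : cmod w = 1 -> cmod (w ^ j) = 1.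
Proof.
move=> w1; case: j => n; first by rewrite -exprnP cmodX w1 expr1n.
by rewrite NegzE -invr_expz -exprnP cmodV cmodX w1 expr1n invr1.
Qed.

Let box_prod (u v u' v' : R[i]) (e : R[i]) N :
  theta_sum h u N * theta_sum h v N + e * (theta_sum h u' N * theta_sum h v' N) =
  \sum_(x <- zbox N) (theta_term h%:C u x.1 * theta_term h%:C v x.2 +
                      e * (theta_term h%:C u' x.1 * theta_term h%:C v' x.2)).
Proof.
rewrite /zbox big_allpairs_dep /= !(big_distrlr, mulr_sumr) /= -big_split.
by apply: eq_bigr => i _ /=; rewrite mulr_sumr -big_split.
Qed.

Let ttermE_N (p u : R[i]) j : theta_term p (- u) j = u ^ j * p ^+ (`|j| ^ 2).
Proof. by rewrite /theta_term opprK. Qed.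

Let cmod_AE (w z : R[i]) (e : bool) (x : int * int) : cmod w = 1 -> cmod z = 1 ->
  cmod (theta_term h%:C (- w) x.1 * theta_term h%:C z x.2 +
       (-1) ^+ e * (theta_term h%:C w x.1 * theta_term h%:C (- z) x.2)) <=
  2 * (h ^+ (`|x.1| ^ 2) * h ^+ (`|x.2| ^ 2)).
Proof.
move=> w1 z1; apply: le_trans (cmodD _ _) _.
rewrite mulr2n mulrDl mul1r !ttermE_N !ttermE.
have s1 (b : bool) : cmod ((-1) ^+ b : R[i]) = 1 by rewrite cmodX cmodN cmod1 expr1n.
by rewrite !(cmodM, cmodX, s1) !cmodN !cmod1 !expr1n !cmod_unit // !cmod_real
  (gtr0_norm h0) !mul1r.
Qed.

Let H := h%:C.
Let H0 : H != 0. Proof. by rewrite fmorph_eq0 gt_eqF. Qed.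

Let sqE (x : int) : H ^+ (`|x| ^ 2) = H ^ (x * x).
Proof. by rewrite exprnP; congr (_ ^ _); nia. Qed.

Let psqE (x : int) : (h ^+ 2)%:C ^+ (`|x| ^ 2) = H ^ (2 * (x * x)).
Proof.
by rewrite rmorphXn /= -exprM exprnP; congr (_ ^ _); nia.
Qed.

Let sgD (m n : int) : (-1 : R[i]) ^+ odd `|m + n| = (-1) ^+ odd `|m| * (-1) ^+ odd `|n|.
Proof. by rewrite -!exprz_sign expfzDr // oppr_eq0 oner_eq0. Qed.

(** In the product of two series with general terms indexed by m and n, the
    combination with a plus sign keeps the pairs of equal parity, which are
    parametrized by (m, n) = (a + b, a - b); the exponent m^2 + n^2 becomes 2
    (a^2 + b^2), so the two sums separate with h replaced by h^2. *)
Lemma theta_addition (w z : R[i]) : cmod w = 1 -> cmod z = 1 ->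
  exists K, forall N,
  cmod (theta_sum h (- w) (2 * N).+2 * theta_sum h z (2 * N).+2 +
        theta_sum h w (2 * N).+2 * theta_sum h (- z) (2 * N).+2
      - 2 * (theta_sum (h ^+ 2) (w * z) N * theta_sum (h ^+ 2) (w / z) N)) <= K * h ^+ N.
Proof.
move=> w1 z1.
have w0 : w != 0 by rewrite -cmod_eq0 w1 oner_eq0.
have z0 : z != 0 by rewrite -cmod_eq0 z1 oner_eq0.
pose A (x : int * int) := theta_term h%:C (- w) x.1 * theta_term h%:C z x.2 +
       (-1) ^+ false * (theta_term h%:C w x.1 * theta_term h%:C (- z) x.2).
pose f (x : int * int) := (x.1 + x.2, x.1 - x.2).
have [||||K hK] := @double_sum_rotate R h h01 A f.
- by move=> [a b] [c d] [] ? ?; congr pair; lia.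
- by move=> x; exact: cmod_AE.
- move=> N [m n]; rewrite mem_zbox /= => mn; rewrite /A /= expr0 mul1r.
  rewrite !ttermE_N !ttermE => A0.
  have mnE : odd `|m| = odd `|n|.
    apply/eqP; apply: contraNT A0 => mn'; apply/eqP.
    by move: mn'; case: (odd `|m|); case: (odd `|n|) => //= _; ring.
  (* m + n is even here, so these quotients are exact and stay in the square of
     size N. *)
  exists (((m + n) %/ 2)%Z, ((m - n) %/ 2)%Z).
    by rewrite mem_zbox /=; lia.
  by rewrite /f /=; congr pair; lia.
- by move=> N [m n]; rewrite !mem_zbox /f /=; lia.
exists K => N; have := hK N; rewrite -box_prod expr0 mul1r.
congr (cmod (_ - _) <= _).
rewrite /zbox big_allpairs_dep /= big_distrlr /= mulr_sumr.
apply: eq_bigr => m _; rewrite mulr_sumr; apply: eq_bigr => n _.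
rewrite /A /f /= expr0 mul1r !ttermE_N !ttermE !sqE !psqE.
rewrite (_ : odd `|m - n| = odd `|m + n|); last by lia.
rewrite sgD !expfzMl !expfzDr // !(exprz_inv, invr_expz).
have : H ^ ((m + n) * (m + n)) * H ^ ((m - n) * (m - n)) =
    H ^ (2 * (m * m)) * H ^ (2 * (n * n)).
  by rewrite -!expfzDr //; congr (_ ^ _); ring.
do 4 move: (H ^ _) => ?; move=> e.
ring: e.
Qed.

(** The combination with a minus sign keeps the pairs of opposite parity,
    parametrized by (m, n) = (a + b - 1, a - b).  The shift by one produces the
    factor h / w and moves the arguments to the circle of radius h^(-2). *)
Lemma theta_subtraction (w z : R[i]) : cmod w = 1 -> cmod z = 1 ->
  exists K, forall N,
  cmod (theta_sum h (- w) (2 * N).+2 * theta_sum h z (2 * N).+2 -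
        theta_sum h w (2 * N).+2 * theta_sum h (- z) (2 * N).+2
      - 2 * h%:C * w^-1 * (theta_sum (h ^+ 2) (w * z / (h ^+ 2)%:C) N *
             theta_sum (h ^+ 2) (w / z / (h ^+ 2)%:C) N)) <= K * h ^+ N.
Proof.
move=> w1 z1.
have w0 : w != 0 by rewrite -cmod_eq0 w1 oner_eq0.
have z0 : z != 0 by rewrite -cmod_eq0 z1 oner_eq0.
pose A (x : int * int) := theta_term h%:C (- w) x.1 * theta_term h%:C z x.2 +
       (-1) ^+ true * (theta_term h%:C w x.1 * theta_term h%:C (- z) x.2).
pose f (x : int * int) := (x.1 + x.2 - 1, x.1 - x.2).
have [||||K hK] := @double_sum_rotate R h h01 A f.
- by move=> [a b] [c d] [] ? ?; congr pair; lia.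
- by move=> x; exact: cmod_AE.
- move=> N [m n]; rewrite mem_zbox /= => mn; rewrite /A /= expr1 mulN1r.
  rewrite !ttermE_N !ttermE => A0.
  have mnE : odd `|m| != odd `|n|.
    apply: contraNN A0 => /eqP ->; apply/eqP; ring.
  (* m + n is odd here; the shift by one makes both quotients exact. *)
  exists (((m + n + 1) %/ 2)%Z, ((m - n + 1) %/ 2)%Z).
    by rewrite mem_zbox /=; lia.
  by rewrite /f /=; congr pair; lia.
- by move=> N [m n]; rewrite !mem_zbox /f /=; lia.
exists K => N; have := hK N; rewrite -box_prod expr1 mulN1r.
congr (cmod (_ - _) <= _).
rewrite /zbox big_allpairs_dep /= big_distrlr /= mulr_sumr.
apply: eq_bigr => m _; rewrite mulr_sumr; apply: eq_bigr => n _.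
rewrite /A /f /= expr1 mulN1r !ttermE_N !ttermE !sqE !psqE.
rewrite (_ : odd `|m - n| = odd `|m + n|); last by lia.
rewrite (_ : odd (absz (m + n - 1)%R) = ~~ odd (absz (m + n)%R)); last by lia.
rewrite signrN sgD !expfzMl ![w ^ (_ - _)]expfzDr // ![w ^ (_ + _)]expfzDr //.
rewrite [z ^ (_ - _)]expfzDr // !(exprz_inv, invr_expz).
have pE (j : int) : (h ^+ 2)%:C ^ (- j) = H ^ (- (2 * j)).
  by rewrite rmorphXn /= exprnP exprz_exp; congr (_ ^ _); ring.
rewrite !pE.
have e : H ^ ((m + n - 1) * (m + n - 1)) * H ^ ((m - n) * (m - n)) =
    H * H ^ (- (2 * m)) * H ^ (2 * (m * m)) * H ^ (- (2 * n)) * H ^ (2 * (n * n)).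
  by rewrite -[X in _ = X * _ * _ * _ * _]expr1z -!expfzDr //; congr (_ ^ _); ring.
rewrite exprN1 -/H; move: e; do 6 move: (H ^ _) => ?; move=> e.
ring: e.
Qed.
End ThetaAddition.

End AdditionFormulas.

(** * The theta function on the unit circle *)

Section ThetaOnTheCircle.
Local Open Scope complex_scope.
Local Open Scope classical_set_scope.

Section GeometricError.
Variable R : realType.

Lemma cvg_geo0 (K h : R) : 0 < h < 1 -> (fun N => K * h ^+ N) @ \oo --> (0 : R).
Proof.
move=> /andP[h0 h1]; rewrite -[X in _ --> X](mulr0 K).
by apply: cvgMr; apply: cvg_expr; rewrite gtr0_norm.
Qed.

Lemma cvg_geo_dist (K h : R) (a b : nat -> R) (l : R) : 0 < h < 1 ->
  (forall N, `|a N - b N| <= K * h ^+ N) -> a @ \oo --> l -> b @ \oo --> l.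
Proof.
move=> h01 ab al.
have ab0 : (fun N => a N - b N) @ \oo --> (0 : R).
  apply: (@squeeze_cvgr _ _ _ _ (fun N => - (K * h ^+ N)) (fun N => K * h ^+ N)).
  - by near=> N; rewrite -ler_norml.
  - by rewrite -oppr0; apply: cvgN; exact: cvg_geo0.
  - exact: cvg_geo0.
rewrite -[l]subr0 (_ : b = (fun N => a N - (a N - b N))); last first.
  by apply/funext => N; rewrite subKr.
exact: cvgB.
Unshelve. all: end_near. Qed.

Lemma is_cvg_geo (K h : R) (a : nat -> R) : 0 < h < 1 ->
  (forall N, `|a N.+1 - a N| <= K * h ^+ N) -> cvgn a.
Proof.
move=> h01 ha; have [h0 h1] := andP h01.
have : cvgn (series (telescope a)).
  apply: normed_cvg; apply: (@series_le_cvg _ _ (geometric K h)).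
  - by move=> n /=.
  - by move=> n /=; exact: le_trans (normr_ge0 _) (ha n).
  - by move=> n /=; exact: ha.
  - by apply: is_cvg_geometric_series; rewrite gtr0_norm.
rewrite (_ : series _ = (fun N => a N - a 0%N)); last first.
  by apply/funext => N; rewrite telescopeK.
move=> /cvg_ex[l hl]; suff : a @ \oo --> (l + a 0%N : R) by move/cvgP.
have e : (fun N => (a N - a 0%N) + a 0%N) = a by apply/funext => N; rewrite subrK.
by rewrite -[X in X @ \oo --> _]e; apply: cvgD => //; exact: cvg_cst.
Qed.

End GeometricError.

Section ThetaFunction.
Variables (R : realType) (h : R).
Hypothesis h01 : 0 < h < 1.
Let h0 : 0 < h. Proof. by case/andP: h01. Qed.
Let h1 : h < 1. Proof. by case/andP: h01. Qed.
Implicit Types w z u : R[i].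

(** The sum of w^j h^(j^2) over all integers j.  For w on the unit circle the
    terms for j and - j are conjugate, so the partial sums are real and taking
    real parts loses nothing. *)
Definition theta_fun w : R := limn (fun N => complex.Re (theta_sum h (- w) N)).

Lemma theta_sumS u N :
  theta_sum h u N.+1 =
  ((- u) ^+ N.+1 + (- u) ^- N.+1) * h%:C ^+ (N.+1 ^ 2) + theta_sum h u N.
Proof.
rewrite /theta_sum /= !big_cons addrA /theta_term abszN !absz_nat -mulrDl.
by rewrite -invr_expz -!exprnP.
Qed.

Let unitX w n : cmod w = 1 -> w ^+ n + w ^- n = (2 * complex.Re (w ^+ n))%:C.
Proof.
move=> w1; rewrite cmod1V; first by rewrite addcJ rmorphM rmorph_nat.
by rewrite cmodX w1 expr1n.
Qed.

Lemma theta_sum_real w N : cmod w = 1 ->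
  theta_sum h (- w) N = (complex.Re (theta_sum h (- w) N))%:C.
Proof.
move=> w1; apply/esym/RRe_real; elim: N => [|N IH].
  by rewrite /theta_sum big_seq1 /theta_term expr0 mulr1 expr0z real1.
rewrite theta_sumS opprK unitX // -rmorphXn -rmorphM rpredD //.
by apply/complex_realP; eexists.
Qed.

Lemma Re_theta_sumS w N : cmod w = 1 ->
  complex.Re (theta_sum h (- w) N.+1) =
  2 * complex.Re (w ^+ N.+1) * h ^+ (N.+1 ^ 2) + complex.Re (theta_sum h (- w) N).
Proof.
move=> w1; apply: (@complexI R); rewrite -theta_sum_real //.
rewrite theta_sumS opprK unitX // (theta_sum_real _ w1).
by rewrite rmorphD !rmorphM rmorphXn.
Qed.

Lemma Re_le_cmod z : `|complex.Re z| <= cmod z.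
Proof. by rewrite -lecR -cmodE normc_ge_Re. Qed.

Lemma Re_theta_sum_step w N : cmod w = 1 ->
  `|complex.Re (theta_sum h (- w) N.+1) - complex.Re (theta_sum h (- w) N)| <=
  2 * h ^+ N.
Proof.
move=> w1.
rewrite Re_theta_sumS // addrK normrM normrM gtr0_norm // -mulrA ler_wpM2l //.
have := Re_le_cmod (w ^+ N.+1); rewrite cmodX w1 expr1n => hr.
rewrite (ger0_norm (exprn_ge0 _ (ltW h0))) -[leRHS]mul1r.
apply: ler_pM; rewrite ?normr_ge0 ?exprn_ge0 ?(ltW h0) //.
by apply: ler_wiXn2l; [exact: ltW|exact: ltW|nia].
Qed.

Lemma theta_sum0 u : theta_sum h u 0 = 1.
Proof. by rewrite /theta_sum big_seq1 /theta_term expr0 mulr1 expr0z. Qed.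

Lemma theta_fun_cvg w : cmod w = 1 ->
  (fun N => complex.Re (theta_sum h (- w) N)) @ \oo --> theta_fun w.
Proof.
by move=> w1; apply: (@is_cvg_geo _ 2 h) => // N; exact: Re_theta_sum_step.
Qed.

Lemma theta_fun_cvgN w : cmod w = 1 ->
  (fun N => complex.Re (theta_sum h w N)) @ \oo --> theta_fun (- w).
Proof.
move=> w1; rewrite -{1}[w]opprK; apply: theta_fun_cvg; by rewrite cmodN.
Qed.

Lemma theta_prod_real w N : cmod w = 1 ->
  theta_prod h w N = (\prod_(m < N) cmod (1 - w * h%:C ^+ (2 * m).+1) ^+ 2)%:C.
Proof.
move=> w1; rewrite /theta_prod rmorph_prod; apply: eq_bigr => m _.
rewrite rmorphXn /= -cmodE sqr_normc cmod1V //.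
have -> : h%:C ^+ (2 * m).+1 = (h ^+ (2 * m).+1)%:C :> R[i] by rewrite rmorphXn.
rewrite rmorphB rmorph1 rmorphM /=; congr (_ * (1 - _ * _)).
by rewrite -[LHS]conjc_real.
Qed.

Lemma cmod_theta_prod w N : cmod w = 1 ->
  cmod (theta_prod h w N) = \prod_(m < N) cmod (1 - w * h%:C ^+ (2 * m).+1) ^+ 2.
Proof.
move=> w1; rewrite theta_prod_real // cmod_real ger0_norm //.
by apply: prodr_ge0 => m _; rewrite exprn_ge0 // cmod_ge0.
Qed.

Lemma cmod1B w (c : R) : cmod w = 1 -> 0 <= c -> 1 - c <= cmod (1 - w * c%:C) <= 1 + c.
Proof.
move=> w1 c0; have e : cmod (w * c%:C) = c by rewrite cmodM w1 mul1r cmod_real ger0_norm.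
apply/andP; split.
  rewrite lerBlDr -{2}e (le_trans _ (cmodD _ _)) // subrK cmod1 //.
by rewrite (le_trans (cmodD _ _)) // cmodN e cmod1.
Qed.

Lemma nome_inv_ge1 : 1 <= h^-1. Proof. by rewrite invf_ge1 // ltW. Qed.

Lemma theta_prod_cvg w : cmod w = 1 ->
  (fun N => qfact_lim h * cmod (theta_prod h w N)) @ \oo --> theta_fun (- w).
Proof.
move=> w1; have [K hK] := triple_product_dist h01.
have w0 : w != 0 by rewrite -cmod_eq0 w1 oner_eq0.
apply: (@cvg_geo_dist _ K h (fun N => complex.Re (theta_sum h w N))) => //; last first.
  exact: theta_fun_cvgN.
have w1' : cmod (- w) = 1 by rewrite cmodN.
move=> N; rewrite distrC -cmod_real rmorphB rmorphM /=.
have := hK w w0; rewrite cmodV w1 invr1 => /(_ nome_inv_ge1 nome_inv_ge1 N).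
have := theta_sum_real N w1'; rewrite opprK => <-.
by rewrite cmod_theta_prod // -theta_prod_real.
Qed.

(** A lower bound uniform in N: it makes theta positive on the circle and allows
    division by these products in the limit. *)
Lemma theta_prod_lower w N : cmod w = 1 ->
  ((1 - h) * qfact_lim h) ^+ 2 <= cmod (theta_prod h w N).
Proof.
move=> w1; rewrite cmod_theta_prod //.
have G0 := qfact_lim_gt0 h01.
have q0 : 0 < 1 - h by rewrite subr_gt0.
case: N => [|N].
  rewrite big_ord0 exprn_ile1 ?mulr_ge0 ?(ltW q0) ?(ltW G0) //.
  rewrite mulr_ile1 ?(ltW q0) ?(ltW G0) //; first by rewrite lerBlDr lerDl ltW.
  exact: le_trans (qfact_lim_le h01 0) (qfact_le1 h01 0).
rewrite prodrXl lerXn2r // ?nnegrE ?mulr_ge0 ?(ltW q0) ?(ltW G0) //.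
  by apply: prodr_ge0 => m _; rewrite cmod_ge0.
rewrite big_ord_recl; apply: ler_pM; rewrite ?(ltW q0) ?(ltW G0) //.
  have := @cmod1B w h w1 (ltW h0) => /andP[] h2 _; by rewrite muln0 expr1.
apply: le_trans (qfact_lim_le h01 N) _.
apply: ler_prod => m _; rewrite subr_ge0 exprn_ile1 ?(ltW h0) ?(ltW h1) //=.
have := @cmod1B w (h ^+ (2 * bump 0 m).+1) w1 (exprn_ge0 _ (ltW h0)).
rewrite rmorphXn => /andP[h2 _]; apply: le_trans h2; rewrite lerB //.
by apply: ler_wiXn2l; [exact: ltW|exact: ltW|rewrite /bump; lia].
Qed.

Lemma theta_fun_gt0 w : cmod w = 1 -> 0 < theta_fun w.
Proof.
move=> w1; have w1' : cmod (- w) = 1 by rewrite cmodN.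
have := theta_prod_cvg w1'; rewrite opprK => hc.
have G0 := qfact_lim_gt0 h01; have q0 : 0 < 1 - h by rewrite subr_gt0.
apply: (@lt_le_trans _ _ (qfact_lim h * ((1 - h) * qfact_lim h) ^+ 2)).
  by rewrite mulr_gt0 // exprn_gt0 // mulr_gt0.
rewrite -(cvg_lim _ hc) //; apply: limr_ge; first exact: (cvgP _ hc).
by near=> N; rewrite ler_wpM2l ?(ltW G0) // theta_prod_lower.
Unshelve. all: end_near. Qed.

Lemma cmod_theta_sum_bound u N :
  u != 0 -> cmod u <= h^-1 -> cmod u^-1 <= h^-1 ->
  cmod (theta_sum h u N) <= 1 + 2 / (1 - h).
Proof.
move=> u0 u1 u2; have q0 : 0 < 1 - h by rewrite subr_gt0.
suff H : cmod (theta_sum h u N) <= 1 + 2 / (1 - h) * (1 - h ^+ N).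
  apply: le_trans H _; rewrite lerD2l -[leRHS]mulr1 ler_wpM2l ?divr_ge0 ?(ltW q0) //.
  by rewrite lerBlDr lerDl exprn_ge0 // ltW.
elim: N => [|N IH].
  by rewrite /theta_sum big_seq1 /theta_term !mulr1 cmod1 expr0 subrr mulr0 addr0.
rewrite /theta_sum /= !big_cons addrA.
apply: le_trans (cmodD _ _) _.
apply: le_trans (lerD (lexx _) IH) _.
apply: le_trans (lerD (cmodD _ _) (lexx _)) _.
have b1 := cmod_theta_term h01 (N.+1%:Z) u0 u1 u2.
have b2 := cmod_theta_term h01 (- N.+1%:Z) u0 u1 u2.
rewrite abszN !absz_nat in b1 b2.
have e : h ^+ (N.+1 ^ 2 - N.+1) <= h ^+ N.
  by apply: ler_wiXn2l; [exact: ltW|exact: ltW|nia].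
have -> : 1 + 2 / (1 - h) * (1 - h ^+ N.+1) = 2 * h ^+ N + (1 + 2 / (1 - h) * (1 - h ^+ N)).
  by rewrite exprS; field; rewrite lt0r_neq0.
rewrite lerD2r; have := le_trans b1 e; have := le_trans b2 e; lra.
Qed.

End ThetaFunction.

Lemma expr_lt01 (R : realFieldType) (h : R) k : 0 < h < 1 -> (0 < k)%N -> 0 < h ^+ k < 1.
Proof. by move=> /andP[h0 h1] k0; rewrite exprn_gt0 // exprn_ilt1 // ?ltW // -lt0n. Qed.

Lemma cvg_sparse (R : realType) (a : nat -> R) (l : R) :
  a @ \oo --> l -> (fun N => a (2 * N).+2) @ \oo --> l.
Proof.
move=> al; apply: (cvg_comp (fun N => (2 * N).+2) a _ al).
by move=> A [n _ nA]; exists n => // m /= nm; apply: nA => /=; lia.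
Qed.

Lemma cvg_mulD (R : realType) (a b c d : nat -> R) (a' b' c' d' : R) :
  a @ \oo --> a' -> b @ \oo --> b' -> c @ \oo --> c' -> d @ \oo --> d' ->
  (fun N => a N * b N + c N * d N) @ \oo --> (a' * b' + c' * d').
Proof. by move=> ha hb hc hd; apply: cvgD; apply: cvgM. Qed.

Lemma cvg_mulB (R : realType) (a b c d : nat -> R) (a' b' c' d' : R) :
  a @ \oo --> a' -> b @ \oo --> b' -> c @ \oo --> c' -> d @ \oo --> d' ->
  (fun N => `|a N * b N - c N * d N|) @ \oo --> `|a' * b' - c' * d'|.
Proof. by move=> ha hb hc hd; apply: cvg_norm; apply: cvgB; apply: cvgM. Qed.

Lemma cvg_mulZ (R : realType) (k : R) (a b : nat -> R) (a' b' : R) :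
  a @ \oo --> a' -> b @ \oo --> b' ->
  (fun N => k * (a N * b N)) @ \oo --> (k * (a' * b')).
Proof. by move=> ha hb; apply: cvgMr; apply: cvgM. Qed.

Lemma real_dist_muladd (R : realType) (a b c d e f : R[i]) (K : R) :
  a = (complex.Re a)%:C -> b = (complex.Re b)%:C -> c = (complex.Re c)%:C ->
  d = (complex.Re d)%:C -> e = (complex.Re e)%:C -> f = (complex.Re f)%:C ->
  cmod (a * b + c * d - 2 * (e * f)) <= K ->
  `|complex.Re a * complex.Re b + complex.Re c * complex.Re d -
    2 * (complex.Re e * complex.Re f)| <= K.
Proof.
move=> ha hb hc hd he hf; rewrite -cmod_real rmorphB rmorphD !rmorphM rmorph_nat /=.
by rewrite -ha -hb -hc -hd -he -hf.
Qed.

Lemma real_dist_mulsub (R : realType) (a b c d t : R[i]) (K : R) :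
  a = (complex.Re a)%:C -> b = (complex.Re b)%:C -> c = (complex.Re c)%:C ->
  d = (complex.Re d)%:C -> cmod (a * b - c * d - t) <= K ->
  `| `|complex.Re a * complex.Re b - complex.Re c * complex.Re d| - cmod t| <= K.
Proof.
move=> ha hb hc hd; apply: le_trans.
have -> : a * b - c * d = (complex.Re a * complex.Re b - complex.Re c * complex.Re d)%:C.
  by rewrite rmorphB !rmorphM /= -ha -hb -hc -hd.
rewrite -[X in `|X - _|]cmod_real; exact: cmod_dist.
Qed.

Lemma mul_dist (R : realFieldType) (a b a' b' M K e : R) :
  0 <= a -> 0 <= b -> a <= M -> b <= M -> 0 <= a' -> 0 <= b' ->
  `|a' - a| <= K * e -> `|b' - b| <= K * e -> 0 < e -> e <= 1 ->
  `|a * b - a' * b'| <= (M * K + (M + K) * K) * e.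
Proof.
move=> a0 b0 aM bM a'0 b'0 d1 d2 e0 e1.
have K0 : 0 <= K by rewrite -(pmulr_lge0 _ e0); exact: le_trans d1.
have b'M : b' <= M + K.
  have : `|b' - b| <= K by apply: le_trans d2 _; rewrite ler_piMr.
  by rewrite ler_norml => /andP[? ?]; lra.
have -> : a * b - a' * b' = a * (b - b') + b' * (a - a') by ring.
apply: le_trans (ler_normD _ _) _; rewrite !normrM (ger0_norm a0) (ger0_norm b'0).
rewrite mulrDl -!mulrA distrC [X in _ + b' * X]distrC.
by apply: lerD; apply: ler_pM.
Qed.

Section ThetaIdentities.
Variables (R : realType) (h : R).
Hypothesis h01 : 0 < h < 1.
Let h0 : 0 < h. Proof. by case/andP: h01. Qed.
Let h1 : h < 1. Proof. by case/andP: h01. Qed.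
Let p := h ^+ 2.
Let p01 : 0 < p < 1. Proof. exact: expr_lt01. Qed.
Let p0 : 0 < p. Proof. by case/andP: p01. Qed.
Implicit Types w z u : R[i].

Let cmodMu w z : cmod w = 1 -> cmod z = 1 -> cmod (w * z) = 1.
Proof. by move=> w1 z1; rewrite cmodM w1 z1 mulr1. Qed.

Let cmodVu z : cmod z = 1 -> cmod z^-1 = 1.
Proof. by move=> z1; rewrite cmodV z1 invr1. Qed.

Let theta_sum_realN (q : R) w N : 0 < q < 1 -> cmod w = 1 ->
  theta_sum q w N = (complex.Re (theta_sum q w N))%:C.
Proof.
by move=> q01 w1; have := theta_sum_real q N (_ : cmod (- w) = 1);
  rewrite opprK cmodN => /(_ w1).
Qed.

Lemma theta_fun_addition w z : cmod w = 1 -> cmod z = 1 ->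
  theta_fun h w * theta_fun h (- z) + theta_fun h (- w) * theta_fun h z =
  2 * (theta_fun p (- (w * z)) * theta_fun p (- (w / z))).
Proof.
move=> w1 z1; have [K hK] := theta_addition h01 w1 z1.
pose S u N := complex.Re (theta_sum h u N).
pose P u N := complex.Re (theta_sum p u N).
have wz1 := cmodMu w1 z1; have wz2 := cmodMu w1 (cmodVu z1).
have w1' : cmod (- w) = 1 by rewrite cmodN.
have z1' : cmod (- z) = 1 by rewrite cmodN.
have lim1 : (fun N => S (- w) (2 * N).+2 * S z (2 * N).+2 +
     S w (2 * N).+2 * S (- z) (2 * N).+2) @ \oo -->
   (theta_fun h w * theta_fun h (- z) + theta_fun h (- w) * theta_fun h z : R).
  apply: (@cvg_sparse _ (fun N => S (- w) N * S z N + S w N * S (- z) N)).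
  exact: cvg_mulD (theta_fun_cvg h01 w1) (theta_fun_cvgN h01 z1)
    (theta_fun_cvgN h01 w1) (theta_fun_cvg h01 z1).
have lim2 : (fun N => 2 * (P (w * z) N * P (w / z) N)) @ \oo -->
   (2 * (theta_fun p (- (w * z)) * theta_fun p (- (w / z))) : R).
  exact: cvg_mulZ (theta_fun_cvgN p01 wz1) (theta_fun_cvgN p01 wz2).
have dist N : `|S (- w) (2 * N).+2 * S z (2 * N).+2 +
     S w (2 * N).+2 * S (- z) (2 * N).+2 - 2 * (P (w * z) N * P (w / z) N)| <= K * h ^+ N.
  exact: (real_dist_muladd (theta_sum_realN _ h01 w1') (theta_sum_realN _ h01 z1)
    (theta_sum_realN _ h01 w1) (theta_sum_realN _ h01 z1')
    (theta_sum_realN _ p01 wz1) (theta_sum_realN _ p01 wz2) (hK N)).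
exact: (cvg_unique _ (cvg_geo_dist h01 dist lim1) lim2).
Qed.

Lemma theta_fun_subtraction w z : cmod w = 1 -> cmod z = 1 ->
  (fun N => 2 * h * (qfact_lim p ^+ 2 * (cmod (theta_prod p (w * z / p%:C) N) *
                                  cmod (theta_prod p (w / z / p%:C) N))))
   @ \oo -->
  (`|theta_fun h w * theta_fun h (- z) - theta_fun h (- w) * theta_fun h z| : R).
Proof.
move=> w1 z1; have [K hK] := theta_subtraction h01 w1 z1.
pose S u N := complex.Re (theta_sum h u N).
have w1' : cmod (- w) = 1 by rewrite cmodN.
have z1' : cmod (- z) = 1 by rewrite cmodN.
set u1 := w * z / p%:C; set u2 := w / z / p%:C.
have lim1 : (fun N => `|S (- w) (2 * N).+2 * S z (2 * N).+2 -
     S w (2 * N).+2 * S (- z) (2 * N).+2|) @ \oo -->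
   (`|theta_fun h w * theta_fun h (- z) - theta_fun h (- w) * theta_fun h z| : R).
  apply: (@cvg_sparse _ (fun N => `|S (- w) N * S z N - S w N * S (- z) N|)).
  exact: cvg_mulB (theta_fun_cvg h01 w1) (theta_fun_cvgN h01 z1)
    (theta_fun_cvgN h01 w1) (theta_fun_cvg h01 z1).
have lim2 : (fun N => 2 * h * (cmod (theta_sum p u1 N) * cmod (theta_sum p u2 N)))
   @ \oo -->
   (`|theta_fun h w * theta_fun h (- z) - theta_fun h (- w) * theta_fun h z| : R).
  have dist N : `| `|S (- w) (2 * N).+2 * S z (2 * N).+2 -
     S w (2 * N).+2 * S (- z) (2 * N).+2| -
     2 * h * (cmod (theta_sum p u1 N) * cmod (theta_sum p u2 N))| <= K * h ^+ N;
    last exact: (cvg_geo_dist h01 dist lim1).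
  have -> : 2 * h * (cmod (theta_sum p u1 N) * cmod (theta_sum p u2 N)) =
     cmod (2 * h%:C * w^-1 * (theta_sum p u1 N * theta_sum p u2 N)).
    rewrite cmodM (cmodM (theta_sum p u1 N)); congr (_ * _).
    rewrite !cmodM cmodVu // mulr1 cmod_real (gtr0_norm h0).
    by rewrite -[2 in RHS](rmorph_nat (real_complex R)) cmod_real ger0_norm.
  exact: (real_dist_mulsub (theta_sum_realN _ h01 w1') (theta_sum_realN _ h01 z1)
    (theta_sum_realN _ h01 w1) (theta_sum_realN _ h01 z1') (hK N)).
have [K2 hK2] := triple_product_dist p01.
have pC0 : p%:C != 0 :> R[i] by rewrite fmorph_eq0 gt_eqF.
have pV1 : p <= p^-1.
  apply: (@le_trans _ _ 1); [by apply: ltW; case/andP: p01|exact: nome_inv_ge1].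
have ok v : cmod v = 1 -> [/\ v / p%:C != 0, cmod (v / p%:C) <= p^-1
                                 & cmod (v / p%:C)^-1 <= p^-1].
  move=> v1; have v0 : v != 0 by rewrite -cmod_eq0 v1 oner_eq0.
  rewrite mulf_neq0 ?invr_eq0 // invf_div !cmodM !cmodV v1 cmod_real gtr0_norm //.
  by rewrite invr1 mul1r mulr1.
have [a1 b1 c1] := ok _ (cmodMu w1 z1).
have [a2 b2 c2] := ok _ (cmodMu w1 (cmodVu z1)).
rewrite -/u1 in a1 b1 c1; rewrite -/u2 in a2 b2 c2.
set G := qfact_lim p; have G0 : 0 < G := qfact_lim_gt0 p01.
pose M := 1 + 2 / (1 - p).
apply: (@cvg_geo_dist _ (2 * h * (M * K2 + (M + K2) * K2)) p _ _ _ p01 _ lim2) => N.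
rewrite -mulrBr normrM ger0_norm ?mulr_ge0 ?(ltW h0) //.
rewrite -[leRHS]mulrA ler_wpM2l ?mulr_ge0 ?(ltW h0) //.
have d1 := le_trans (cmod_dist _ _) (hK2 _ a1 b1 c1 N).
have d2 := le_trans (cmod_dist _ _) (hK2 _ a2 b2 c2 N).
rewrite !cmodM !cmod_real !(gtr0_norm G0) -/G in d1 d2.
have B1 := cmod_theta_sum_bound p01 N a1 b1 c1; have B2 := cmod_theta_sum_bound p01 N a2 b2 c2.
rewrite -/M in B1 B2.
have A1 := cmod_ge0 (theta_sum p u1 N); have A2 := cmod_ge0 (theta_sum p u2 N).
have E1 : 0 <= G * cmod (theta_prod p u1 N) by rewrite mulr_ge0 ?cmod_ge0 ?(ltW G0).
have E2 : 0 <= G * cmod (theta_prod p u2 N) by rewrite mulr_ge0 ?cmod_ge0 ?(ltW G0).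
have -> : G ^+ 2 * (cmod (theta_prod p u1 N) * cmod (theta_prod p u2 N)) =
  (G * cmod (theta_prod p u1 N)) * (G * cmod (theta_prod p u2 N)) by ring.
have pN : p ^+ N <= 1 by rewrite exprn_ile1 ?(ltW p0) // ltW //; case/andP: p01.
exact: (mul_dist A1 A2 B1 B2 E1 E2 d1 d2 (exprn_gt0 N p0) pN).
Qed.

Definition theta_ratio (w : R[i]) : R := theta_fun h w / theta_fun h (- w).

Lemma theta_ratio_gt0 w : cmod w = 1 -> 0 < theta_ratio w.
Proof. by move=> w1; rewrite divr_gt0 // theta_fun_gt0 // cmodN. Qed.

Lemma theta_ratioN w : theta_ratio (- w) = (theta_ratio w)^-1.
Proof. by rewrite /theta_ratio opprK invf_div. Qed.

(** The quotient of the two addition formulas, with each theta sum replaced by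
    its product.  In this form a product over several z can be computed factor
    by factor. *)
Lemma theta_ratio_cvg w z : cmod w = 1 -> cmod z = 1 ->
  (fun N => h * (cmod (theta_prod p (w * z / p%:C) N) * cmod (theta_prod p (w / z / p%:C) N)
     / (cmod (theta_prod p (w * z) N) * cmod (theta_prod p (w / z) N)))) @ \oo -->
  (`|theta_ratio w - theta_ratio z| / (theta_ratio w + theta_ratio z) : R).
Proof.
move=> w1 z1.
have wz1 := cmodMu w1 z1; have wz2 := cmodMu w1 (cmodVu z1).
have num := theta_fun_subtraction w1 z1.
have den := @cvg_mulZ R 2 _ _ _ _ (theta_prod_cvg p01 wz1) (theta_prod_cvg p01 wz2).
rewrite -(theta_fun_addition w1 z1) in den.
have w1' : cmod (- w) = 1 by rewrite cmodN.
have z1' : cmod (- z) = 1 by rewrite cmodN.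
have [a0 b0 c0 d0] : [/\ 0 < theta_fun h w, 0 < theta_fun h (- w),
  0 < theta_fun h z & 0 < theta_fun h (- z)] by split; exact: theta_fun_gt0.
have -> : `|theta_ratio w - theta_ratio z| / (theta_ratio w + theta_ratio z) =
   `|theta_fun h w * theta_fun h (- z) - theta_fun h (- w) * theta_fun h z| /
   (theta_fun h w * theta_fun h (- z) + theta_fun h (- w) * theta_fun h z).
  rewrite /theta_ratio; move: a0 b0 c0 d0.
  move: (theta_fun h w) (theta_fun h (- w)) (theta_fun h z) (theta_fun h (- z)).
  move=> a b c d a0 b0 c0 d0.
  have -> : a / b - c / d = (a * d - b * c) / (b * d) by field; rewrite !lt0r_neq0.
  rewrite normrM normfV (gtr0_norm (mulr_gt0 b0 d0)).
  by field; rewrite !lt0r_neq0 // addr_gt0 // mulr_gt0.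
move: a0 b0 c0 d0 num den.
move: (theta_fun h w) (theta_fun h (- w)) (theta_fun h z) (theta_fun h (- z)).
move=> a b c d a0 b0 c0 d0 num den.
have s0 : a * d + b * c != 0 by rewrite lt0r_neq0 // addr_gt0 // mulr_gt0.
have G0 := qfact_lim_gt0 p01.
have l0 : 0 < ((1 - p) * qfact_lim p) ^+ 2.
  by rewrite exprn_gt0 // mulr_gt0 // subr_gt0; case/andP: p01.
have cvgND := cvgM num (cvgV s0 den).
set F := fun N => _; suff -> : F = (fun N => 2 * h * (qfact_lim p ^+ 2 *
    (cmod (theta_prod p (w * z / p%:C) N) * cmod (theta_prod p (w / z / p%:C) N))) *
    (2 * (qfact_lim p * cmod (theta_prod p (w * z) N) *
     (qfact_lim p * cmod (theta_prod p (w / z) N))))^-1) by exact: cvgND.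
apply/funext => N; rewrite /F.
have y1 := lt_le_trans l0 (theta_prod_lower p01 N wz1).
have y2 := lt_le_trans l0 (theta_prod_lower p01 N wz2).
move: y1 y2.
move: (cmod (theta_prod p (w * z) N)) (cmod (theta_prod p (w / z) N)) => Y1 Y2 y1 y2.
move: (cmod (theta_prod p (w * z / p%:C) N)) (cmod (theta_prod p (w / z / p%:C) N)) => X1 X2.
by field; rewrite !lt0r_neq0.
Qed.

End ThetaIdentities.

End ThetaOnTheCircle.

(** * An explicit rational function of Zolotarev type *)

Section Zolotarev.
Local Open Scope complex_scope.
Local Open Scope classical_set_scope.

Section RootsOfI.
Variables (R : realType) (k : nat).
Hypothesis k0 : (0 < k)%N.

Definition iC : R[i] := Complex 0 1.

Lemma iC_sqr : iC * iC = -1.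
Proof.
by apply/eqP; rewrite eq_complex /=; apply/andP; split; apply/eqP; ring.
Qed.

Lemma iC_neq0 : iC != 0.
Proof. by rewrite eq_complex /= oner_eq0 andbF. Qed.

Lemma iCV : iC^-1 = - iC.
Proof. by apply: (mulfI iC_neq0); rewrite mulfV ?iC_neq0 // mulrN iC_sqr opprK. Qed.

Lemma cmod_iC : cmod iC = 1.
Proof. by rewrite /cmod normc_def /= expr0n expr1n add0r sqrtr1. Qed.

Lemma roots_of_i : exists2 rs : seq R[i], size rs = k &
  'X^k - iC%:P = \prod_(z <- rs) ('X - z%:P).
Proof.
have [rs e] := closed_field_poly_normal ('X^k - iC%:P).
have sz : size ('X^k - iC%:P : {poly R[i]}) = k.+1 by exact: size_XnsubC.
rewrite (eqP (monicXnsubC iC k0)) scale1r in e.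
by exists rs => //; move: sz; rewrite e size_prod_XsubC => -[].
Qed.

Variable rs : seq R[i].
Hypothesis rsE : 'X^k - iC%:P = \prod_(z <- rs) ('X - z%:P).

Lemma horner_roots_of_i (y : R[i]) : \prod_(z <- rs) (y - z) = y ^+ k - iC.
Proof.
have := congr1 (fun q => q.[y]) rsE; rewrite !hornerE horner_prod => ->.
by apply: eq_bigr => z _; rewrite !hornerE.
Qed.

Lemma roots_of_i_exp z : z \in rs -> z ^+ k = iC.
Proof.
move=> zrs; apply/eqP; rewrite -subr_eq0 -horner_roots_of_i.
by rewrite (big_rem z) //= subrr mul0r.
Qed.

Lemma roots_of_i_cmod z : z \in rs -> cmod z = 1.
Proof.
move=> /roots_of_i_exp /(congr1 cmod); rewrite cmodX cmod_iC => /eqP.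
by rewrite pexpr_eq1 ?cmod_ge0 // => /eqP.
Qed.

Lemma prod_roots_mul (y : R[i]) : \prod_(z <- rs) (1 - y * z) = 1 - y ^+ k * iC.
Proof.
have [->|y0] := eqVneq y 0.
  rewrite expr0n gtn_eqF // mul0r subr0 big1 // => z _; by rewrite mul0r subr0.
have -> : \prod_(z <- rs) (1 - y * z) = \prod_(z <- rs) (y * (y^-1 - z)).
  by apply: eq_bigr => z _; rewrite mulrBr mulfV.
rewrite big_split /= horner_roots_of_i big_const_seq count_predT iter_mulr_1.
have -> : size rs = k.
  by move: (congr1 (fun q : {poly R[i]} => (size q).-1) rsE); rewrite size_XnsubC // size_prod_XsubC.
by rewrite mulrBr exprVn mulfV // expf_neq0.
Qed.

Lemma prod_roots_div (y : R[i]) : \prod_(z <- rs) (1 - y / z) = 1 - y ^+ k / iC.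
Proof.
have rs0 z : z \in rs -> z != 0.
  by move=> /roots_of_i_cmod z1; rewrite -cmod_eq0 z1 oner_eq0.
have e0 := horner_roots_of_i 0; rewrite expr0n gtn_eqF // sub0r in e0.
apply: (@mulfI _ (- iC)); first by rewrite oppr_eq0 iC_neq0.
rewrite -{1}e0 -big_split /=.
have -> : - iC * (1 - y ^+ k / iC) = y ^+ k - iC by field; exact: iC_neq0.
rewrite -horner_roots_of_i !big_seq; apply: eq_bigr => z /rs0 z0.
by field.
Qed.

Lemma theta_prod_roots (p : R) (c : R[i]) N :
  \prod_(z <- rs) theta_prod p (c * z) N = theta_prod (p ^+ k) (c ^+ k * iC) N.
Proof.
rewrite /theta_prod exchange_big /=; apply: eq_bigr => m _.
rewrite big_split /=; congr (_ * _).
  under eq_bigr do rewrite mulrAC.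
  by rewrite prod_roots_mul exprMn rmorphXn /= -!exprM [(_ * k)%N]mulnC mulrAC.
under eq_bigr do rewrite invfM mulrAC.
rewrite prod_roots_div exprMn exprVn rmorphXn /= -!exprM [(_ * k)%N]mulnC invfM.
by rewrite [in RHS]mulrAC.
Qed.

Lemma theta_prod_rootsV (p : R) (c : R[i]) N :
  \prod_(z <- rs) theta_prod p (c / z) N = theta_prod (p ^+ k) (c ^+ k / iC) N.
Proof.
rewrite /theta_prod exchange_big /=; apply: eq_bigr => m _.
rewrite big_split /=; congr (_ * _).
  under eq_bigr do rewrite mulrAC.
  by rewrite prod_roots_div exprMn rmorphXn /= -!exprM [(_ * k)%N]mulnC mulrAC.
transitivity (\prod_(z <- rs) (1 - p%:C ^+ (2 * m).+1 / c * z)).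
  by apply: eq_bigr => z _; rewrite invf_div; congr (1 - _); ring.
rewrite prod_roots_mul exprMn exprVn rmorphXn /= -!exprM [(_ * k)%N]mulnC invf_div.
by congr (1 - _); ring.
Qed.

Lemma cvg_prod_seq (T : eqType) (s : seq T) (f : T -> nat -> R) (l : T -> R) :
  (forall t, t \in s -> f t @ \oo --> l t) ->
  (fun N => \prod_(t <- s) f t N) @ \oo --> \prod_(t <- s) l t.
Proof.
elim: s => [|t s IH] h.
  rewrite big_nil; under eq_fun do rewrite big_nil; exact: cvg_cst.
rewrite big_cons; under eq_fun do rewrite big_cons.
apply: cvgM; first by apply: h; rewrite mem_head.
by apply: IH => u us; apply: h; rewrite inE us orbT.
Qed.

Variable h : R.
Hypothesis h01 : 0 < h < 1.

(** The product of 1 - y z over the k-th roots z of i is 1 - y^k i, so each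
    factor of the triple products for h contributes a factor of the triple
    products for h^k. *)
Lemma theta_ratio_multiplication (w : R[i]) : cmod w = 1 ->
  \prod_(z <- rs) (`|theta_ratio h w - theta_ratio h z| /
                   (theta_ratio h w + theta_ratio h z)) =
  `|theta_ratio (h ^+ k) (w ^+ k) - theta_ratio (h ^+ k) iC| /
    (theta_ratio (h ^+ k) (w ^+ k) + theta_ratio (h ^+ k) iC).
Proof.
move=> w1; have hk01 := expr_lt01 h01 k0.
have wk1 : cmod (w ^+ k) = 1 by rewrite cmodX w1 expr1n.
have lim1 := theta_ratio_cvg hk01 wk1 cmod_iC.
pose A z N := cmod (theta_prod (h ^+ 2) (w * z / (h ^+ 2)%:C) N).
pose B z N := cmod (theta_prod (h ^+ 2) (w / z / (h ^+ 2)%:C) N).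
pose C z N := cmod (theta_prod (h ^+ 2) (w * z) N).
pose D z N := cmod (theta_prod (h ^+ 2) (w / z) N).
have lim2 : (fun N => \prod_(z <- rs) (h * (A z N * B z N / (C z N * D z N)))) @ \oo -->
    \prod_(z <- rs) (`|theta_ratio h w - theta_ratio h z| /
                   (theta_ratio h w + theta_ratio h z)).
  exact: cvg_prod_seq (fun z zrs => theta_ratio_cvg h01 w1 (roots_of_i_cmod zrs)).
have srs : size rs = k.
  by move: (congr1 (fun q : {poly R[i]} => (size q).-1) rsE); rewrite size_XnsubC // size_prod_XsubC.
have pk : (h ^+ 2) ^+ k = (h ^+ k) ^+ 2 by rewrite -!exprM mulnC.
have pkC : (h ^+ 2)%:C ^+ k = ((h ^+ k) ^+ 2)%:C :> R[i].
  by rewrite -pk [RHS]rmorphXn.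
have hA N : \prod_(z <- rs) A z N =
    cmod (theta_prod (h ^+ k ^+ 2) (w ^+ k * iC / (h ^+ k ^+ 2)%:C) N).
  rewrite -cmod_prod; under eq_bigr do rewrite mulrAC.
  by rewrite theta_prod_roots pk exprMn exprVn pkC mulrAC.
have hB N : \prod_(z <- rs) B z N =
    cmod (theta_prod (h ^+ k ^+ 2) (w ^+ k / iC / (h ^+ k ^+ 2)%:C) N).
  rewrite -cmod_prod; under eq_bigr do rewrite mulrAC.
  by rewrite theta_prod_rootsV pk exprMn exprVn pkC mulrAC.
have hC N : \prod_(z <- rs) C z N = cmod (theta_prod (h ^+ k ^+ 2) (w ^+ k * iC) N).
  by rewrite -cmod_prod theta_prod_roots pk.
have hD N : \prod_(z <- rs) D z N = cmod (theta_prod (h ^+ k ^+ 2) (w ^+ k / iC) N).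
  by rewrite -cmod_prod theta_prod_rootsV pk.
have e : (fun N => \prod_(z <- rs) (h * (A z N * B z N / (C z N * D z N)))) =
  (fun N => h ^+ k *
   (cmod (theta_prod (h ^+ k ^+ 2) (w ^+ k * iC / (h ^+ k ^+ 2)%:C) N) *
    cmod (theta_prod (h ^+ k ^+ 2) (w ^+ k / iC / (h ^+ k ^+ 2)%:C) N) /
    (cmod (theta_prod (h ^+ k ^+ 2) (w ^+ k * iC) N) *
     cmod (theta_prod (h ^+ k ^+ 2) (w ^+ k / iC) N)))).
  apply/funext => N; rewrite -hA -hB -hC -hD.
  rewrite big_split /= big_const_seq count_predT iter_mulr_1 srs; congr (_ * _).
  rewrite big_split big_split /=; congr (_ * _).
  by rewrite prodfV big_split.
rewrite e in lim2.
exact: (cvg_unique _ lim2 lim1).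
Qed.
End RootsOfI.

Section ThetaRatioRange.
Variables (R : realType) (h : R).
Hypothesis h01 : 0 < h < 1.
Let h0 : 0 < h. Proof. by case/andP: h01. Qed.
Let h1 : h < 1. Proof. by case/andP: h01. Qed.
Implicit Types w z u : R[i].

Lemma theta_sumV u N : theta_sum h u^-1 N = theta_sum h u N.
Proof.
have e j : theta_term h%:C u^-1 j = theta_term h%:C u (- j).
  by rewrite /theta_term abszN -invrN -exprz_inv.
rewrite /theta_sum; under eq_bigr do rewrite e.
rewrite -(big_map (fun j : int => - j) predT (theta_term h%:C u)).
apply: perm_big; apply: uniq_perm.
- by rewrite map_inj_uniq ?uniq_zrange //; exact: oppr_inj.
- exact: uniq_zrange.
move=> j; apply/mapP/idP => [[l + ->]|jN]; first by rewrite !mem_zrange abszN.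
by exists (- j); rewrite ?opprK // mem_zrange abszN -mem_zrange.
Qed.

Lemma theta_fun_Ni : theta_fun h (- iC R) = theta_fun h (iC R).
Proof.
have e : (fun N => complex.Re (theta_sum h (- - iC R) N)) =
         (fun N => complex.Re (theta_sum h (- iC R) N)).
  have -> : - - iC R = (- iC R)^-1 by rewrite invrN iCV.
  by apply/funext => N; exact: (congr1 (@complex.Re R) (theta_sumV (- iC R) N)).
exact: (congr1 (fun f : nat -> R => limn f) e).
Qed.

(* Unification must not unfold these limits. *)
Opaque theta_fun theta_sum theta_prod.

Lemma theta_ratio_i : theta_ratio h (iC R) = 1.
Proof.
by rewrite /theta_ratio theta_fun_Ni divff // lt0r_neq0 // theta_fun_gt0 // cmod_iC.
Qed.

(** Through the product formula theta is compared factor by factor. *)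
Lemma le_theta_fun w z : cmod w = 1 -> cmod z = 1 ->
  (forall c : R, 0 <= c -> cmod (1 + w * c%:C) <= cmod (1 + z * c%:C)) ->
  theta_fun h w <= theta_fun h z.
Proof.
move=> w1 z1 wz.
have w1' : cmod (- w) = 1 by rewrite cmodN.
have z1' : cmod (- z) = 1 by rewrite cmodN.
have lw := theta_prod_cvg h01 w1'; have lz := theta_prod_cvg h01 z1'.
rewrite !opprK in lw lz.
rewrite -(cvg_lim _ lw) // -(cvg_lim _ lz) //.
apply: ler_lim; [exact: (cvgP _ lw)|exact: (cvgP _ lz)|].
apply: nearW => N; rewrite ler_wpM2l ?(ltW (qfact_lim_gt0 h01)) //.
rewrite !cmod_theta_prod //; apply: ler_prod => m _.
rewrite exprn_ge0 ?cmod_ge0 //= lerXn2r ?nnegrE ?cmod_ge0 //.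
by rewrite !mulNr !opprK -rmorphXn wz // exprn_ge0 // ltW.
Qed.

Let u1 : cmod (1 : R[i]) = 1. Proof. exact: cmod1. Qed.
Let uN1 : cmod (-1 : R[i]) = 1. Proof. by rewrite cmodN cmod1. Qed.

Lemma theta_fun_le1 w : cmod w = 1 -> theta_fun h w <= theta_fun h 1.
Proof.
move=> w1; apply: le_theta_fun => // c c0.
have w1' : cmod (- w) = 1 by rewrite cmodN.
have /andP[_] := cmod1B w1' c0; rewrite mulNr opprK => /le_trans; apply.
by rewrite mul1r -(rmorph1 (real_complex R)) -rmorphD cmod_real ger0_norm // addr_ge0.
Qed.

Lemma theta_fun_geN1 w : cmod w = 1 -> theta_fun h (-1) <= theta_fun h w.
Proof.
move=> w1; apply: le_theta_fun => // c c0.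
have -> : 1 + -1 * c%:C = (1 - c)%:C :> R[i] by rewrite rmorphB rmorph1 mulN1r.
have := cmod_dist 1 (- (w * c%:C)); rewrite cmodN cmodM w1 mul1r !cmod_real normr1 opprK.
by rewrite (ger0_norm c0).
Qed.

Lemma theta_ratio_le1 w : cmod w = 1 -> theta_ratio h w <= theta_ratio h 1.
Proof.
move=> w1; have w1' : cmod (- w) = 1 by rewrite cmodN.
have := theta_fun_le1 w1; have := theta_fun_geN1 w1'.
have := theta_fun_gt0 h01 w1; have := theta_fun_gt0 h01 w1'.
have := theta_fun_gt0 h01 uN1; rewrite /theta_ratio.
move: (theta_fun h w) (theta_fun h (- w)) (theta_fun h 1) (theta_fun h (-1)).
move=> a b c d d0 b0 a0 db ac.
by apply: ler_pM; rewrite ?invr_ge0 ?lef_pV2 ?posrE // ltW.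
Qed.

Lemma theta_ratio_ge w : cmod w = 1 -> (theta_ratio h 1)^-1 <= theta_ratio h w.
Proof.
move=> w1; have w1' : cmod (- w) = 1 by rewrite cmodN.
have := theta_ratio_le1 w1'; rewrite theta_ratioN.
have := theta_ratio_gt0 h01 w1; have := theta_ratio_gt0 h01 u1.
move: (theta_ratio h w) (theta_ratio h 1) => a b b0 a0 le.
by rewrite -[leRHS]invrK lef_pV2 ?posrE ?invr_gt0.
Qed.

Lemma theta_ratio1_ge1 : 1 <= theta_ratio h 1.
Proof. by rewrite -{1}theta_ratio_i; apply: theta_ratio_le1; exact: cmod_iC. Qed.

(** At w = 1 and z = i the product formula involves only g(j) = 1 + p^(2j), and
    the quotient is the product of g(2m) g(2m+2) / g(2m+1)^2.  Telescoping with
    the decrease of g bounds it by g(0) = 2. *)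
Lemma theta_ratio1_bound : (theta_ratio h 1 - 1) / (theta_ratio h 1 + 1) <= 2 * h.
Proof.
have p01 : 0 < h ^+ 2 < 1 by exact: expr_lt01.
set p := h ^+ 2 in p01; have /andP[p0 p1] := p01.
have := theta_ratio_cvg h01 u1 (cmod_iC R).
rewrite theta_ratio_i ger0_norm ?subr_ge0 ?theta_ratio1_ge1 // !mul1r => lim.
rewrite -(cvg_lim _ lim) //; apply: limr_le; first exact: (cvgP _ lim).
apply: nearW => N; rewrite mulrC ler_pM2r //.
rewrite -/p; clear lim; clearbody p.
have uV : cmod (iC R)^-1 = 1 by rewrite cmodV cmod_iC invr1.
pose g (j : nat) := 1 + p ^+ (2 * j).
have pos v : cmod v = 1 -> 0 < cmod (theta_prod p v N).
  move=> v1; apply: lt_le_trans (theta_prod_lower p01 N v1).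
  by rewrite exprn_gt0 // mulr_gt0 ?qfact_lim_gt0 // subr_gt0.
rewrite ler_pdivrMr; last by rewrite mulr_gt0 ?pos ?cmod_iC.
have g1 j : 1 <= g j by rewrite lerDl exprn_ge0 // ltW.
have pair (c : R) : cmod (1 - iC R * c%:C) * cmod (1 - (iC R)^-1 * c%:C) = 1 + c ^+ 2.
  rewrite -cmodM iCV; have -> : (1 - iC R * c%:C) * (1 - - iC R * c%:C) = (1 + c ^+ 2)%:C.
    rewrite rmorphD rmorph1 rmorphXn /=.
    have -> : (1 - iC R * c%:C) * (1 - - iC R * c%:C) = 1 - (iC R * iC R) * c%:C ^+ 2 by ring.
    by rewrite iC_sqr mulN1r opprK.
  by rewrite cmod_real ger0_norm // addr_ge0 ?sqr_ge0.
have Y : cmod (theta_prod p (iC R) N) * cmod (theta_prod p (iC R)^-1 N) =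
    \prod_(m < N) g (2 * m).+1 ^+ 2.
  rewrite !cmod_prod -big_split; apply: eq_bigr => m _ /=.
  rewrite !cmodM invrK -(rmorphXn (real_complex R)) /=; set c := p ^+ _.
  have := pair c; move: (cmod (1 - iC R * c%:C)) (cmod (1 - (iC R)^-1 * c%:C)).
  by move=> a b e; rewrite [b * a]mulrC e /g exprM -!expr2 exprAC.
have pC0 : p%:C != 0 :> R[i] by rewrite fmorph_eq0 gt_eqF.
have X : cmod (theta_prod p (iC R / p%:C) N) * cmod (theta_prod p ((iC R)^-1 / p%:C) N) =
    \prod_(m < N) (g (2 * m)%N * g (2 * m).+2).
  rewrite !cmod_prod -big_split; apply: eq_bigr => m _ /=.
  rewrite !cmodM !invf_div !invrK.
  have e1 v : v / p%:C * p%:C ^+ (2 * m).+1 = v * (p ^+ (2 * m))%:C.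
    by rewrite rmorphXn /= exprS; field.
  have e2 : p%:C / iC R * p%:C ^+ (2 * m).+1 = (iC R)^-1 * (p ^+ (2 * m).+2)%:C.
    by rewrite rmorphXn /= [in RHS]exprS mulrCA mulrA.
  have e3 : p%:C * iC R * p%:C ^+ (2 * m).+1 = iC R * (p ^+ (2 * m).+2)%:C.
    by rewrite rmorphXn /= [in RHS]exprS mulrCA mulrA.
  rewrite !e1 e2 e3.
  have := pair (p ^+ (2 * m)); have := pair (p ^+ (2 * m).+2).
  move: (cmod (1 - _ * (p ^+ (2 * m))%:C)) (cmod (1 - _^-1 * (p ^+ (2 * m))%:C)).
  move: (cmod (1 - iC R * _)) (cmod (1 - _^-1 * _)) => a b c d E1 E2.
  rewrite /g [p ^+ (2 * (2 * m).+2)]exprM [p ^+ (2 * (2 * m))]exprM exprAC [X in _ * (1 + X)]exprAC -E1 -E2; ring.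
rewrite X Y; apply: (@le_trans _ _ ((\prod_(m < N) (g (2 * m)%N * g (2 * m).+2)) * g (2 * N)%N)).
  rewrite ler_peMr ?g1 //; apply: prodr_ge0 => m _.
  by rewrite mulr_ge0 // (le_trans ler01).
have -> : (\prod_(m < N) (g (2 * m)%N * g (2 * m).+2)) * g (2 * N)%N =
    g 0%N * \prod_(m < N) g (2 * m).+2 ^+ 2.
  elim: (N) => [|n IH]; first by rewrite !big_ord0 mul1r mulr1 muln0.
  rewrite !big_ord_recr /= (_ : (2 * n.+1 = (2 * n).+2)%N); last by lia.
  by rewrite [in RHS]mulrA -IH; ring.
have -> : g 0%N = 2 by rewrite /g muln0 expr0.
rewrite ler_wpM2l //; apply: ler_prod => m _.
rewrite exprn_ge0 ?(le_trans ler01) //= lerXn2r ?nnegrE ?(le_trans ler01) //.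
by rewrite lerD2l; apply: ler_wiXn2l; [exact: ltW|exact: ltW|lia].
Qed.

Lemma theta_ratio_dist1 w : cmod w = 1 ->
  `|theta_ratio h w - 1| / (theta_ratio h w + 1) <= 2 * h.
Proof.
move=> w1; apply: le_trans theta_ratio1_bound.
have := theta_ratio_ge w1; have := theta_ratio_le1 w1; have := theta_ratio1_ge1.
have := theta_ratio_gt0 h01 w1.
move: (theta_ratio h w) (theta_ratio h 1) => a F a0 F1 aF Fa.
have F0 : 0 < F by lra.
have Fa1 : 1 <= F * a by rewrite -ler_pdivrMl // mulr1.
rewrite ler_pdivrMr ?addr_gt0 // mulrAC ler_pdivlMr ?addr_gt0 //.
by have [le|le] := lerP 1 a; nra.
Qed.

End ThetaRatioRange.

Section ThetaOnCircle.
Variables (R : realType) (h : R).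
Hypothesis h01 : 0 < h < 1.
Let h0 : 0 < h. Proof. by case/andP: h01. Qed.
Let h1 : h < 1. Proof. by case/andP: h01. Qed.

Definition circle (t : R) : R[i] := Complex (cos t) (sin t).

Lemma cmod_circle t : cmod (circle t) = 1.
Proof. by rewrite /cmod normc_def /= cos2Dsin2 sqrtr1. Qed.

Lemma circleX t n : circle t ^+ n = circle (n%:R * t).
Proof.
elim: n => [|n IH]; first by rewrite expr0 mul0r /circle cos0 sin0.
rewrite exprS IH -[in RHS]addn1 natrD mulrDl mul1r /circle cosD sinD.
by apply/eqP; rewrite eq_complex /=; apply/andP; split; apply/eqP; ring.
Qed.

Lemma lim_geo_dist (K : R) (a : nat -> R) (l : R) : 0 <= K ->
  (forall N, `|a N.+1 - a N| <= K * h ^+ N) -> a @ \oo --> l ->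
  forall N, `|l - a N| <= K / (1 - h) * h ^+ N.
Proof.
move=> K0 ha al N; have q0 : 0 < 1 - h by rewrite subr_gt0.
have step k : `|a (N + k)%N - a N| <= K / (1 - h) * h ^+ N.
  suff H : `|a (N + k)%N - a N| <= K / (1 - h) * (h ^+ N - h ^+ (N + k)).
    apply: le_trans H _; rewrite ler_wpM2l ?divr_ge0 ?(ltW q0) //.
    by rewrite lerBlDr lerDl exprn_ge0 // ltW.
  elim: k => [|k IH]; first by rewrite addn0 !subrr normr0 mulr0.
  rewrite addnS -[a _ - a N](subrKA (a (N + k)%N)).
  apply: le_trans (ler_normD _ _) _; apply: le_trans (lerD (ha _) IH) _.
  rewrite exprS le_eqVlt; apply/orP; left; apply/eqP.
  by field; rewrite lt0r_neq0.
have lim : (fun k => `|a k - a N|) @ \oo --> `|l - a N|.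
  by apply: cvg_norm; apply: cvgB => //; exact: cvg_cst.
rewrite -(cvg_lim _ lim) //; apply: limr_le; first exact: (cvgP _ lim).
near=> k; rewrite -(@subnKC N k); first exact: step.
by near: k; exact: nbhs_infty_ge.
Unshelve. all: end_near. Qed.

Lemma continuous_geo_limit (K : R) (S : nat -> R -> R) (f : R -> R) :
  (forall N, continuous (S N)) -> (forall N t, `|f t - S N t| <= K * h ^+ N) ->
  continuous f.
Proof.
move=> cS fS t; apply/cvgrPdist_lt => e e0.
have e3 : 0 < e / 3 by rewrite divr_gt0.
have /cvgrPdist_lt/(_ _ e3)[N _ /(_ N (leqnn N))] := cvg_geo0 K h01.
rewrite /= sub0r normrN => /ltr_normlW Ke.
have /cvgrPdist_lt/(_ _ e3) := cS N t.
apply: filterS => s ts.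
have -> : f t - f s = (f t - S N t) + (S N t - S N s) - (f s - S N s) by ring.
apply: le_lt_trans (ler_normB _ _) _; apply: le_lt_trans (lerD (ler_normD _ _) (lexx _)) _.
by have := fS N t; have := fS N s; lra.
Qed.

Lemma continuous_theta_circle : continuous (fun t => theta_fun h (circle t)).
Proof.
apply: (@continuous_geo_limit (2 / (1 - h))
   (fun N t => complex.Re (theta_sum h (- circle t) N))).
  elim=> [|N IH].
    have -> : (fun t => complex.Re (theta_sum h (- circle t) 0)) = cst 1.
      by apply/funext => s; exact: (congr1 (@complex.Re R) (theta_sum0 _ _)).
    by move=> t; exact: cvg_cst.
  have -> : (fun t => complex.Re (theta_sum h (- circle t) N.+1)) =
     (fun t => 2 * cos (N.+1%:R * t) * h ^+ (N.+1 ^ 2) +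
        complex.Re (theta_sum h (- circle t) N)).
    apply/funext => t; rewrite (Re_theta_sumS h N (cmod_circle t)).
    by rewrite circleX.
  move=> t; apply: cvgD; last exact: IH.
  apply: cvgMl; apply: cvgMr.
  apply: (continuous_comp (g := cos)); last exact: continuous_cos.
  by apply: cvgMr; exact: cvg_id.
move=> N t; exact: (@lim_geo_dist 2 (fun N => complex.Re (theta_sum h (- circle t) N))
  _ (ler0n _ _) (fun M => Re_theta_sum_step h01 M (cmod_circle t))
  (theta_fun_cvg h01 (cmod_circle t)) N).
Qed.

Lemma circleN t : - circle t = circle (t + pi).
Proof. by rewrite /circle cosDpi sinDpi. Qed.

(** The intermediate value theorem along the half circle from 1 to -1. *)
Lemma theta_ratio_onto x : (theta_ratio h 1)^-1 <= x <= theta_ratio h 1 ->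
  exists2 w : R[i], cmod w = 1 & theta_ratio h w = x.
Proof.
move=> /andP[x1 x2]; pose f t := theta_ratio h (circle t).
have cf : continuous f.
  move=> t; apply: cvgM; first exact: continuous_theta_circle.
  apply: cvgV.
    by rewrite circleN lt0r_neq0 // theta_fun_gt0 // cmod_circle.
  have e : (fun s => theta_fun h (- circle s)) = (fun s => theta_fun h (circle (s + pi))).
    by apply/funext => s; rewrite circleN.
  rewrite e circleN.
  apply: (continuous_comp (f := fun s : R => s + pi) (g := fun s => theta_fun h (circle s))).
    by apply: cvgD; [exact: cvg_id|exact: cvg_cst].
  exact: continuous_theta_circle.
have f0 : f 0 = theta_ratio h 1 by rewrite /f /circle cos0 sin0.
have fpi : f pi = (theta_ratio h 1)^-1.
  rewrite -theta_ratioN /f; congr theta_ratio.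
  by rewrite -[pi]add0r -circleN /circle cos0 sin0.
have [||c _ fc] := @IVT R f 0 pi x (pi_ge0 R).
- by apply: continuous_subspaceT.
- by rewrite f0 fpi ge_min le_max x1 x2 orbT.
exists (circle c); [exact: cmod_circle|exact: fc].
Qed.

(** The zeros are the values of the theta ratio at the k-th roots of i, and a
    point x of the interval is the value at some w of the circle; the
    multiplication formula then reduces the claim to the bound for the single
    pair (w^k, i) and the nome h^k. *)
Lemma zolotarev_rational k : exists zs : seq R,
  [/\ size zs = k, forall z, z \in zs -> 0 < z &
   forall x, (theta_ratio h 1)^-1 <= x <= theta_ratio h 1 ->
     \prod_(z <- zs) (`|x - z| / (x + z)) <= 2 * h ^+ k].
Proof.
have [->|k0] := posnP k.
  by exists [::]; split=> // x _; rewrite big_nil expr0 mulr1 ler1n.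
have [rs srs rsE] := roots_of_i R k0.
have rs1 := roots_of_i_cmod k0 rsE.
exists [seq theta_ratio h z | z <- rs]; split; first by rewrite size_map.
  by move=> _ /mapP[z /rs1 z1 ->]; exact: theta_ratio_gt0.
move=> _ /theta_ratio_onto[w w1 <-]; rewrite big_map.
rewrite (theta_ratio_multiplication k0 rsE h01 w1).
have hk := expr_lt01 h01 k0.
by rewrite (theta_ratio_i hk); apply: theta_ratio_dist1 => //; rewrite cmodX w1 expr1n.
Qed.

End ThetaOnCircle.

End Zolotarev.

(** * Complete elliptic integrals *)

Section EllipticIntegrals.
Local Open Scope classical_set_scope.
Local Open Scope ring_scope.

Section EllipticIntegral.
Variable R : realType.
Implicit Types (t c l k : R).
Local Notation leb := (@lebesgue_measure R).

Definition elliptic_integrand l t : R :=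
  1 / Num.sqrt ((1 - t ^+ 2) * (1 - l ^+ 2 * t ^+ 2)).

(** The incomplete integral, in the extended reals so that finiteness at c = 1
    can be derived from a bound instead of being assumed. *)
Definition elliptic_F l c : \bar R :=
  (\int[leb]_(t in `[0%R, c]) (elliptic_integrand l t)%:E)%E.

Lemma elliptic_integrand_ge0 l t : 0 <= elliptic_integrand l t.
Proof. by rewrite divr_ge0 // sqrtr_ge0. Qed.

Lemma one_minus_gt0 l t : 0 <= l <= 1 -> -1 < t < 1 -> 0 < 1 - l ^+ 2 * t ^+ 2.
Proof.
move=> /andP[l0 l1] /andP[t1 t2].
have t21 : t ^+ 2 < 1 by rewrite -[t ^+ 2]real_normK ?num_real // exprn_ilt1 // ltr_norml t1 t2.
have l21 : l ^+ 2 <= 1 by rewrite exprn_ile1.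
by rewrite subr_gt0 (le_lt_trans _ t21) // ler_piMl // sqr_ge0.
Qed.

Lemma radicand_gt0 l t : 0 <= l <= 1 -> -1 < t < 1 ->
  0 < (1 - t ^+ 2) * (1 - l ^+ 2 * t ^+ 2).
Proof.
move=> l01 t01; rewrite mulr_gt0 ?one_minus_gt0 //.
have := @one_minus_gt0 1 t; rewrite expr1n mul1r; apply => //.
by rewrite ler01 lexx.
Qed.

Lemma continuous_integrand l t : 0 <= l <= 1 -> -1 < t < 1 ->
  {for t, continuous (elliptic_integrand l)}.
Proof.
move=> l01 t01; have := radicand_gt0 l01 t01 => r0.
apply: cvgMr; apply: cvgV; first by rewrite lt0r_neq0 // sqrtr_gt0.
apply: (continuous_comp (f := fun t => (1 - t ^+ 2) * (1 - l ^+ 2 * t ^+ 2))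
  (g := @Num.sqrt R)); last exact: sqrt_continuous.
apply: cvgM; first by apply: cvgB; [exact: cvg_cst|exact: exprn_continuous].
apply: cvgB; first exact: cvg_cst.
by apply: cvgMr; exact: exprn_continuous.
Qed.

Lemma within_continuous_integrand l c : 0 <= l <= 1 -> c < 1 ->
  {within `[0, c], continuous (elliptic_integrand l)}.
Proof.
move=> l01 c1; apply: continuous_in_subspaceT => t; rewrite inE /= in_itv /= => /andP[t0 tc].
by apply: continuous_integrand => //; rewrite (lt_le_trans _ t0) ?ltrN10 // (le_lt_trans tc).
Qed.

Lemma measurable_integrand l : 0 <= l <= 1 ->
  measurable_fun (`[0, 1] : set R) (elliptic_integrand l).
Proof.
move=> l01; apply/measurable_fun_itv_bndo_bndcP.
apply: (@measurable_funS _ _ _ _ (`]-1, 1[ : set R)) => //.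
  by apply: subset_itvr; rewrite bnd_simp ltrN10.
apply: open_continuous_measurable_fun => [|t].
  exact: itv_open.
by rewrite inE /= in_itv /= => ?; exact: continuous_integrand.
Qed.

Lemma elliptic_F_mono l c d : 0 <= l <= 1 -> c <= d -> d <= 1 ->
  (elliptic_F l c <= elliptic_F l d)%E.
Proof.
move=> l01 cd d1; apply: ge0_subset_integral => //.
- apply/measurable_EFinP; apply: measurable_funS (measurable_integrand l01) => //.
  by apply: subset_itvl; rewrite bnd_simp.
- by move=> t _; rewrite lee_fin elliptic_integrand_ge0.
- by apply: subset_itvl; rewrite bnd_simp.
Qed.

(** The complete integral is the supremum of the incomplete ones, by monotone
    convergence.  This reduces every statement on the singular endpoint to
    integrals of continuous functions. *)
Lemma elliptic_F_sup l M : 0 <= l <= 1 ->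
  (forall c, 0 <= c < 1 -> (elliptic_F l c <= M)%E) -> (elliptic_F l 1 <= M)%E.
Proof.
move=> l01 h; rewrite /elliptic_F -integral_itv_bndo_bndc; last first.
  apply/measurable_EFinP; apply: measurable_funS (measurable_integrand l01) => //.
  by apply: subset_itvl; rewrite bnd_simp.
(* The half-open interval is exhausted by closed ones on which the integrand is
   bounded. *)
pose F (n : nat) : set R := `[0, 1 - n.+1%:R^-1]%classic.
have lt1 (n : nat) : 1 - n.+1%:R^-1 < 1 :> R by rewrite ltrBlDr ltrDl invr_gt0.
have -> : `[0%R, 1%R[%classic = \bigcup_n F n.
  apply/seteqP; split=> t /=.
    rewrite in_itv /= => /andP[t0 t1].
    have e0 : 0 < 1 - t by rewrite subr_gt0.
    have [n nt] : exists n : nat, n.+1%:R^-1 <= 1 - t.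
      exists (Num.truncn (1 - t)^-1); rewrite -[leRHS]invrK lef_pV2 ?posrE ?invr_gt0 //.
      by rewrite ltW // truncnS_gt.
    by exists n => //; rewrite /F /= in_itv /= t0 /= lerBrDr addrC -lerBrDr.
  move=> [n _]; rewrite /F /= !in_itv /= => /andP[-> tn] /=.
  exact: le_lt_trans tn (lt1 n).
have mF i : measurable_fun (F i) (EFin \o elliptic_integrand l).
  apply/measurable_EFinP; apply: measurable_funS (measurable_integrand l01) => //.
  by apply: subset_itvl; rewrite bnd_simp ltW.
have nd : nondecreasing_seq F.
  move=> m n mn; apply/subsetPset; apply: subset_itvl; rewrite bnd_simp lerB //.
  by rewrite lef_pV2 ?posrE // ler_nat ltnS.
have lim : (fun n => (\int[leb]_(t in F n) (elliptic_integrand l t)%:E)%E) @ \oo -->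
    (\int[leb]_(t in \bigcup_n F n) (elliptic_integrand l t)%:E)%E.
  apply: (@ge0_nondecreasing_set_cvg_integral _ (measurableTypeR R) R F
    (EFin \o elliptic_integrand l) lebesgue_measure nd (fun i => measurable_itv _) mF).
  by move=> i x _; rewrite lee_fin elliptic_integrand_ge0.
rewrite -(cvg_lim _ lim) //; apply: lime_le; first exact: (cvgP _ lim).
apply: nearW => n; apply: h; rewrite lt1 andbT subr_ge0.
by rewrite invf_le1 // ler1n.
Qed.

Lemma integral_of_derivative c (g H : R -> R) : 0 < c < 1 ->
  (forall t, -1 < t < 1 -> is_derive t 1 H (g t)) ->
  (forall t, -1 < t < 1 -> {for t, continuous g}) ->
  measurable_fun (`[0, c] : set R) (EFin \o g) /\
  (\int[leb]_(t in `[0%R, c]) (g t)%:E = (H c - H 0)%:E)%E.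
Proof.
move=> /andP[c0 c1] dH cg.
have in01 t : 0 <= t <= c -> -1 < t < 1.
  by move=> /andP[t0 tc]; rewrite (lt_le_trans _ t0) ?ltrN10 // (le_lt_trans tc).
have wg : {within `[0, c], continuous g}.
  by apply: continuous_in_subspaceT => t; rewrite inE /= in_itv /= => /in01; exact: cg.
have cH t : -1 < t < 1 -> {for t, continuous H}.
  by move=> /dH[d _]; apply: differentiable_continuous; apply/derivable1_diffP.
split; first by apply/measurable_EFinP; exact: subspace_continuous_measurable_fun.
rewrite EFinB (@continuous_FTC2 _ g H 0 c c0 wg) //.
- split.
  + move=> t; rewrite in_itv /= => /andP[t0 tc].
    have t01 : -1 < t < 1 by apply: in01; rewrite (ltW t0) (ltW tc).
    by have [] := dH t t01.
  + by apply: cvg_at_right_filter; apply: cH; rewrite ltrN10 ltr01.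
  + by apply: cvg_at_left_filter; apply: cH; apply: in01; rewrite lexx ltW.
- move=> t; rewrite in_itv /= => /andP[t0 tc]; rewrite derive1E.
  have t01 : -1 < t < 1 by apply: in01; rewrite (ltW t0) (ltW tc).
  by have [_ ->] := dH t t01.
Qed.

(** Comparison with a function whose primitive H is known. *)
Lemma elliptic_F_le l c (g H : R -> R) : 0 <= l <= 1 -> 0 < c < 1 ->
  (forall t, -1 < t < 1 -> is_derive t 1 H (g t)) ->
  (forall t, -1 < t < 1 -> {for t, continuous g}) ->
  (forall t, 0 <= t < 1 -> elliptic_integrand l t <= g t) ->
  (elliptic_F l c <= (H c - H 0)%:E)%E.
Proof.
move=> l01 c01 dH cg lg; have [mg <-] := integral_of_derivative c01 dH cg.
have /andP[_ c1] := c01; apply: ge0_le_integral => //.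
- by move=> t _; rewrite lee_fin elliptic_integrand_ge0.
- apply/measurable_EFinP; apply: measurable_funS (measurable_integrand l01) => //.
  by apply: subset_itvl; rewrite bnd_simp ltW.
- move=> t /=; rewrite in_itv /= => /andP[t0 tc]; rewrite lee_fin.
  by apply: lg; rewrite t0 (le_lt_trans tc).
Qed.

Lemma elliptic_F_ge l c (g H : R -> R) : 0 <= l <= 1 -> 0 < c < 1 ->
  (forall t, -1 < t < 1 -> is_derive t 1 H (g t)) ->
  (forall t, -1 < t < 1 -> {for t, continuous g}) ->
  (forall t, 0 <= t < 1 -> 0 <= g t <= elliptic_integrand l t) ->
  ((H c - H 0)%:E <= elliptic_F l c)%E.
Proof.
move=> l01 c01 dH cg lg; have [mg <-] := integral_of_derivative c01 dH cg.
have /andP[_ c1] := c01.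
have {}lg t : (`[0, c]%classic : set R) t -> 0 <= g t <= elliptic_integrand l t.
  by rewrite /= in_itv /= => /andP[t0 tc]; apply: lg; rewrite t0 (le_lt_trans tc).
apply: ge0_le_integral => //.
- by move=> t /lg; rewrite lee_fin => /andP[].
- apply/measurable_EFinP; apply: measurable_funS (measurable_integrand l01) => //.
  by apply: subset_itvl; rewrite bnd_simp ltW.
- by move=> t /lg; rewrite lee_fin => /andP[].
Qed.

(** The integrand dominates the derivative of arcsine. *)
Lemma elliptic_F1_ge l : 0 <= l <= 1 -> ((pi / 2)%:E <= elliptic_F l 1)%E.
Proof.
move=> l01; apply/lee_subgt0Pr => e e0.
(* The cut-off is sin th for th slightly below pi/2, where arcsine has value th.
   *)
pose e' := Num.min e 1; have e'0 : 0 < e' by rewrite lt_min e0 ltr01.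
have h1 := pihalf_ge1 R.
pose th := pi / 2 - e' / 2.
have e'1 : e' <= 1 by rewrite ge_min lexx orbT.
have th0 : 0 < th by rewrite /th; lra.
have thp : th < pi / 2 by rewrite /th; lra.
have thin : th \in `](- (pi / 2)), (pi / 2)[ by rewrite in_itv /= thp andbT; lra.
have s0 : 0 < sin th by rewrite sin_gt0_pihalf // th0.
have s1 : sin th < 1.
  rewrite -[ltRHS](@sin_pihalf R) ltr_sin // in_itv /=; lra.
have sK : asin (sin th) = th by rewrite sinK // in_itv /=; lra.
have a0 : asin 0 = 0 :> R by rewrite -{1}(@sin0 R) sinK // in_itv /=; lra.
apply: (@le_trans _ _ (elliptic_F l (sin th))); last by apply: elliptic_F_mono => //; exact: ltW.
apply: (@le_trans _ _ (th%:E)).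
  have e'e : e' <= e by rewrite ge_min lexx.
  rewrite -EFinB lee_fin /th; lra.
suff : ((asin (sin th) - asin 0)%:E <= elliptic_F l (sin th))%E by rewrite sK a0 subr0.
apply: (@elliptic_F_ge l (sin th) (fun t => (Num.sqrt (1 - t ^+ 2))^-1) asin) => //.
- by rewrite s0.
- move=> t t01; apply: cvgV.
    rewrite lt0r_neq0 // sqrtr_gt0.
    by have := @one_minus_gt0 1 t; rewrite expr1n mul1r; apply => //; rewrite ler01 lexx.
  apply: (continuous_comp (f := fun t => 1 - t ^+ 2) (g := @Num.sqrt R)); last exact: sqrt_continuous.
  by apply: cvgB; [exact: cvg_cst|exact: exprn_continuous].
move=> t /andP[t0 t1]; have t01 : -1 < t < 1 by rewrite t1 andbT (lt_le_trans _ t0) ?ltrN10.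
have p1 : 0 < 1 - t ^+ 2.
  by have := @one_minus_gt0 1 t; rewrite expr1n mul1r; apply => //; rewrite ler01 lexx.
rewrite invr_ge0 sqrtr_ge0 /= /elliptic_integrand div1r.
rewrite lef_pV2 ?posrE ?sqrtr_gt0 ?radicand_gt0 //.
apply: ler_wsqrtr; rewrite ler_piMr ?(ltW p1) // lerBlDr lerDl.
by rewrite mulr_ge0 // sqr_ge0.
Qed.

End EllipticIntegral.

Section EllipticIntegral2.
Variable R : realType.
Implicit Types (t c l k x : R).

(** The ascending Landen transformation, by the substitution t |-> (1 + k) t /
    (1 + k t^2). *)
Lemma elliptic_F_landen k c : 0 < k < 1 -> 0 <= c < 1 ->
  elliptic_F (2 * Num.sqrt k / (1 + k)) ((1 + k) * c / (1 + k * c ^+ 2)) =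
  ((1 + k)%:E * elliptic_F k c)%E.
Proof.
move=> /andP[k0 k1] /andP[c0 c1].
pose f t := (1 + k) * t / (1 + k * t ^+ 2).
pose df t := (1 + k) * (1 - k * t ^+ 2) / (1 + k * t ^+ 2) ^+ 2.
have den t : 0 < 1 + k * t ^+ 2 by rewrite ltr_pwDl // mulr_ge0 ?sqr_ge0 // ltW.
have fd t : is_derive t 1 f (df t).
  rewrite /f /df; have d0 := lt0r_neq0 (den t).
  by apply: is_derive_eq; rewrite /GRing.scale /=; field.
have f'E : derive1 f = df by apply/funext => t; rewrite derive1E; have [_ ->] := fd t.
have cdf : continuous df.
  move=> t; have d0 := lt0r_neq0 (den t).
  have cq : (fun s => k * s ^+ 2) @ t --> k * t ^+ 2 by apply: cvgMr; exact: exprn_continuous.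
  have cq1 : (fun s => 1 + k * s ^+ 2) @ t --> 1 + k * t ^+ 2 by apply: cvgD => //; exact: cvg_cst.
  apply: cvgM; first by apply: cvgMr; apply: cvgB => //; exact: cvg_cst.
  apply: cvgV; first by rewrite expf_neq0.
  exact: (cvgM cq1 cq1).
have cf : continuous f.
  by move=> t; have [d _] := fd t; apply: differentiable_continuous; apply/derivable1_diffP.
set l := 2 * Num.sqrt k / (1 + k).
have s0 : 0 < Num.sqrt k by rewrite sqrtr_gt0.
have sk : Num.sqrt k ^+ 2 = k by rewrite sqr_sqrtr // ltW.
have l01 : 0 <= l <= 1.
  have k10 : 0 < 1 + k by rewrite addr_gt0.
  apply/andP; split; first by rewrite divr_ge0 ?ltW // mulr_gt0.
  by rewrite /l ler_pdivrMr // mul1r -{2}sk; have := sqr_ge0 (Num.sqrt k - 1); nra.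
have f0 : f 0 = 0 by rewrite /f mulr0 mul0r.
have f_lt1 t : t < 1 -> f t < 1.
  move=> t1; rewrite /f ltr_pdivrMr // mul1r -subr_gt0.
  have -> : 1 + k * t ^+ 2 - (1 + k) * t = (1 - t) * (1 - k * t) by ring.
  rewrite mulr_gt0 ?subr_gt0 //; have [t0|t0] := lerP 0 t; first by nra.
  by rewrite (lt_trans _ ltr01) // pmulr_rlt0.
have fincr t s : 0 <= t -> t < s -> s <= c -> f t < f s.
  move=> t0 ts sc; rewrite /f ltr_pdivrMr // mulrAC ltr_pdivlMr // -subr_gt0.
  have -> : (1 + k) * s * (1 + k * t ^+ 2) - (1 + k) * t * (1 + k * s ^+ 2) =
    (1 + k) * ((s - t) * (1 - k * (t * s))) by ring.
  rewrite mulr_gt0 ?addr_gt0 // mulr_gt0 ?subr_gt0 //.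
  have ts1 : t * s < 1 by rewrite (le_lt_trans _ (le_lt_trans sc c1)) // ler_piMl; lra.
  have ts0 : 0 <= t * s by rewrite mulr_ge0 // ltW // (le_lt_trans t0).
  by nra.
have := @integration_by_substitution_increasing R f (elliptic_integrand l) 0 c c0.
rewrite f0 f'E => sub; rewrite /elliptic_F -/(f c) sub; last 6 first.
- move=> t s; rewrite !in_itv /= => /andP[t0 tc] /andP[s1 sc] ts; exact: fincr.
- by move=> t _; exact: cdf.
- by apply: (cvgP (df 0)); apply: cvg_at_right_filter; exact: cdf.
- by apply: (cvgP (df c)); apply: cvg_at_left_filter; exact: cdf.
- split; [by move=> t _; have [] := fd t|apply: cvg_at_right_filter; exact: cf
         |apply: cvg_at_left_filter; exact: cf].
- by apply: within_continuous_integrand => //; exact: f_lt1.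
have k01 : 0 <= k <= 1 by rewrite !ltW.
rewrite -ge0_integralZl_EFin //; last 3 first.
- by move=> t _; rewrite lee_fin elliptic_integrand_ge0.
- apply/measurable_EFinP; apply: measurable_funS (measurable_integrand k01) => //.
  by apply: subset_itvl; rewrite bnd_simp ltW.
- by rewrite addr_ge0 // ltW.
apply: eq_integral => t; rewrite inE /= in_itv /= => /andP[t0 tc]; rewrite -EFinM; congr (_%:E).
have t1 : t < 1 := le_lt_trans tc c1.
have t01 : -1 < t < 1 by rewrite t1 andbT (lt_le_trans _ t0) ?ltrN10.
transitivity (elliptic_integrand l (f t) * df t); first by [].
rewrite /elliptic_integrand /df /f.
have kt0 : 0 < 1 - k * t ^+ 2 by nra.
set D := 1 + k * t ^+ 2; have D0 : 0 < D := den t.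
have -> : (1 - ((1 + k) * t / D) ^+ 2) * (1 - l ^+ 2 * ((1 + k) * t / D) ^+ 2) =
   ((1 - k * t ^+ 2) / D ^+ 2) ^+ 2 * ((1 - t ^+ 2) * (1 - k ^+ 2 * t ^+ 2)).
  rewrite /l !expr_div_n !exprMn sk /D; field.
  by rewrite !lt0r_neq0 // addr_gt0.
rewrite sqrtrM ?sqr_ge0 // sqrtr_sqr ger0_norm; last first.
  by rewrite divr_ge0 ?exprn_ge0 // ltW.
have r0 : 0 < Num.sqrt ((1 - t ^+ 2) * (1 - k ^+ 2 * t ^+ 2)).
  by rewrite sqrtr_gt0 radicand_gt0.
by field; rewrite !lt0r_neq0.
Qed.

(** Here y = sqrt(1 - t^2) and x is the complementary modulus.  The left-hand
    side is split as (1 - t) + t times itself.  The first part is at most 1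
    because y <= z, and the second is bounded by (y^2 + x^2)^2 <= ((y + x) z)^2,
    which makes the right-hand side explicitly integrable. *)
Lemma log_integrand_bound (t x y z : R) :
  0 <= t /\ t <= 1 -> 0 < x /\ x <= 1 -> 0 < y -> 0 < z -> t ^+ 2 = 1 - y ^+ 2 ->
  z ^+ 2 = y ^+ 2 + x ^+ 2 - x ^+ 2 * y ^+ 2 ->
  1 / (y * z) <= 1 + t / (y ^+ 2 + x ^+ 2) + t * x / (y * (y ^+ 2 + x ^+ 2)).
Proof.
move=> [t0 t1] [x0 x1] y0 z0 tE zE.
have y1 : y <= 1 by have := sqr_ge0 t; nra.
have q0 : 0 < y ^+ 2 + x ^+ 2 by nra.
have P : (y ^+ 2 + x ^+ 2) <= (y + x) * z.
  have : 0 <= y ^+ 2 + x ^+ 2 by exact: ltW.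
  have : 0 <= (y + x) * z by rewrite mulr_ge0 ?addr_ge0 ?ltW.
  move=> a b; rewrite -(@ler_pXn2r _ 2) ?nnegrE //.
  rewrite exprMn zE -subr_ge0.
  have -> : (y + x) ^+ 2 * (y ^+ 2 + x ^+ 2 - x ^+ 2 * y ^+ 2) - (y ^+ 2 + x ^+ 2) ^+ 2 =
    y * x * (2 * (y ^+ 2 + x ^+ 2) - (y + x) ^+ 2 * (y * x)) by ring.
  have yx1 : y * x <= 1 by rewrite mulr_ile1 // ltW.
  have yx0 : 0 <= y * x by rewrite mulr_ge0 // ltW.
  rewrite mulr_ge0 // subr_ge0; apply: (@le_trans _ _ ((y + x) ^+ 2)).
    by rewrite ler_piMr // sqr_ge0.
  by have := sqr_ge0 (y - x); lra.
have zy : y <= z.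
  rewrite -(@ler_pXn2r _ 2) ?nnegrE ?(ltW y0) ?(ltW z0) // zE.
  have : 0 <= x ^+ 2 * (1 - y ^+ 2) by rewrite -tE mulr_ge0 ?sqr_ge0.
  by lra.
have -> : 1 + t / (y ^+ 2 + x ^+ 2) + t * x / (y * (y ^+ 2 + x ^+ 2)) =
    1 + t * ((y + x) / (y * (y ^+ 2 + x ^+ 2))) by field; rewrite !lt0r_neq0.
have -> : 1 / (y * z) = (1 - t) / (y * z) + t * (1 / (y * z)) by field; rewrite !lt0r_neq0.
have yz0 : 0 < y * z by rewrite mulr_gt0.
apply: lerD.
  rewrite ler_pdivrMr // mul1r; apply: (@le_trans _ _ (1 - t ^+ 2)).
    by rewrite lerD2l lerN2 expr2 ler_piMr.
  by rewrite tE opprB addrC subrK expr2 ler_wpM2l // ltW.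
rewrite ler_wpM2l // ler_pdivrMr // mulrAC ler_pdivlMr; last by rewrite mulr_gt0.
by rewrite mul1r mulrCA ler_wpM2l // ltW.
Qed.

(** The bound of the previous lemma has the primitive H below: a logarithm that
    reaches - ln x as t tends to 1, an arctangent and a linear term, the last
    two being bounded by absolute constants. *)
Lemma elliptic_F_log x : 0 < x <= 1 ->
  (elliptic_F (Num.sqrt (1 - x ^+ 2)) 1 <= (4 - ln x)%:E)%E.
Proof.
move=> /andP[x0 x1]; set l := Num.sqrt _.
have x2 : 0 <= 1 - x ^+ 2 by rewrite subr_ge0 exprn_ile1 // ltW.
have l2 : l ^+ 2 = 1 - x ^+ 2 by rewrite sqr_sqrtr.
have l01 : 0 <= l <= 1.
  rewrite sqrtr_ge0 /=; have := sqrtr_ge0 (1 - x ^+ 2); rewrite -/l => l0.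
  by rewrite -(@ler_pXn2r _ 2) ?nnegrE // expr1n l2 lerBlDr lerDl sqr_ge0.
apply: elliptic_F_sup => // c /andP[].
rewrite le_eqVlt => /predU1P[<- _|c0 c1].
  rewrite /elliptic_F set_itv1 integral_set1 lee_fin subr_ge0.
  by apply: le_trans (_ : 0 <= _) => //; rewrite ln_le0.
pose v t : R := 1 - t ^+ 2.
(* H is the primitive, on ]-1, 1[, of the majorant g of the integrand. *)
pose H t : R := t - 2^-1 * ln (v t + x ^+ 2) - atan (Num.sqrt (v t) / x).
pose g t : R := 1 + t / (v t + x ^+ 2) + t * x / (Num.sqrt (v t) * (v t + x ^+ 2)).
have v0 t : -1 < t < 1 -> 0 < v t.
  by move=> t01; have := @one_minus_gt0 _ 1 t; rewrite expr1n mul1r; apply => //; rewrite ler01 lexx.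
have vx0 t : -1 < t < 1 -> 0 < v t + x ^+ 2 by move=> /v0 h; rewrite addr_gt0 // exprn_gt0.
have dv t : is_derive t 1 v (- (2 * t)).
  by apply: is_derive_eq; rewrite /GRing.scale /=; ring.
have dH t : -1 < t < 1 -> is_derive t 1 H (g t).
  move=> t01; have s0 : 0 < Num.sqrt (v t) by rewrite sqrtr_gt0 v0.
  have dvx : is_derive t 1 (fun t => v t + x ^+ 2) (- (2 * t)).
    by apply: is_derive_eq; rewrite addr0.
  have dl : is_derive t 1 (fun t => ln (v t + x ^+ 2)) (- (2 * t) * (v t + x ^+ 2)^-1).
    apply: (is_derive_eq (@is_derive1_comp R (@ln R) (fun t => v t + x ^+ 2) t _ _
      (is_derive1_ln (vx0 t t01)) dvx)).
    by rewrite /GRing.scale /= mulrC.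
  have ds : is_derive t 1 (fun t => Num.sqrt (v t)) (- (2 * t) * (2 * Num.sqrt (v t))^-1).
    apply: (is_derive_eq (@is_derive1_comp R (@Num.sqrt R) v t _ _
      (is_derive1_sqrt (v0 t t01)) (dv t))).
    by rewrite /GRing.scale /= mulrC.
  have dw : is_derive t 1 (fun t => Num.sqrt (v t) / x) (- (2 * t) * (2 * Num.sqrt (v t))^-1 / x).
    by apply: is_derive_eq; rewrite /GRing.scale /=; ring.
  have da : is_derive t 1 (fun t => atan (Num.sqrt (v t) / x))
      ((1 + (Num.sqrt (v t) / x) ^+ 2)^-1 * (- (2 * t) * (2 * Num.sqrt (v t))^-1 / x)).
    exact: (is_derive_eq (@is_derive1_comp R (@atan R) (fun t => Num.sqrt (v t) / x) t _ _
      (is_derive1_atan _) dw)).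
  rewrite /H /g; apply: is_derive_eq.
  have vx := vx0 t t01; have sE : Num.sqrt (v t) ^+ 2 = v t by rewrite sqr_sqrtr // ltW // v0.
  rewrite /GRing.scale /=.
  move: (Num.sqrt (v t)) s0 sE => y s0 sE; rewrite -sE in vx *.
  have vx' : 0 < x ^+ 2 + y ^+ 2 by rewrite addrC.
  by field; rewrite !lt0r_neq0.
have cg t : -1 < t < 1 -> {for t, continuous g}.
  move=> t01; have s0 : 0 < Num.sqrt (v t) by rewrite sqrtr_gt0 v0.
  have vx := vx0 t t01.
  have cv : v s @[s --> t] --> v t.
    by have [d _] := dv t; apply: differentiable_continuous; apply/derivable1_diffP.
  have cvx : (v s + x ^+ 2) @[s --> t] --> v t + x ^+ 2 by apply: cvgD => //; exact: cvg_cst.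
  have csv : Num.sqrt (v s) @[s --> t] --> Num.sqrt (v t).
    by apply: (continuous_comp (f := v) (g := @Num.sqrt R)) => //; exact: sqrt_continuous.
  apply: cvgD; first apply: cvgD; first exact: cvg_cst.
    by apply: cvgM; [exact: cvg_id|apply: cvgV => //; exact: lt0r_neq0].
  apply: cvgM; first by apply: cvgMl; exact: cvg_id.
  by apply: cvgV; [rewrite lt0r_neq0 // mulr_gt0|exact: cvgM].
have Hc : (elliptic_F l c <= (H c - H 0)%:E)%E.
  apply: (elliptic_F_le l01 _ dH cg); first by rewrite c0.
  move=> t /andP[t0 t1].
  have t01 : -1 < t < 1 by rewrite t1 andbT (lt_le_trans _ t0) ?ltrN10.
  have s0 : 0 < Num.sqrt (v t) by rewrite sqrtr_gt0 v0.
  have sE : Num.sqrt (v t) ^+ 2 = v t by rewrite sqr_sqrtr // ltW // v0.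
  rewrite /elliptic_integrand /g -/(v t).
  have r0 := one_minus_gt0 l01 t01.
  have qE : 1 - l ^+ 2 * t ^+ 2 = v t + x ^+ 2 - x ^+ 2 * v t by rewrite l2 /v; ring.
  rewrite qE in r0 *; rewrite sqrtrM; last by rewrite ltW // v0.
  have zE := sqr_sqrtr (ltW r0).
  have z0 : 0 < Num.sqrt (v t + x ^+ 2 - x ^+ 2 * v t) by rewrite sqrtr_gt0.
  have vt : t ^+ 2 = 1 - v t by rewrite /v; ring.
  rewrite -sE in vt; rewrite -[in X in _ = X]sE in zE.
  have := @log_integrand_bound t x _ _ (conj t0 (ltW t1)) (conj x0 x1) s0 z0 vt zE.
  by rewrite sE.
apply: le_trans Hc _; rewrite lee_fin.
have c01 : -1 < c < 1 by rewrite c1 andbT (lt_trans _ c0) ?ltrN10.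
have -> : H c - H 0 = c + 2^-1 * (ln (1 + x ^+ 2) - ln (v c + x ^+ 2)) +
    (atan (Num.sqrt (v 0) / x) - atan (Num.sqrt (v c) / x)).
  by rewrite /H /v expr0n /= subr0; ring.
have x2' : 0 < x ^+ 2 by rewrite exprn_gt0.
have L1 : ln (1 + x ^+ 2) <= x ^+ 2 by apply: le_ln1Dx; rewrite (lt_trans _ x2') ?ltrN10.
have L2 : 2 * ln x <= ln (v c + x ^+ 2).
  rewrite mulr_natl -lnXn // ler_ln ?posrE ?vx0 //.
  by rewrite lerDr ltW // v0.
have A1 := atan_ltpi2 (Num.sqrt (v 0) / x).
have A2 : 0 <= atan (Num.sqrt (v c) / x).
  by rewrite -(@atan0 R) le_atan // divr_ge0 ?sqrtr_ge0 // ltW.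
have := pihalf_lt2 R; have : x ^+ 2 <= 1 by rewrite exprn_ile1 // ltW.
by lra.
Qed.
End EllipticIntegral2.

End EllipticIntegrals.

(** * The Groetzsch ring function *)

Section GrotzschFunction.
Local Open Scope classical_set_scope.
Local Open Scope ring_scope.

Section Grotzsch.
Variable R : realType.
Implicit Types (t c l m k x : R).
Local Notation K := (@elliptic_K R).
Local Notation mu := (@grotzsch_mu R).

(** The complementary modulus. *)
Definition comodulus l : R := Num.sqrt (1 - l ^+ 2).

Lemma comodulus_lt01 l : 0 < l < 1 -> 0 < comodulus l < 1.
Proof.
move=> /andP[l0 l1]; have l2 : 0 < 1 - l ^+ 2 by nra.
rewrite /comodulus sqrtr_gt0 l2 /= -(@ltr_pXn2r _ 2) ?nnegrE ?sqrtr_ge0 //.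
by rewrite expr1n sqr_sqrtr ?(ltW l2) // ltrBlDr ltrDl exprn_gt0.
Qed.

Lemma comodulusK l : 0 <= l <= 1 -> comodulus (comodulus l) = l.
Proof.
move=> /andP[l0 l1]; rewrite /comodulus sqr_sqrtr ?subr_ge0 ?exprn_ile1 //.
by rewrite opprB addrC subrK sqrtr_sqr ger0_norm.
Qed.

Lemma elliptic_F_fin l : 0 <= l < 1 -> elliptic_F l 1 = (K l)%:E.
Proof.
move=> /andP[l0 l1]; have l01 : 0 <= l <= 1 by rewrite l0 ltW.
rewrite /elliptic_K /Rintegral fineK //.
have x2 : 0 < 1 - l ^+ 2 by nra.
have x0 : 0 < comodulus l by rewrite sqrtr_gt0.
have x1 : comodulus l <= 1.
  rewrite -(@ler_pXn2r _ 2) ?nnegrE ?(ltW x0) // expr1n sqr_sqrtr ?(ltW x2) //.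
  by rewrite lerBlDr lerDl sqr_ge0.
have := @elliptic_F_log R (comodulus l); rewrite x0 x1 => /(_ isT).
rewrite -[Num.sqrt _]/(comodulus (comodulus l)) comodulusK //.
have := elliptic_F1_ge l01.
rewrite -[X in X \is a fin_num]/(elliptic_F l 1).
by case: (elliptic_F l 1) => [r| |] //=; rewrite ?leeNy_eq.
Qed.

Lemma elliptic_K_ge l : 0 <= l < 1 -> pi / 2 <= K l.
Proof.
move=> l01; rewrite -lee_fin -elliptic_F_fin //; apply: elliptic_F1_ge.
by case/andP: l01 => -> /ltW.
Qed.

Lemma elliptic_K_gt0 l : 0 <= l < 1 -> 0 < K l.
Proof. by move=> /elliptic_K_ge; apply: lt_le_trans; rewrite divr_gt0 ?pi_gt0. Qed.

Lemma elliptic_K_log x : 0 < x < 1 -> K (comodulus x) <= 4 - ln x.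
Proof.
move=> x01; rewrite -lee_fin -elliptic_F_fin; last first.
  by have /andP[/ltW -> ->] := comodulus_lt01 x01.
by apply: elliptic_F_log; case/andP: x01 => -> /ltW.
Qed.

Lemma elliptic_K_le l m : 0 <= l -> l <= m -> m < 1 -> K l <= K m.
Proof.
move=> l0 lm m1; have m0 := le_trans l0 lm.
have l1 := le_lt_trans lm m1.
rewrite -lee_fin -!elliptic_F_fin ?l0 ?m0 //.
apply: elliptic_F_sup; first by rewrite l0 ltW.
move=> c /andP[c0 c1]; apply: (@le_trans _ _ (elliptic_F m c)); last first.
  by apply: elliptic_F_mono => //; [rewrite m0 ltW|exact: ltW].
apply: ge0_le_integral => //.
- by move=> t _; rewrite lee_fin elliptic_integrand_ge0.
- apply/measurable_EFinP; apply: measurable_funS (measurable_integrand _) => //.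
    by apply: subset_itvl; rewrite bnd_simp ltW.
  by rewrite l0 ltW.
- apply/measurable_EFinP; apply: measurable_funS (measurable_integrand _) => //.
    by apply: subset_itvl; rewrite bnd_simp ltW.
  by rewrite m0 ltW.
move=> t /=; rewrite in_itv /= => /andP[t0 tc]; rewrite lee_fin.
have t01 : -1 < t < 1 by rewrite (lt_le_trans _ t0) ?ltrN10 // (le_lt_trans tc).
have rl : 0 < (1 - t ^+ 2) * (1 - l ^+ 2 * t ^+ 2) by apply: radicand_gt0 => //; rewrite l0 ltW.
have rm : 0 < (1 - t ^+ 2) * (1 - m ^+ 2 * t ^+ 2) by apply: radicand_gt0 => //; rewrite m0 ltW.
rewrite /elliptic_integrand !div1r lef_pV2 ?posrE ?sqrtr_gt0 //.
apply: ler_wsqrtr; rewrite ler_wpM2l //.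
  by have /andP[? ?] := t01; nra.
rewrite lerD2l lerN2 ler_wpM2r ?sqr_ge0 //; exact: lerXn2r.
Qed.

(** The ascending Landen transform of a modulus. *)
Definition ascending l : R := 2 * Num.sqrt l / (1 + l).

Lemma ascending_lt01 k : 0 < k < 1 -> 0 < ascending k < 1.
Proof.
move=> /andP[k0 k1]; have s0 : 0 < Num.sqrt k by rewrite sqrtr_gt0.
have sk : Num.sqrt k ^+ 2 = k by rewrite sqr_sqrtr // ltW.
have k10 : 0 < 1 + k by rewrite addr_gt0.
rewrite /ascending divr_gt0 ?mulr_gt0 //= ltr_pdivrMr // mul1r -{2}sk.
have s1 : Num.sqrt k < 1 by rewrite -(@ltr_pXn2r _ 2) ?nnegrE ?ltW // sk expr1n.
have : 0 < (1 - Num.sqrt k) ^+ 2 by rewrite exprn_gt0 // subr_gt0.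
by lra.
Qed.

(** Since (1 + k) d / (1 + k d^2) is at least d and less than 1, the
    transformation of incomplete integrals passes to the supremum in both
    directions. *)
Lemma elliptic_K_landen k : 0 < k < 1 -> K (ascending k) = (1 + k) * K k.
Proof.
move=> k01; have /andP[k0 k1] := k01.
have /andP[l0 l1] := ascending_lt01 k01; set l := ascending k in l0 l1 *.
have k10 : 0 < 1 + k by rewrite addr_gt0.
have l01 : 0 <= l <= 1 by rewrite !ltW.
have k01' : 0 <= k <= 1 by rewrite !ltW.
have Fk : elliptic_F k 1 = (K k)%:E by rewrite elliptic_F_fin // k1 ltW.
have Fl : elliptic_F l 1 = (K l)%:E by rewrite elliptic_F_fin // l1 ltW.
have le1 c : 0 <= c < 1 -> (1 + k) * c <= 1 + k * c ^+ 2.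
  move=> /andP[c0 c1]; rewrite -subr_ge0.
  have -> : 1 + k * c ^+ 2 - (1 + k) * c = (1 - c) * (1 - k * c) by ring.
  by rewrite mulr_ge0 ?subr_ge0 // ?mulr_ile1 // ltW.
apply/eqP; rewrite eq_le; apply/andP; split.
  rewrite -lee_fin -Fl EFinM -Fk; apply: elliptic_F_sup => // d /andP[d0 d1].
  have d2 : d ^+ 2 <= 1 by rewrite exprn_ile1 // ltW.
  have q0 : 0 < 1 + k * d ^+ 2 by rewrite ltr_pwDl // mulr_ge0 ?sqr_ge0 // ltW.
  apply: (@le_trans _ _ (elliptic_F l ((1 + k) * d / (1 + k * d ^+ 2)))).
    apply: elliptic_F_mono => //; last first.
      by rewrite ler_pdivrMr // mul1r le1 // d0.
    by rewrite ler_pdivlMr // mulrC ler_wpM2r // lerD2l ler_piMr // ltW.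
  rewrite /l elliptic_F_landen ?d0 //.
  by apply: lee_wpmul2l; [rewrite lee_fin ltW|apply: elliptic_F_mono => //; exact: ltW].
rewrite mulrC -ler_pdivlMr // -lee_fin -Fk; apply: elliptic_F_sup => // c /andP[c0 c1].
have -> : elliptic_F k c =
    ((1 + k)^-1%:E * elliptic_F l ((1 + k) * c / (1 + k * c ^+ 2)))%E.
  by rewrite elliptic_F_landen ?c0 // muleA -EFinM mulVf ?mul1e // lt0r_neq0.
rewrite EFinM -Fl [X in (_ <= X)%E]muleC; apply: lee_wpmul2l; first by rewrite lee_fin invr_ge0 ltW.
have q0 : 0 < 1 + k * c ^+ 2 by rewrite ltr_pwDl // mulr_ge0 ?sqr_ge0 // ltW.
apply: elliptic_F_mono => //.
by rewrite ler_pdivrMr // mul1r le1 // c0.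
Qed.

Lemma descend_lt01 k : 0 < k < 1 -> 0 < (1 - k) / (1 + k) < 1.
Proof.
move=> /andP[k0 k1]; have k10 : 0 < 1 + k by rewrite addr_gt0.
by rewrite divr_gt0 ?subr_gt0 //= ltr_pdivrMr // mul1r; lra.
Qed.

Lemma comodulus_ascending k : 0 < k < 1 -> comodulus (ascending k) = (1 - k) / (1 + k).
Proof.
move=> k01; have /andP[k0 k1] := k01; have k10 : 0 < 1 + k by rewrite addr_gt0.
have -> : comodulus (ascending k) = Num.sqrt (((1 - k) / (1 + k)) ^+ 2).
  congr Num.sqrt; rewrite /ascending expr_div_n exprMn sqr_sqrtr ?ltW //.
  by field; rewrite lt0r_neq0.
by rewrite sqrtr_sqr ger0_norm // ltW //; case/andP: (descend_lt01 k01).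
Qed.

(** The complementary moduli are related by the same transform, in the opposite
    direction. *)
Lemma ascending_descend k : 0 < k < 1 -> ascending ((1 - k) / (1 + k)) = comodulus k.
Proof.
move=> k01; have /andP[k0 k1] := k01; have d01 := descend_lt01 k01.
have a01 := ascending_lt01 d01; have k10 : 0 < 1 + k by rewrite addr_gt0.
rewrite -[LHS]comodulusK; last by case/andP: a01 => /ltW -> /ltW ->.
by rewrite comodulus_ascending //; congr comodulus; field; rewrite lt0r_neq0 // lt0r_neq0 //; lra.
Qed.

Lemma grotzsch_muE l : mu l = pi / 2 * (K (comodulus l) / K l).
Proof. by []. Qed.

Lemma grotzsch_mu_gt0 l : 0 < l < 1 -> 0 < mu l.
Proof.
move=> l01; have /andP[c0 c1] := comodulus_lt01 l01; have /andP[l0 l1] := l01.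
by rewrite grotzsch_muE mulr_gt0 ?divr_gt0 ?pi_gt0 ?elliptic_K_gt0 ?ltW.
Qed.

Lemma grotzsch_mu_anti l m : 0 < l -> l <= m -> m < 1 -> mu m <= mu l.
Proof.
move=> l0 lm m1; have m0 := lt_le_trans l0 lm; have l1 := le_lt_trans lm m1.
have /andP[cm0 cm1] : 0 < comodulus m < 1 by rewrite comodulus_lt01 ?m0.
have /andP[cl0 cl1] : 0 < comodulus l < 1 by rewrite comodulus_lt01 ?l0.
have Kl : 0 < K l by rewrite elliptic_K_gt0 // l1 ltW.
have Km : 0 < K m by rewrite elliptic_K_gt0 // m1 ltW.
rewrite !grotzsch_muE ler_pM2l ?divr_gt0 ?pi_gt0 //.
apply: ler_pM; rewrite ?invr_ge0 ?(ltW Km) //.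
- by rewrite ltW // elliptic_K_gt0 // cm1 ltW.
- apply: elliptic_K_le => //; first exact: ltW.
  by apply: ler_wsqrtr; rewrite lerD2l lerN2; apply: lerXn2r; rewrite ?nnegrE ?(ltW l0) ?(ltW m0).
- by rewrite lef_pV2 ?posrE //; apply: elliptic_K_le => //; exact: ltW.
Qed.

(** The numerator and the denominator of mu are transformed by the two forms of
    the Landen transformation; their factors (1 + k)/2 and 1 + k leave one half.
    *)
Lemma grotzsch_mu_landen k : 0 < k < 1 -> mu (ascending k) = mu k / 2.
Proof.
move=> k01; have /andP[k0 k1] := k01; have k10 : 0 < 1 + k by rewrite addr_gt0.
have /andP[d0 d1] := descend_lt01 k01.
rewrite !grotzsch_muE comodulus_ascending // elliptic_K_landen //.
rewrite -(ascending_descend k01) elliptic_K_landen ?d0 //.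
have Kk : 0 < K k by rewrite elliptic_K_gt0 // k1 ltW.
have := elliptic_K_gt0 (_ : 0 <= (1 - k) / (1 + k) < 1); rewrite (ltW d0) d1 => /(_ isT).
move: (K k) (K _) Kk => a b a0 b0; field; rewrite !lt0r_neq0 //.
Qed.

Lemma grotzsch_mu_comodulus l : 0 < l < 1 -> mu l * mu (comodulus l) = pi ^+ 2 / 4.
Proof.
move=> l01; have /andP[l0 l1] := l01; have /andP[c0 c1] := comodulus_lt01 l01.
rewrite !grotzsch_muE comodulusK ?ltW //.
have : 0 < K l by rewrite elliptic_K_gt0 // l1 ltW.
have : 0 < K (comodulus l) by rewrite elliptic_K_gt0 // c1 ltW.
by move: (K l) (K _) => a b b0 a0; field; rewrite !lt0r_neq0.
Qed.

Lemma grotzsch_mu_log_weak x : 0 < x < 1 -> mu x <= 4 - ln x.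
Proof.
move=> x01; have /andP[x0 x1] := x01; apply: le_trans (elliptic_K_log x01).
have /andP[c0 c1] := comodulus_lt01 x01.
have Kc : 0 < K (comodulus x) by rewrite elliptic_K_gt0 // c1 ltW.
have Kx : pi / 2 <= K x by rewrite elliptic_K_ge // x1 ltW.
have p0 : 0 < pi / 2 :> R by rewrite divr_gt0 ?pi_gt0.
rewrite grotzsch_muE mulrCA -[leRHS]mulr1 ler_pM2l // ler_pdivrMr ?mul1r //.
exact: lt_le_trans Kx.
Qed.

(** If x is the Landen transform of k, then mu(x) = mu(k)/2 and x^2 <= 4k, so
    that an estimate mu <= log(4/x) + e on the whole interval improves itself to
    e/2. *)
Lemma grotzsch_mu_log x : 0 < x < 1 -> mu x <= ln (4 / x).
Proof.
move=> x01.
suff H n : forall x, 0 < x < 1 -> mu x <= ln (4 / x) + 4 / 2 ^+ n.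
  apply/ler_addgt0Pr => e e0; pose n := Num.truncn (4 / e).
  apply: le_trans (H n _ x01) _; rewrite lerD2l ler_pdivrMr ?exprn_gt0 // mulrC -ler_pdivrMr //.
  apply: le_trans (_ : n.+1%:R <= _); first by rewrite ltW // truncnS_gt.
  by rewrite -natrX ler_nat ltn_expl.
elim: n => [|n IH] {x01}x x01; have /andP[x0 x1] := x01.
  apply: le_trans (grotzsch_mu_log_weak x01) _.
  rewrite expr0 divr1 ln_div ?posrE //; have : 0 <= ln 4 :> R by rewrite ln_ge0 // ler1n.
  by lra.
have c01 := comodulus_lt01 x01; have d01 := descend_lt01 c01.
have xE : x = ascending ((1 - comodulus x) / (1 + comodulus x)).
  by rewrite ascending_descend // comodulusK // !ltW.
set k := (1 - _) / _ in d01 xE; clearbody k; have /andP[k0 k1] := d01.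
have k10 : 0 < 1 + k by rewrite addr_gt0.
rewrite [X in mu X]xE grotzsch_mu_landen //.
have Hk := IH _ d01.
have xk : x ^+ 2 <= 4 * k.
  rewrite xE /ascending expr_div_n exprMn sqr_sqrtr ?(ltW k0) // ler_pdivrMr ?exprn_gt0 //.
  have -> : 2 ^+ 2 = 4 :> R by ring.
  have k4 : 0 <= 4 * k by rewrite mulr_ge0 // ltW.
  by rewrite ler_peMr // exprn_ege1 //; lra.
have L : ln (4 / k) <= 2 * ln (4 / x).
  rewrite [2 * ln _]mulr_natl -lnXn ?divr_gt0 // ler_ln ?posrE ?exprn_gt0 ?divr_gt0 //.
  rewrite expr_div_n ler_pdivrMr // mulrAC ler_pdivlMr ?exprn_gt0 //.
  by rewrite (_ : 4 ^+ 2 = 4 * 4) // -mulrA ler_pM2l.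
have -> : 4 / 2 ^+ n.+1 = (4 / 2 ^+ n) / 2 :> R by rewrite exprS invfM; ring.
by lra.
Qed.

End Grotzsch.

End GrotzschFunction.

(** * The nome of a modulus *)

Section NomeAndModulus.
Local Open Scope complex_scope.
Local Open Scope classical_set_scope.

Section ThetaConstants.
Variable R : realType.
Implicit Types (h q x : R).
Local Notation mu := (@grotzsch_mu R).

Let u1 : cmod (1 : R[i]) = 1. Proof. exact: cmod1. Qed.
Let uN1 : cmod (-1 : R[i]) = 1. Proof. by rewrite cmodN cmod1. Qed.

Lemma theta_const_le h : 0 < h < 1 -> theta_fun h 1 <= 1 + 2 / (1 - h).
Proof.
move=> h01; have /andP[h0 h1] := h01.
have lim := theta_fun_cvg h01 u1.
rewrite -(cvg_lim _ lim) //; apply: limr_le; first exact: (cvgP _ lim).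
apply: nearW => N; apply: le_trans (ler_norm _) _; apply: le_trans (Re_le_cmod _) _.
have hV : 1 <= h^-1 by rewrite invf_ge1 // ltW.
apply: (cmod_theta_sum_bound h01).
- by rewrite -cmod_eq0 uN1 oner_eq0.
- by rewrite uN1.
- by rewrite cmodV uN1 invr1.
Qed.

(** The terms of odd index change sign between w = 1 and w = -1, and the two
    terms with j = 1 and j = -1 already contribute 4h. *)
Lemma theta_const_gap h : 0 < h < 1 -> theta_fun h (-1) + 4 * h <= theta_fun h 1.
Proof.
move=> h01; have /andP[h0 h1] := h01.
have lim1 := theta_fun_cvg h01 u1; have limN := theta_fun_cvg h01 uN1.
have lim : (fun N => complex.Re (theta_sum h (- 1) N) - complex.Re (theta_sum h (- -1) N))
    @ \oo --> (theta_fun h 1 - theta_fun h (-1) : R) by exact: cvgB lim1 limN.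
have step (a b o r e : R) : 0 <= e -> o = 1 -> `|r| <= 1 ->
    a - b <= 2 * o * e + a - (2 * r * e + b).
  by move=> e0 ->; rewrite ler_norml => /andP[_ r1]; nra.
have gap N : 4 * h <=
    complex.Re (theta_sum h (- 1) N.+1) - complex.Re (theta_sum h (- -1) N.+1).
  elim: N => [|N IH].
    rewrite [X in _ <= X - _](Re_theta_sumS h 0 u1) [X in _ <= _ - X](Re_theta_sumS h 0 uN1).
    rewrite !theta_sum0 !expr1 /=; lra.
  apply: le_trans IH _.
  rewrite [X in _ <= X - _](Re_theta_sumS h N.+1 u1) [X in _ <= _ - X](Re_theta_sumS h N.+1 uN1).
  apply: step.
  - by rewrite exprn_ge0 // ltW.
  - by rewrite expr1n.
  - by apply: le_trans (Re_le_cmod _) _; rewrite cmodX uN1 expr1n.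
rewrite -lerBrDl -(cvg_lim _ lim) //.
apply: limr_ge; first exact: (cvgP _ lim).
near=> N; have : (0 < N)%N by near: N; exact: nbhs_infty_gt.
by move/prednK <-; exact: gap.
Unshelve. all: end_near. Qed.

(** In classical notation theta(1) and theta(-1) are the theta constants theta_3
    and theta_4, and this is the complementary modulus (theta_4 / theta_3)^2 of
    nome h. *)
Definition theta_modulus h : R := (theta_ratio h 1) ^- 2.

Lemma theta_modulus_lt01 h : 0 < h < 1 -> 0 < theta_modulus h < 1.
Proof.
move=> h01; have /andP[h0 h1] := h01.
have := theta_const_gap h01; have := theta_fun_gt0 h01 u1; have := theta_fun_gt0 h01 uN1.
rewrite /theta_modulus /theta_ratio; move: (theta_fun h 1) (theta_fun h (-1)) => a b b0 a0 gap.
have ba : b < a by lra.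
rewrite invr_gt0 exprn_gt0 ?divr_gt0 //= invf_lt1 ?exprn_gt0 ?divr_gt0 //.
by rewrite exprn_egt1 // ltr_pdivlMr // mul1r.
Qed.

(** The first addition formula at (1, -1) and (1, 1): the pair of theta
    constants of nome h^2 is, up to squares, the arithmetic-geometric mean step
    applied to those of nome h. *)
Lemma theta_fun_sqr h : 0 < h < 1 ->
  theta_fun h 1 ^+ 2 + theta_fun h (-1) ^+ 2 = 2 * theta_fun (h ^+ 2) 1 ^+ 2 /\
  theta_fun h 1 * theta_fun h (-1) = theta_fun (h ^+ 2) (-1) ^+ 2.
Proof.
move=> h01.
have half (x y z : R) : y = x -> x + y = 2 * (z * z) -> x = z ^+ 2 by move=> -> e; lra.
have := theta_fun_addition h01 u1 uN1; have := theta_fun_addition h01 u1 u1.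
rewrite opprK mul1r invrN invr1 !mulrN !mulr1 !opprK.
move: (theta_fun h 1) (theta_fun h (-1)) (theta_fun (h ^+ 2) 1) (theta_fun (h ^+ 2) (-1)) => a b c d.
move=> e1 e2; split; first by rewrite !expr2 -e2.
by apply: (half _ (b * a)) => //; rewrite mulrC.
Qed.

Lemma theta_modulus_sqr h : 0 < h < 1 ->
  theta_modulus (h ^+ 2) = ascending (theta_modulus h).
Proof.
move=> h01; have p01 : 0 < h ^+ 2 < 1 by exact: expr_lt01.
have := theta_fun_sqr h01; have := theta_fun_gt0 h01 u1; have := theta_fun_gt0 h01 uN1.
have := theta_fun_gt0 p01 u1; have := theta_fun_gt0 p01 uN1.
rewrite /theta_modulus /theta_ratio.
move: (theta_fun h 1) (theta_fun h (-1)) (theta_fun (h ^+ 2) 1) (theta_fun (h ^+ 2) (-1)) => a b c d.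
move=> d0 c0 b0 a0 [e1 e2]; rewrite /ascending.
have -> : (a / b) ^- 2 = (b / a) ^+ 2 by field; rewrite !lt0r_neq0.
rewrite sqrtr_sqr ger0_norm ?divr_ge0 ?ltW // expr_div_n invf_div -e2.
have -> : c ^+ 2 = (a ^+ 2 + b ^+ 2) / 2 by rewrite e1; field.
by field; rewrite !lt0r_neq0 // addr_gt0 // exprn_gt0.
Qed.

(** Squaring the nome many times brings the complement of theta_modulus close to
    0; this lower bound keeps it comparable to the nome, so that mu there is
    controlled by a logarithm. *)
Lemma theta_modulus_gap h : 0 < h < 1 ->
  h * (1 - h) / 2 <= comodulus (theta_modulus (h ^+ 2)).
Proof.
move=> h01; have /andP[h0 h1] := h01.
rewrite theta_modulus_sqr // comodulus_ascending ?theta_modulus_lt01 //.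
have := theta_const_le h01.
have := theta_const_gap h01; have := theta_fun_gt0 h01 u1; have := theta_fun_gt0 h01 uN1.
rewrite /theta_modulus /theta_ratio.
move: (theta_fun h 1) (theta_fun h (-1)) => a b b0 a0 gap ub.
have -> : (1 - (a / b) ^- 2) / (1 + (a / b) ^- 2) = (a ^+ 2 - b ^+ 2) / (a ^+ 2 + b ^+ 2).
  by field; rewrite !lt0r_neq0 // ?addr_gt0 ?exprn_gt0 ?divr_gt0.
have s0 : 0 < a ^+ 2 + b ^+ 2 by rewrite addr_gt0 ?exprn_gt0.
have a1 : a * (1 - h) <= 3.
  rewrite -ler_pdivlMr ?subr_gt0 //; apply: le_trans ub _.
  rewrite -subr_ge0; have -> : 3 / (1 - h) - (1 + 2 / (1 - h)) = h / (1 - h).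
    by field; rewrite lt0r_neq0 // subr_gt0.
  by rewrite divr_ge0 ?subr_ge0 // ltW.
rewrite ler_pdivlMr //.
have ba : b <= a by lra.
apply: (@le_trans _ _ (h * (1 - h) / 2 * (a * (a + b)))).
  rewrite ler_wpM2l ?divr_ge0 ?mulr_ge0 ?subr_ge0 ?ltW //; nra.
have -> : a ^+ 2 - b ^+ 2 = (a - b) * (a + b) by ring.
rewrite mulrA ler_wpM2r ?addr_ge0 ?ltW //.
have -> : h * (1 - h) / 2 * a = h * (a * (1 - h)) / 2 by ring.
nra.
Qed.

Lemma grotzsch_mu_theta_step h : 0 < h < 1 ->
  mu (comodulus (theta_modulus h)) = mu (comodulus (theta_modulus (h ^+ 2))) / 2.
Proof.
move=> h01; have l01 := theta_modulus_lt01 h01.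
rewrite theta_modulus_sqr // comodulus_ascending // -grotzsch_mu_landen ?descend_lt01 //.
by rewrite ascending_descend.
Qed.

Lemma halving_iter (f : R -> R) h n :
  (forall q, 0 < q < 1 -> f q = f (q ^+ 2) / 2) -> 0 < h < 1 ->
  f h = f (h ^+ (2 ^ n)) / 2 ^+ n.
Proof.
move=> step h01; elim: n => [|n ->]; first by rewrite expn0 expr1 expr0 divr1.
rewrite step; last by rewrite expr_lt01 // expn_gt0.
by rewrite -exprM -expnSr exprSr invfM mulrA mulrAC.
Qed.

(** After n + 1 squarings mu at the complement is bounded by log(1/h) 2^n up to
    a constant, by the previous lower bound and the logarithmic growth of mu;
    division by 2^(n+1) removes the constant in the limit. *)
Lemma grotzsch_mu_theta h : 0 < h < 1 ->
  mu (comodulus (theta_modulus h)) <= - ln h / 2.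
Proof.
move=> h01; have /andP[h0 h1] := h01.
(* C absorbs the constants of the lower bound q (1 - h) / 2, uniformly over all
   nomes q <= h. *)
pose C := ln (8 / (1 - h)).
have C0 : 0 <= C.
  by rewrite ln_ge0 // ler_pdivlMr ?subr_gt0 // mul1r; lra.
suff H n : mu (comodulus (theta_modulus h)) <= - ln h / 2 + C / 2 ^+ n.+1.
  apply/ler_addgt0Pr => e e0; pose n := Num.truncn (C / e).
  apply: le_trans (H n) _; rewrite lerD2l ler_pdivrMr ?exprn_gt0 // mulrC -ler_pdivrMr //.
  apply: le_trans (_ : n.+1%:R <= _); first by rewrite ltW // truncnS_gt.
  by rewrite -natrX ler_nat ltnW // ltn_expl.
set q := h ^+ (2 ^ n); have q01 : 0 < q < 1 by rewrite expr_lt01 // expn_gt0.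
have /andP[q0 q1] := q01.
rewrite (halving_iter n.+1 grotzsch_mu_theta_step h01) expnSr exprM -/q.
have p01 : 0 < q ^+ 2 < 1 by exact: expr_lt01.
have /andP[c0 c1] := comodulus_lt01 (theta_modulus_lt01 p01).
have gap : q * (1 - h) / 2 <= comodulus (theta_modulus (q ^+ 2)).
  apply: le_trans (theta_modulus_gap q01); rewrite ler_wpM2r // ler_wpM2l ?(ltW q0) //.
  rewrite lerD2l lerN2 /q -[leRHS]expr1; apply: ler_wiXn2l; rewrite ?ltW //.
  by rewrite expn_gt0.
have g0 : 0 < q * (1 - h) / 2 by rewrite divr_gt0 // mulr_gt0 // subr_gt0.
have M : mu (comodulus (theta_modulus (q ^+ 2))) <= C - ln h *+ (2 ^ n).
  apply: le_trans (grotzsch_mu_anti g0 gap c1) _.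
  apply: le_trans (grotzsch_mu_log _) _; first by rewrite g0 (le_lt_trans gap).
  rewrite -lnXn // -/q -ln_div ?posrE ?divr_gt0 ?subr_gt0 //.
  rewrite le_eqVlt; apply/orP; left; apply/eqP; congr ln.
  by field; rewrite lt0r_neq0 // lt0r_neq0 // subr_gt0.
rewrite ler_pdivrMr ?exprn_gt0 //; apply: le_trans M _.
rewrite le_eqVlt; apply/orP; left; apply/eqP.
rewrite -[ln h *+ _]mulr_natl natrX exprS; field.
by rewrite expf_neq0.
Qed.

End ThetaConstants.

End NomeAndModulus.

(** * From two intervals to the symmetric configuration *)

Section CrossRatio.
Local Open Scope classical_set_scope.
Local Open Scope ring_scope.
Local Open Scope complex_scope.

Section Assembly.
Variable R : realType.
Local Notation mu := (@grotzsch_mu R).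

(** Only F = theta_ratio h 1 >= s has to be shown.  Otherwise s^(-2) <= F^(-2),
    and monotonicity of mu, the bound at the complementary modulus and the
    product formula pi^2/4 force h below the threshold. *)
Lemma zolotarev_rational_nome (s h : R) k : 1 < s ->
  expR (- (pi ^+ 2 / (2 * mu (s ^- 2)))) < h < 1 ->
  exists zs : seq R, [/\ size zs = k, forall z, z \in zs -> 0 < z &
   forall x, s^-1 <= x <= s -> \prod_(z <- zs) (`|x - z| / (x + z)) <= 2 * h ^+ k].
Proof.
move=> s1 /andP[nome_h h1]; have s0 : 0 < s := lt_trans ltr01 s1.
have h01 : 0 < h < 1 by rewrite h1 (lt_trans (expR_gt0 _) nome_h).
have [zs [zs_size zs_gt0 zsP]] := zolotarev_rational h01 k.
exists zs; split=> // x /andP[sx xs]; apply: zsP.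
have s_le : s <= theta_ratio h 1.
  rewrite leNgt; apply/negP => lt_s.
  have F0 : 0 < theta_ratio h 1 := lt_le_trans ltr01 (theta_ratio1_ge1 h01).
  have l0 : 0 < s ^- 2 by rewrite invr_gt0 exprn_gt0.
  have /andP[t0 t1] := theta_modulus_lt01 h01.
  have lt_mod : s ^- 2 <= theta_modulus h.
    rewrite /theta_modulus lef_pV2 ?posrE ?exprn_gt0 //.
    by rewrite lerXn2r ?nnegrE ?(ltW s0) ?(ltW F0) // ltW.
  have mu0 : 0 < mu (s ^- 2).
    by rewrite grotzsch_mu_gt0 // l0 invf_lt1 ?exprn_gt0 // exprn_egt1.
  have mut := grotzsch_mu_gt0 (theta_modulus_lt01 h01).
  have le1 := grotzsch_mu_anti l0 lt_mod t1.
  have le2 := grotzsch_mu_theta h01.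
  have prod := grotzsch_mu_comodulus (theta_modulus_lt01 h01).
  have muc := grotzsch_mu_gt0 (comodulus_lt01 (theta_modulus_lt01 h01)).
  have : pi ^+ 2 / 4 <= mu (s ^- 2) * (- ln h / 2).
    by rewrite -prod; apply: ler_pM => //; exact: ltW.
  move: (mu (s ^- 2)) mu0 nome_h => m m0 nome_h le.
  move: nome_h; apply/negP; rewrite -leNgt -ler_ln ?posrE ?expR_gt0 //; last by case/andP: h01.
  rewrite expRK lerNr ler_pdivrMr ?mulr_gt0 //.
  by move: le; rewrite ler_pdivrMr //; lra.
have F0 : 0 < theta_ratio h 1 := lt_le_trans s0 s_le.
rewrite (le_trans xs s_le) andbT (le_trans _ sx) //.
by rewrite lef_pV2 ?posrE.
Qed.

(** The map is a weighted mean of 1/s and s on [a, b], with weights b - t and C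
    (t - a), so that a goes to 1/s and b to s.  The constant C is chosen to send
    c to -s, and then the cross-ratio condition says that d goes to -1/s.
    Numerator and denominator are kept apart since they enter the factors of the
    rational function separately. *)
Lemma mobius_intervals_lt (a b c d s : R) : a < b -> b < c -> c < d -> 1 < s ->
  (s + s^-1) ^+ 2 * ((c - b) * (d - a)) = 4 * ((c - a) * (d - b)) ->
  exists u0 u1 v0 v1 : R,
   (forall x, a <= x <= b -> v0 + v1 * x != 0 /\
     s^-1 <= (u0 + u1 * x) / (v0 + v1 * x) <= s) /\
   (forall y, c <= y <= d -> v0 + v1 * y != 0 /\
     s^-1 <= - ((u0 + u1 * y) / (v0 + v1 * y)) <= s).
Proof.
move=> ab bc cd s1 cross; have s0 : 0 < s := lt_trans ltr01 s1.
have ca : 0 < c - a by lra.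
have da : 0 < d - a by lra.
have cb : 0 < c - b by lra.
have ba : 0 < b - a by lra.
have ss : s^-1 < s by rewrite (@lt_trans _ _ 1) // invf_lt1.
have si : 0 < s^-1 by rewrite invr_gt0.
pose e := s + s^-1; have e0 : 0 < e by rewrite addr_gt0.
(* C is the solution of u c + s * v c = 0. *)
pose C := e * (c - b) / (2 * s * (c - a)).
have C0 : 0 < C by rewrite divr_gt0 ?mulr_gt0.
pose u t := (t - b) / s - s * C * (t - a).
pose v t := (t - b) - C * (t - a).
exists (- (b / s) + s * C * a), (s^-1 - s * C), (C * a - b), (1 - C).
have uE t : - (b / s) + s * C * a + (s^-1 - s * C) * t = u t by rewrite /u; ring.
have vE t : C * a - b + (1 - C) * t = v t by rewrite /v; ring.
split=> t /andP[t1 t2]; rewrite uE vE.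
  have w1 : 0 <= t - a by rewrite subr_ge0.
  have w2 : 0 <= b - t by rewrite subr_ge0.
  have w3 : 0 <= C * (t - a) by rewrite mulr_ge0 // ltW.
  have v0 : 0 < - v t.
    rewrite /v; have [lt|ge] := ltrP t b; first by lra.
    have -> : t = b by apply/eqP; rewrite eq_le t2 ge.
    by rewrite subrr sub0r opprK mulr_gt0.
  split; first by rewrite -oppr_eq0 lt0r_neq0.
  have -> : u t / v t = (- u t) / (- v t) by rewrite invrN mulrNN.
  rewrite ler_pdivlMr // ler_pdivrMr //; apply/andP; split; rewrite -subr_ge0.
    have -> : - u t - s^-1 * - v t = (s - s^-1) * (C * (t - a)) by rewrite /u /v; ring.
    by rewrite mulr_ge0 // subr_ge0 ltW.
  have -> : s * - v t - - u t = (s - s^-1) * (b - t) by rewrite /u /v; ring.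
  by rewrite mulr_ge0 // subr_ge0 ltW.
have E1 : u t + s * v t = e * (b - a) * (t - c) / (c - a).
  by rewrite /u /v /C /e; field; rewrite !lt0r_neq0.
have E2 : u t + s^-1 * v t = - (2 / s * (b - a) * (d - t) / (d - a)).
  have -> : u t + s^-1 * v t = 2 / s * (t - b) - e * C * (t - a) by rewrite /u /v /e; ring.
  have -> : e * C = 2 / s * (d - b) / (d - a).
    have -> : e * C = e ^+ 2 * ((c - b) * (d - a)) / (2 * s * (c - a) * (d - a)).
      by rewrite /C; field; rewrite !lt0r_neq0.
    by rewrite cross; field; rewrite !lt0r_neq0.
  by field; rewrite !lt0r_neq0.
have P1 : 0 <= u t + s * v t.
  by rewrite E1 !(divr_ge0, mulr_ge0) ?(ltW e0) ?(ltW ba) ?(ltW ca) ?subr_ge0.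
have P2 : u t + s^-1 * v t <= 0.
  by rewrite E2 oppr_le0 !(divr_ge0, mulr_ge0) ?(ltW s0) ?(ltW ba) ?(ltW da) ?subr_ge0.
have v0 : 0 < v t.
  have ss0 : 0 < s - s^-1 by rewrite subr_gt0.
  rewrite -(pmulr_rgt0 _ ss0).
  have -> : (s - s^-1) * v t = (u t + s * v t) - (u t + s^-1 * v t) by ring.
  rewrite subr_gt0; have [lt|ge] := ltrP c t.
    by apply: le_lt_trans P2 _; rewrite E1 !(divr_gt0, mulr_gt0) // subr_gt0.
  apply: lt_le_trans P1; rewrite E2 oppr_lt0 !(divr_gt0, mulr_gt0) // subr_gt0.
  exact: le_lt_trans ge cd.
split; first exact: lt0r_neq0.
rewrite -mulNr ler_pdivlMr // ler_pdivrMr //; lra.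
Qed.

(** The reflection t |-> -t exchanges the two relative positions of the
    intervals. *)
Lemma mobius_intervals (a b c d s : R) : a < b -> c < d -> b < c \/ d < a -> 1 < s ->
  (s + s^-1) ^+ 2 = 4 * abs_cross_ratio a b c d ->
  exists u0 u1 v0 v1 : R,
   (forall x, a <= x <= b -> v0 + v1 * x != 0 /\
     s^-1 <= (u0 + u1 * x) / (v0 + v1 * x) <= s) /\
   (forall y, c <= y <= d -> v0 + v1 * y != 0 /\
     s^-1 <= - ((u0 + u1 * y) / (v0 + v1 * y)) <= s).
Proof.
move=> ab cd sep s1; rewrite /abs_cross_ratio => cross; case: sep => [bc|da].
  apply: mobius_intervals_lt => //; rewrite cross !gtr0_norm ?subr_gt0 //; try lra.
  by field; rewrite !lt0r_neq0 // subr_gt0; lra.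
have [|||||u0 [u1 [v0 [v1 [hx hy]]]]] := @mobius_intervals_lt (- b) (- a) (- d) (- c) s.
- lra.
- lra.
- lra.
- exact: s1.
- rewrite cross !ltr0_norm ?subr_lt0 //; try lra.
  by field; rewrite !ltr0_neq0 // subr_lt0; lra.
exists u0, (- u1), v0, (- v1); split=> t /andP[t1 t2]; rewrite !mulNr -(mulrN u1) -(mulrN v1).
  by apply: hx; rewrite !lerN2 t2.
by apply: hy; rewrite !lerN2 t2.
Qed.

Lemma loewner_interval_decay (a b c d s h : R) n (x y : 'I_n -> R) (r t : 'I_n -> R[i]) m k :
  a < b -> c < d -> b < c \/ d < a ->
  (forall i, a <= x i <= b) -> (forall i, c <= y i <= d) ->
  1 < s -> (s + s^-1) ^+ 2 = 4 * abs_cross_ratio a b c d ->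
  expR (- (pi ^+ 2 / (2 * mu (s ^- 2)))) < h < 1 -> (0 < m)%N ->
  singular_value (loewner_mx x y r t) (m + 2 * k) <=
    4 * h ^+ (2 * k) * singular_value (loewner_mx x y r t) m.
Proof.
move=> ab cd sep xab ycd s1 cross hh m0.
have h0 : 0 < h by case/andP: hh => /(lt_trans (expR_gt0 _)).
have [zs [zs_size zs_gt0 zsP]] := zolotarev_rational_nome k s1 hh.
have [u0 [u1 [v0 [v1 [hx hy]]]]] := mobius_intervals ab cd sep s1 cross.
pose u p := u0 + u1 * p; pose v p := v0 + v1 * p.
(* The factors of (T - z) / (T + z) with T = u / v, cleared of denominators. *)
pose fs := [seq (fun p => u p - z * v p, fun p => u p + z * v p) | z <- zs].
have si : 0 < s^-1 by rewrite invr_gt0 (lt_trans ltr01).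
have xy i j : x i != y j.
  have /andP[? ?] := xab i; have /andP[? ?] := ycd j.
  by apply/eqP => e; case: sep; lra.
have xz z i : z \in zs -> u (x i) + z * v (x i) != 0.
  move=> /zs_gt0 z0; have [v_neq0 /andP[T1 _]] := hx _ (xab i).
  have -> : u (x i) + z * v (x i) = v (x i) * (u (x i) / v (x i) + z) by field; exact: v_neq0.
  by rewrite mulf_neq0 // lt0r_neq0 // addr_gt0 // (lt_le_trans si).
have yz z i : z \in zs -> u (y i) - z * v (y i) != 0.
  move=> /zs_gt0 z0; have [v_neq0 /andP[T1 _]] := hy _ (ycd i).
  have -> : u (y i) - z * v (y i) = - v (y i) * (- (u (y i) / v (y i)) + z).
    by field; exact: v_neq0.
  by rewrite mulf_neq0 ?oppr_eq0 // lt0r_neq0 // addr_gt0 // (lt_le_trans si).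
have -> : 4 * h ^+ (2 * k) = (2 * h ^+ k) * (2 * h ^+ k) by rewrite mul2n -addnn exprD; ring.
have fs_size : size fs = k by rewrite size_map.
have hk : 0 <= 2 * h ^+ k by rewrite mulr_ge0 // exprn_ge0 // ltW.
rewrite -{1}fs_size.
apply: loewner_decay => //.
- move=> _ /mapP[z _ ->] /=; exists (2 * z * (u1 * v0 - u0 * v1)) => p q.
  by rewrite /u /v; ring.
- move=> i; rewrite /den_prod big_map /= prodf_seq_neq0; apply/allP => z zzs /=.
  exact: xz.
- move=> i; rewrite /num_prod big_map /= prodf_seq_neq0; apply/allP => z zzs /=.
  exact: yz.
- move=> i; have [v_neq0 T] := hx _ (xab i).
  apply: le_trans (zsP _ T); rewrite /num_prod /den_prod !big_map /=.
  rewrite -prodf_div normr_prod le_eqVlt; apply/orP; left; apply/eqP.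
  apply: eq_big_seq => z zzs /=.
  have q0 : 0 < u (x i) / v (x i) + z.
    by rewrite addr_gt0 ?(zs_gt0 _ zzs) // (lt_le_trans si) //; case/andP: T.
  rewrite -(gtr0_norm q0) -normf_div; congr `|_|.
  rewrite -/(u (x i)) -/(v (x i)).
  by field; rewrite v_neq0 xz // lt0r_neq0.
- move=> i; have [v_neq0 T] := hy _ (ycd i).
  apply: le_trans (zsP _ T); rewrite /num_prod /den_prod !big_map /=.
  rewrite -prodf_div normr_prod le_eqVlt; apply/orP; left; apply/eqP.
  apply: eq_big_seq => z zzs /=.
  have q0 : 0 < - (u (y i) / v (y i)) + z.
    by rewrite addr_gt0 ?(zs_gt0 _ zzs) // (lt_le_trans si) //; case/andP: T.
  rewrite -(gtr0_norm q0) -normf_div; congr `|_|.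
  rewrite -/(u (y i)) -/(v (y i)).
  by field; rewrite v_neq0 yz // -oppr_eq0 opprD opprK yz.
Qed.

Lemma abs_cross_ratio_gt1 (a b c d : R) : a < b -> c < d -> b < c \/ d < a ->
  1 < abs_cross_ratio a b c d.
Proof.
move=> ab cd; have gap : 0 < (b - a) * (d - c) by rewrite mulr_gt0 ?subr_gt0.
rewrite /abs_cross_ratio; case=> [bc|da].
  rewrite !gtr0_norm ?subr_gt0 //; try lra.
  by rewrite ltr_pdivlMr ?mulr_gt0 ?subr_gt0 //; lra.
rewrite !ltr0_norm ?subr_lt0 //; try lra.
by rewrite !mulrNN ltr_pdivlMr ?nmulr_lgt0 ?subr_lt0 //; lra.
Qed.

(** The root is s = sqrt g + sqrt (g - 1), with inverse sqrt g - sqrt (g - 1).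
    *)
Lemma cross_ratio_root (g : R) : 1 < g -> exists s,
  [/\ 1 < s, (s + s^-1) ^+ 2 = 4 * g & 1 / Num.sqrt g = ascending (s ^- 2)].
Proof.
move=> g1; have g0 : 0 < g := lt_trans ltr01 g1.
pose p := Num.sqrt g; pose q := Num.sqrt (g - 1).
have p2 : p ^+ 2 = g by rewrite sqr_sqrtr // ltW.
have q2 : q ^+ 2 = g - 1 by rewrite sqr_sqrtr // subr_ge0 ltW.
have p0 : 0 < p by rewrite sqrtr_gt0.
have q0 : 0 < q by rewrite sqrtr_gt0 subr_gt0.
have p1 : 1 < p by rewrite -(@ltr_pXn2r _ 2) ?nnegrE ?ltW // p2 expr1n.
have s0 : 0 < p + q by rewrite addr_gt0.
have sV : (p + q)^-1 = p - q.
  apply: (mulfI (lt0r_neq0 s0)); rewrite mulfV ?lt0r_neq0 // [RHS]mulrC -subr_sqr.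
  by rewrite p2 q2; ring.
exists (p + q); split; first by rewrite (lt_trans p1) // ltrDl.
  by rewrite sV -p2; ring.
rewrite /ascending -exprVn sqrtr_sqr gtr0_norm ?invr_gt0 // -/p.
have s2 : (p + q) * (p - q) = 1 by rewrite -sV mulfV // lt0r_neq0.
have d0 : 0 < 1 + (p + q)^-1 ^+ 2 by rewrite addr_gt0 // exprn_gt0 // invr_gt0.
apply/eqP; rewrite eqr_div ?lt0r_neq0 // sV; apply/eqP.
by rewrite -s2; ring.
Qed.

(** All h above the critical value are admissible, and the bound is continuous
    in h, so it holds at the critical value too. *)
Lemma loewner_decay_mu (a b c d : R) n (x y : 'I_n -> R) (r t : 'I_n -> R[i]) m k :
  a < b -> c < d -> b < c \/ d < a ->
  (forall i, a <= x i <= b) -> (forall i, c <= y i <= d) -> (0 < m)%N ->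
  singular_value (loewner_mx x y r t) (m + 2 * k) <=
    4 * expR (pi ^+ 2 / (4 * mu (1 / Num.sqrt (abs_cross_ratio a b c d)))) ^- (2 * k)
      * singular_value (loewner_mx x y r t) m.
Proof.
move=> ab cd sep xab ycd m0.
have [s [s1 cross ->]] := cross_ratio_root (abs_cross_ratio_gt1 ab cd sep).
have s0 : 0 < s := lt_trans ltr01 s1.
have l01 : 0 < s ^- 2 < 1.
  by rewrite invr_gt0 exprn_gt0 //= invf_lt1 ?exprn_gt0 // exprn_egt1.
rewrite grotzsch_mu_landen //; have mu0 := grotzsch_mu_gt0 l01.
have -> : 4 * (mu (s ^- 2) / 2) = 2 * mu (s ^- 2) by field.
rewrite -exprVn -expRN; set h0 := expR _.
have h01 : h0 < 1.
  by rewrite expR_lt1 oppr_lt0 divr_gt0 ?exprn_gt0 ?pi_gt0 // mulr_gt0.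
set S := singular_value _ m.
have lim : (4 * h ^+ (2 * k) * S) @[h --> h0^'+] --> (4 * h0 ^+ (2 * k) * S).
  apply: cvg_at_right_filter; apply: cvgMl; apply: cvgMr.
  exact: exprn_continuous.
rewrite -(cvg_lim _ lim) //; apply: limr_ge; first exact: (cvgP _ lim).
near=> h; apply: (@loewner_interval_decay a b c d s) => //.
apply/andP; split; first by near: h; exact: nbhs_right_gt.
by near: h; exact: nbhs_right_lt.
Unshelve. all: end_near. Qed.

Lemma ascending_symmetric (a b : R) : 0 < a -> a < b ->
  1 / Num.sqrt (abs_cross_ratio a b (- b) (- a)) = ascending (a / b).
Proof.
move=> a0 ab; have b0 := lt_trans a0 ab.
have ab01 : 0 < a / b < 1 by rewrite divr_gt0 //= ltr_pdivrMr // mul1r.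
have /andP[asc0 _] := ascending_lt01 ab01.
rewrite div1r -sqrtrV; last by rewrite divr_ge0 // mulr_ge0.
rewrite -[RHS]gtr0_norm // -sqrtr_sqr; congr Num.sqrt.
rewrite /abs_cross_ratio !ltr0_norm; try lra.
rewrite /ascending expr_div_n exprMn sqr_sqrtr; last by rewrite divr_ge0 // ltW.
by field; rewrite (gt_eqF b0) (gt_eqF (addr_gt0 b0 a0)) /= !lt_eqF //; lra.
Qed.

Lemma grotzsch_mu_cross_ratio_log (g : R) : 1 < g ->
  4 * mu (1 / Num.sqrt g) <= 2 * ln (16 * g).
Proof.
move=> g1; have g0 : 0 < g := lt_trans ltr01 g1.
have s1 : 1 < Num.sqrt g.
  by rewrite -(@ltr_pXn2r _ 2) ?nnegrE ?sqrtr_ge0 // sqr_sqrtr ?expr1n // ltW.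
have s0 : 0 < Num.sqrt g := lt_trans ltr01 s1.
have := @grotzsch_mu_log _ (1 / Num.sqrt g).
rewrite div1r invr_gt0 s0 invf_lt1 // s1 invrK => /(_ isT).
have -> : 16 * g = (4 * Num.sqrt g) ^+ 2.
  by rewrite exprMn sqr_sqrtr ?(ltW g0) //; ring.
rewrite lnXn ?mulr_gt0 // -[ln _ *+ 2]mulr_natl; lra.
Qed.

End Assembly.

End CrossRatio.

Unset Implicit Arguments.
Set Strict Implicit.
Set Printing Implicit Defensive.

Theorem corollary4p3 (R : realType) (a b c d : R) (n : nat)
    (x y : 'I_n -> R) (r s : 'I_n -> R[i]) :
  a < b -> c < d -> (b < c \/ d < a) ->
  (forall i j : 'I_n, (i < j)%N -> x i < x j) ->
  (forall i : 'I_n, a <= x i <= b) ->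
  (forall i j : 'I_n, (i < j)%N -> y i < y j) ->
  (forall i : 'I_n, c <= y i <= d) ->
  let L := loewner_mx x y r s in
  let gamma := abs_cross_ratio a b c d in
  let mu := @grotzsch_mu R in
  [/\ forall j k : nat, (1 <= j)%N -> (j + 2 * k <= n)%N ->
        singular_value L (j + 2 * k) <=
          4 * expR (pi ^+ 2 / (4 * mu (1 / Num.sqrt gamma))) ^- (2 * k)
            * singular_value L j,
      0 < a -> c = - b -> d = - a ->
        2 * mu (1 / Num.sqrt gamma) = mu (a / b)
    & forall j k : nat, (1 <= j)%N -> (j + 2 * k <= n)%N ->
        singular_value L (j + 2 * k) <=
          4 * expR (pi ^+ 2 / (2 * ln (16 * gamma))) ^- (2 * k)
            * singular_value L j].
Proof.
move=> ab cd sep _ xab _ ycd L gamma mu.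
have decay j k : (1 <= j)%N -> singular_value L (j + 2 * k) <=
    4 * expR (pi ^+ 2 / (4 * mu (1 / Num.sqrt gamma))) ^- (2 * k) * singular_value L j.
  by move=> j1; exact: loewner_decay_mu.
split=> [j k j1 _|a0 cE dE|j k j1 _]; first exact: decay.
  have b0 := lt_trans a0 ab.
  rewrite /gamma cE dE ascending_symmetric // /mu grotzsch_mu_landen; first by field.
  by rewrite divr_gt0 //= ltr_pdivrMr // mul1r.
have g1 : 1 < gamma := abs_cross_ratio_gt1 ab cd sep.
have g0 : 0 < gamma := lt_trans ltr01 g1.
have [t [t1 _ tE]] := cross_ratio_root g1.
have t0 : 0 < t := lt_trans ltr01 t1.
have mu0 : 0 < mu (1 / Num.sqrt gamma).
  rewrite tE /mu grotzsch_mu_gt0 // ascending_lt01 // invr_gt0 exprn_gt0 //=.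
  by rewrite invf_lt1 ?exprn_gt0 // exprn_egt1.
have mu_log := grotzsch_mu_cross_ratio_log g1.
apply: le_trans (decay j k j1) _.
rewrite ler_wpM2r ?singular_value_ge0 // ler_pM2l //.
rewrite lef_pV2 ?posrE ?exprn_gt0 ?expR_gt0 // lerXn2r ?nnegrE ?expR_ge0 // ler_expR.
have mu4 : 0 < 4 * mu (1 / Num.sqrt gamma) by rewrite mulr_gt0.
by rewrite ler_pM2l ?exprn_gt0 ?pi_gt0 // lef_pV2 ?posrE // (lt_le_trans mu4).
Qed.
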